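(* $e^+$-\textsc{Internal Vertex SubTree} has a polynomial kernel of size $2k$. That is, given a reoptimization instance $((G,k),T,(G+e,k))$, one can compute in polynomial time a kernel of size at most $2k$ for the instance $(G+e,k)$ of \textsc{Internal Vertex SubTree}.
   Context: A subtree of a graph $G$ is a (not necessarily induced) subgraph that is a tree; internal vertices are those of degree greater than $1$. \textsc{Internal Vertex SubTree}: given a graph $G$ and integer $k$, decide whether $G$ contains a subtree with at least $k$ internal vertices. A kernel for an instance $(x,k)$ of a parameterized problem $L$ is an instance $(x',k')$, computed in polynomial time, with $(x,k)\in L\iff(x',k')\in L$ and $|x'|,k'$ bounded by a function of $k$ (the size of the kernel). In the reoptimization problem $e^+$-\textsc{Internal Vertex SubTree}, an instance is $((G,k),T,(G+e,k))$ where $G$ is a graph, $e$ is a pair of non-adjacent vertices of $G$, $G+e$ is $G$ with the edge $e$ added, and $T$ is a subtree of $G$ with at least $k$ internal vertices if one exists (otherwise $T$ is a trivial tree / indicates that none exists); the instance is a yes-instance iff $(G+e,k)$ is a yes-instance of \textsc{Internal Vertex SubTree}, and a kernel for it means a kernel for $(G+e,k)$.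
   Formalization: The kernel size bound is max(1, 2k) instead of 2k: for k = 0 the instance (G+e, 0) is always a yes-instance, while a graph with no vertices contains no tree, so a kernel of size 0 is impossible; for k ≥ 1 the bound is exactly 2k. *)

(* Defs.v *)
From mathcomp Require Import all_boot.

Set Implicit Arguments.
Unset Strict Implicit.
Unset Printing Implicit Defensive.

(** * Graphs, subtrees, Internal Vertex SubTree *)

(* As inputs of algorithms, graphs have vertex set {0, ..., nvert - 1}. *)
Record graph := Graph {
  nvert : nat;
  adj : rel 'I_nvert;
  adj_sym : symmetric adj;
  adj_irr : irreflexive adj }.

Record subgraph (G : graph) := Subgraph {
  sverts : {set 'I_(nvert G)};
  sadj : rel 'I_(nvert G);
  sadj_sym : symmetric sadj;
  sadj_adj : forall x y, sadj x y -> adj x y;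
  sadj_verts : forall x y, sadj x y -> (x \in sverts) && (y \in sverts) }.

Section Subgraphs.
Variables (G : graph) (T : subgraph G).

Definition connected : Prop :=
  sverts T != set0 /\ {in sverts T &, forall x y, connect (@sadj _ T) x y}.

(* [ucycle] alone accepts the one-edge walk [:: x; y]; the cycles of a simple
   graph are those with at least three vertices. *)
Definition acyclic : Prop :=
  forall c : seq 'I_(nvert G), ucycle (@sadj _ T) c -> size c <= 2.

Definition is_tree : Prop := connected /\ acyclic.

Definition degree (x : 'I_(nvert G)) : nat := #|[set y | sadj T x y]|.

Definition internal : {set 'I_(nvert G)} :=
  [set x in sverts T | 1 < degree x].

End Subgraphs.

Definition ivst_instance : Type := (graph * nat)%type.

Definition ivst_yes (I : ivst_instance) : Prop :=
  exists T : subgraph I.1, is_tree T /\ I.2 <= #|internal T|.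

(** * Reoptimization under edge addition *)

Section AddEdge.
Variables (G : graph) (u v : 'I_(nvert G)).

Definition add_rel : rel 'I_(nvert G) := fun x y =>
  [|| adj x y, (x == u) && (y == v) | (x == v) && (y == u)].

Lemma add_rel_sym : symmetric add_rel.
Proof. by move=> x y; rewrite /add_rel adj_sym andbC [in X in _ || X]orbC andbC. Qed.

Lemma add_rel_irr (uv : u != v) : irreflexive add_rel.
Proof.
move=> x; rewrite /add_rel adj_irr /= [X in _ || X]andbC orbb.
by apply/negP=> /andP[/eqP-> /eqP uv']; rewrite uv' eqxx in uv.
Qed.

Definition add_edge (uv : u != v) : graph :=
  Graph add_rel_sym (add_rel_irr uv).

End AddEdge.

Record reopt_instance := Reopt {
  r_graph : graph;
  r_param : nat;
  r_tree : subgraph r_graph;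
  r_u : 'I_(nvert r_graph);
  r_v : 'I_(nvert r_graph);
  r_neq : r_u != r_v;
  r_nonadj : ~~ adj r_u r_v;
  r_is_tree : is_tree r_tree;
  r_solution : ivst_yes (r_graph, r_param) -> r_param <= #|internal r_tree|;
  r_trivial : ~ ivst_yes (r_graph, r_param) -> #|sverts r_tree| = 1 }.

Definition r_new (I : reopt_instance) : ivst_instance :=
  (add_edge (r_neq I), r_param I).

(* [J] is a kernel, of size at most [s], for the instance [I].  The size of a
   graph is its number of vertices. *)
Definition kernel_for (I J : ivst_instance) (s : nat) : Prop :=
  [/\ ivst_yes I <-> ivst_yes J, nvert J.1 <= s & J.2 <= s].

(** * Polynomial time

    The machine model is the WHILE language over binary trees (N. D. Jones,
    Computability and Complexity from a Programming Perspective), except that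
    reading a variable is charged the full size of its value.  Hence a run of
    cost [t] only ever builds values of size at most (input size) + [t], and
    polynomial time is the same as on Turing machines even when trees are
    copied without sharing. *)

Inductive tree := Nil | Cons of tree & tree.

Fixpoint tsize (t : tree) : nat :=
  if t is Cons a b then (tsize a + tsize b).+1 else 1.

Definition thd (t : tree) : tree := if t is Cons a _ then a else Nil.
Definition ttl (t : tree) : tree := if t is Cons _ b then b else Nil.

Definition store := nat -> tree.

Definition update (s : store) (x : nat) (a : tree) : store :=
  fun y => if y == x then a else s y.

Inductive expr :=
  | EVar of nat
  | ENil
  | ECons of expr & expr
  | EHd of expr
  | ETl of expr.

Fixpoint eval (s : store) (e : expr) : tree :=
  match e with
  | EVar x => s x
  | ENil => Nil
  | ECons a b => Cons (eval s a) (eval s b)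
  | EHd a => thd (eval s a)
  | ETl a => ttl (eval s a)
  end.

Fixpoint ecost (s : store) (e : expr) : nat :=
  match e with
  | EVar x => tsize (s x)
  | ENil => 1
  | ECons a b => (ecost s a + ecost s b).+1
  | EHd a => (ecost s a).+1
  | ETl a => (ecost s a).+1
  end.

Inductive cmd :=
  | Skip
  | Assign of nat & expr
  | Seq of cmd & cmd
  | If of expr & cmd & cmd
  | While of expr & cmd.

(* Tests succeed on non-[Nil] values.  [exec c s t s']: started in [s], the
   command [c] halts in [s'] after time [t]. *)
Inductive exec : cmd -> store -> nat -> store -> Prop :=
  | ExSkip s : exec Skip s 1 s
  | ExAssign s x e :
      exec (Assign x e) s (ecost s e).+1 (update s x (eval s e))
  | ExSeq s s1 s2 c1 c2 t1 t2 :
      exec c1 s t1 s1 -> exec c2 s1 t2 s2 ->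
      exec (Seq c1 c2) s (t1 + t2).+1 s2
  | ExIfTrue s s1 e c1 c2 t : eval s e <> Nil -> exec c1 s t s1 ->
      exec (If e c1 c2) s (ecost s e + t).+1 s1
  | ExIfFalse s s1 e c1 c2 t : eval s e = Nil -> exec c2 s t s1 ->
      exec (If e c1 c2) s (ecost s e + t).+1 s1
  | ExWhileFalse s e c : eval s e = Nil ->
      exec (While e c) s (ecost s e).+1 s
  | ExWhileTrue s s1 s2 e c t1 t2 : eval s e <> Nil -> exec c s t1 s1 ->
      exec (While e c) s1 t2 s2 ->
      exec (While e c) s (ecost s e + t1 + t2).+1 s2.

Definition init (a : tree) : store := update (fun=> Nil) 0 a.

(* Input and output are both in variable 0; since [tsize] is positive, every
   polynomial is dominated by some [C * _ ^ d]. *)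
Definition polytime (A B : Type) (encA : A -> tree) (encB : B -> tree)
    (f : A -> B) : Prop :=
  exists (p : cmd) (C d : nat), forall a : A, exists (t : nat) (s : store),
    [/\ exec p (init (encA a)) t s,
        s 0 = encB (f a) &
        t <= C * tsize (encA a) ^ d].

(** * Encodings

    Graphs are given by adjacency matrices; the parameter is in unary, so that
    the size of an instance (x, k) is of the order of |x| + k. *)

Definition enc_bool (b : bool) : tree := if b then Cons Nil Nil else Nil.
Definition enc_nat (n : nat) : tree := iter n (Cons Nil) Nil.
Definition enc_seq (s : seq tree) : tree := foldr Cons Nil s.

Definition enc_pred (n : nat) (p : pred 'I_n) : tree :=
  enc_seq [seq enc_bool (p i) | i <- enum 'I_n].
Definition enc_rel (n : nat) (r : rel 'I_n) : tree :=
  enc_seq [seq enc_pred (r i) | i <- enum 'I_n].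

Definition enc_graph (G : graph) : tree := enc_rel (@adj G).
Definition enc_subgraph (G : graph) (T : subgraph G) : tree :=
  Cons (enc_pred (fun x => x \in sverts T)) (enc_rel (@sadj G T)).
Definition enc_ivst (I : ivst_instance) : tree :=
  Cons (enc_graph I.1) (enc_nat I.2).
Definition enc_reopt (I : reopt_instance) : tree :=
  Cons (enc_ivst (r_graph I, r_param I))
       (Cons (enc_subgraph (r_tree I)) (enc_ivst (r_new I))).

(* Main.v *)
Require Import Defs.
From mathcomp Require Import all_boot.
From mathcomp Require Import zify.
Import Defs.

Set Implicit Arguments.
Unset Strict Implicit.
Unset Printing Implicit Defensive.

(* If [k = 0] or the given subtree has at least two vertices, it is a solution
   and the answer is a trivial yes-instance.  Otherwise [G] has no solution, so
   every solution of [G + e] contains [e] and lives in the component [H] of [e].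

   Call [Y] dense if it is nonempty and [#|Y| >= 2 * #|N(Y)|].  A minimal dense
   set [Y] is independent with [#|Y| = 2 * #|N(Y)|], and for [y] in [Y], Hall's
   theorem splits [Y - y] into a part matched perfectly to [N(Y)] and a part
   whose members, read as edges between two of their neighbors, form a spanning
   tree of [N(Y)].  This yields a subtree on [N(Y)] and [Y - y] with as many
   internal vertices as any tree can have on [N(Y)] and [Y], so deleting [y]
   does not change the maximum number of internal vertices.

   If no set is dense, then [H] has a spanning tree in which at least half of
   the vertices (rounded down) are internal: the leaves of an optimal tree form
   an independent set [L], which splits likewise into a matched part and a
   forest part, and every spanning tree containing the resulting forest has at
   least [#|L|] internal vertices.  Hence more than [2k] remaining vertices
   mean a yes-instance.

   Dense sets are detected by an auction algorithm for bipartite matching, and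
   polynomial time is derived from closure properties of polynomial-time
   functions between encoded types. *)

(** * Polynomial-time functions *)

(** The factor 2 in density is the source of the bound 2k: without dense sets about half of the
    vertices can be made internal. Absence of dense sets is a strict Hall condition for the
    bipartite graph in which every neighbor is offered twice. Strictness is used twice. It makes the
    test possible, since it becomes an ordinary Hall condition once a single vertex is also doubled
    on the other side. It also builds the forest part, since it always yields a vertex with a
    neighbor among those already reached. The auction suits the machine model: a round is a local
    update of a list that enlarges the state by a constant, and a final state with a bidder left
    over exhibits a Hall violator. The same code thus serves as algorithm and as proof of the
    matching theorem. The obstacle for polynomial time is that a loop may double its data in every
    round. All loops are therefore folds whose step enlarges the accumulator by an amount
    independent of the accumulator. *)

Class encoding (A : Type) := enc : A -> tree.

#[global] Instance bool_encoding : encoding bool := enc_bool.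
#[global] Instance unit_encoding : encoding unit := fun=> Nil.
#[global] Instance nat_encoding : encoding nat := enc_nat.
#[global] Instance prod_encoding A B {eA : encoding A} {eB : encoding B} :
  encoding (A * B) := fun x => Cons (enc x.1) (enc x.2).
#[global] Instance seq_encoding A {eA : encoding A} : encoding (seq A) :=
  fun s => enc_seq [seq enc x | x <- s].

Definition esize A {eA : encoding A} (a : A) : nat := tsize (enc a).

Lemma tsize_gt0 a : 0 < tsize a. Proof. by case: a. Qed.

Lemma esize_gt0 A {eA : encoding A} (a : A) : 0 < esize a.
Proof. exact: tsize_gt0. Qed.

Lemma esize_pair A B {eA : encoding A} {eB : encoding B} (x : A * B) :
  esize x = (esize x.1 + esize x.2).+1.
Proof. by []. Qed.

Lemma esize_cons A {eA : encoding A} (x : A) s :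
  esize (x :: s) = (esize x + esize s).+1.
Proof. by []. Qed.

Lemma esize_nil A {eA : encoding A} : esize ([::] : seq A) = 1.
Proof. by []. Qed.

Lemma esize_cat A {eA : encoding A} (s1 s2 : seq A) :
  (esize (s1 ++ s2)).+1 = esize s1 + esize s2.
Proof.
elim: s1 => [|x s1 IH] /=; first by rewrite esize_nil.
by rewrite !esize_cons; lia.
Qed.

Lemma esize_catl A {eA : encoding A} (s1 s2 : seq A) :
  esize s1 <= esize (s1 ++ s2).
Proof.
by rewrite -ltnS esize_cat -addn1 leq_add2l; apply: esize_gt0.
Qed.

Lemma esize_catr A {eA : encoding A} (s1 s2 : seq A) :
  esize s2 <= esize (s1 ++ s2).
Proof.
by rewrite -ltnS esize_cat -add1n leq_add2r; apply: esize_gt0.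
Qed.

Lemma size_esize A {eA : encoding A} (s : seq A) : size s < esize s.
Proof. by elim: s => // x s IH; rewrite esize_cons /=; lia. Qed.

Lemma esize_filter A {eA : encoding A} (p : pred A) s :
  esize [seq x <- s | p x] <= esize s.
Proof.
elim: s => // x s IH /=; case: ifP => _; rewrite !esize_cons; lia.
Qed.

(** Monotonicity lets a bound be applied to an upper estimate of a size, as composition requires.
    The condition [0 < n] costs nothing, since encodings have positive size, and it keeps [n ^ d]
    monotone in [d]. *)
Definition poly_bounded (b : nat -> nat) : Prop :=
  {homo b : x y / x <= y} /\
  exists C d, forall n, 0 < n -> b n <= C * n ^ d.

Lemma poly_bounded_const c : poly_bounded (fun=> c).
Proof. by split=> //; exists c, 0 => n _; rewrite expn0 muln1. Qed.

Lemma poly_bounded_id : poly_bounded id.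
Proof. by split=> //; exists 1, 1 => n _; rewrite expn1 mul1n. Qed.

Lemma poly_bounded_add b1 b2 :
  poly_bounded b1 -> poly_bounded b2 -> poly_bounded (fun n => b1 n + b2 n).
Proof.
move=> [m1 [C1 [d1 H1]]] [m2 [C2 [d2 H2]]].
split=> [x y xy|]; first by rewrite leq_add ?m1 ?m2.
exists (C1 + C2), (d1 + d2) => n n0.
have := H1 n n0; have := H2 n n0.
have : n ^ d1 <= n ^ (d1 + d2) by rewrite leq_pexp2l // leq_addr.
have : n ^ d2 <= n ^ (d1 + d2) by rewrite leq_pexp2l // leq_addl.
nia.
Qed.

Lemma poly_bounded_mul b1 b2 :
  poly_bounded b1 -> poly_bounded b2 -> poly_bounded (fun n => b1 n * b2 n).
Proof.
move=> [m1 [C1 [d1 H1]]] [m2 [C2 [d2 H2]]].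
split=> [x y xy|]; first by rewrite leq_mul ?m1 ?m2.
exists (C1 * C2), (d1 + d2) => n n0.
by rewrite expnD mulnACA leq_mul ?H1 ?H2.
Qed.

Lemma poly_bounded_comp b1 b2 :
  poly_bounded b1 -> poly_bounded b2 -> poly_bounded (fun n => b1 (b2 n)).
Proof.
move=> [m1 [C1 [d1 H1]]] [m2 [C2 [d2 H2]]].
split=> [x y xy|]; first by rewrite m1 ?m2.
exists (C1 * C2.+1 ^ d1), (d2 * d1) => n n0.
have le : b2 n <= C2.+1 * n ^ d2.
  by apply: leq_trans (H2 n n0) _; rewrite leq_mul.
apply: leq_trans (m1 _ _ le) _.
have pos : 0 < C2.+1 * n ^ d2 by rewrite muln_gt0 expn_gt0 n0.
by apply: leq_trans (H1 _ pos) _; rewrite expnMn -expnM mulnA.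
Qed.

Ltac poly_bound :=
  repeat first [ assumption
    | exact: poly_bounded_const | exact: poly_bounded_id
    | apply: poly_bounded_add | apply: poly_bounded_mul
    | apply: poly_bounded_comp ].

(* Variables below [m] serve as scratch space; as they may hold leftovers of
   earlier computations, the bound must not depend on their initial values. *)
Definition polyf A B {eA : encoding A} {eB : encoding B} (f : A -> B) : Prop :=
  exists (c : cmd) (m : nat) (b : nat -> nat), poly_bounded b /\
  forall a s, s 0 = enc a -> exists t s',
    [/\ exec c s t s', s' 0 = enc (f a),
        forall y, 0 < y -> m <= y -> s' y = s y & t <= b (esize a)].

Lemma polyf_polytime A B {eA : encoding A} {eB : encoding B} (f : A -> B) :
  polyf f -> polytime enc enc f.
Proof.
move=> [c [m [b [[_ [C [d Hb]]] H]]]]; exists c, C, d => a.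
have [//|t [s' [He H0 _ Ht]]] := H a (init (enc a)).
by exists t, s'; split=> //; apply: leq_trans Ht (Hb _ (esize_gt0 _)).
Qed.

Lemma eval_size s e : tsize (eval s e) <= ecost s e.
Proof.
elim: e => //= [e1 IH1 e2 IH2|e IH|e IH]; first by lia.
  by case: (eval s e) IH => //= a b; lia.
by case: (eval s e) IH => //= a b; lia.
Qed.

Lemma exec_size c s t s' y : exec c s t s' -> tsize (s' y) <= tsize (s y) + t.
Proof.
elim=> {c s t s'} [s|s x e||||s e|] *; try by lia.
by rewrite /update; case: ifP => _; [have := eval_size s e|]; lia.
Qed.

(** A run builds values no larger than its input plus its cost, so a time bound also bounds the
    output. Composition needs this, because the second program is charged in terms of the
    intermediate value. *)
Lemma polyf_size A B {eA : encoding A} {eB : encoding B} (f : A -> B) :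
  polyf f -> exists b, poly_bounded b /\ forall a, esize (f a) <= b (esize a).
Proof.
move=> [c [m [b [pb H]]]]; exists (fun n => n + b n); split; first by poly_bound.
move=> a; have [//|t [s' [He H0 _ Ht]]] := H a (init (enc a)).
by have := exec_size 0 He; rewrite H0 /init /update /=;
  move: Ht; rewrite /esize; lia.
Qed.

Lemma polyf_ext A B {eA : encoding A} {eB : encoding B} (f g : A -> B) : f =1 g -> polyf f -> polyf g.
Proof.
move=> fg [c [m [b [pb H]]]]; exists c, m, b; split=> // a s sa.
by rewrite -fg; exact: H.
Qed.

Lemma polyf_assign A B {eA : encoding A} {eB : encoding B} (f : A -> B) e (b : nat -> nat) : poly_bounded b ->
  (forall a s, s 0 = enc a -> eval s e = enc (f a) /\ ecost s e <= b (esize a)) ->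
  polyf f.
Proof.
move=> pb H; exists (Assign 0 e), 1, (fun n => b n + 1); split; first by poly_bound.
move=> a s sa; have [ev co] := H a s sa.
exists (ecost s e).+1, (update s 0 (eval s e)); split.
- exact: ExAssign.
- by rewrite /update /= ev.
- by move=> y y0 _; rewrite /update; case: y y0.
- by lia.
Qed.

Section Basic.
Context {A B C : Type} {eA : encoding A} {eB : encoding B} {eC : encoding C}.

Lemma polyf_id : polyf (@id A).
Proof.
by apply: (@polyf_assign _ _ _ _ _ (EVar 0) id) => [|a s sa /=]; [poly_bound|rewrite sa].
Qed.

Fixpoint const_expr (t : tree) : expr :=
  if t is Cons a b then ECons (const_expr a) (const_expr b) else ENil.

Lemma const_exprE s t : eval s (const_expr t) = t.
Proof. by elim: t => //= a -> b ->. Qed.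

Lemma const_cost s t : ecost s (const_expr t) = tsize t.
Proof. by elim: t => //= a -> b ->. Qed.

Lemma polyf_const (y : B) : polyf (fun _ : A => y).
Proof.
apply: (@polyf_assign _ _ _ _ _ (const_expr (enc y)) (fun=> esize y)); first by poly_bound.
by move=> a s _; rewrite const_exprE const_cost.
Qed.

Lemma polyf_fst : polyf (@fst A B).
Proof.
apply: (@polyf_assign _ _ _ _ _ (EHd (EVar 0)) (fun n => n + 1)); first by poly_bound.
by move=> a s sa /=; rewrite sa /= addn1.
Qed.

Lemma polyf_snd : polyf (@snd A B).
Proof.
apply: (@polyf_assign _ _ _ _ _ (ETl (EVar 0)) (fun n => n + 1)); first by poly_bound.
by move=> a s sa /=; rewrite sa /= addn1.
Qed.

Lemma polyf_comp (g : B -> C) (f : A -> B) :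
  polyf g -> polyf f -> polyf (fun x => g (f x)).
Proof.
move=> [cg [mg [bg [pbg Hg]]]] pf; have [bs [pbs Hs]] := polyf_size pf.
move: pf => [cf [mf [bf [pbf Hf]]]].
exists (Seq cf cg), (maxn mf mg), (fun n => bf n + bg (bs n) + 1).
split; first by poly_bound.
move=> a s sa; have [t1 [s1 [e1 v1 f1 l1]]] := Hf a s sa.
have [t2 [s2 [e2 v2 f2 l2]]] := Hg (f a) s1 v1.
exists (t1 + t2).+1, s2; split=> //.
- exact: ExSeq e1 e2.
- by move=> y y0; rewrite geq_max => /andP[? ?]; rewrite f2 // f1.
- have := (pbg.1 _ _ (Hs a)); lia.
Qed.

Definition save (x : nat) : cmd := Assign x (EVar 0).
Definition load (x : nat) : cmd := Assign 0 (EVar x).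

Lemma exec_save s x : exec (save x) s (tsize (s 0)).+1 (update s x (s 0)).
Proof. exact: (ExAssign s x (EVar 0)). Qed.

Lemma exec_load s x : exec (load x) s (tsize (s x)).+1 (update s 0 (s x)).
Proof. exact: (ExAssign s 0 (EVar x)). Qed.

End Basic.

(** * Pairing, branching and bounded loops *)

Section Combinators.
Context {A B C X : Type} {eA : encoding A} {eB : encoding B} {eC : encoding C}.
Context {eX : encoding X}.

Lemma polyf_pair (f : X -> A) (g : X -> B) :
  polyf f -> polyf g -> polyf (fun x => (f x, g x)).
Proof.
move=> pf pg; have [bs [pbs Hs]] := polyf_size pf.
have [bt [pbt Ht]] := polyf_size pg.
move: pf pg => [cf [mf [bf [pbf Hf]]]] [cg [mg [bg [pbg Hg]]]].
pose m := (maxn mf mg).+1.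
(* Register [m] keeps the input and [m.+1] the first result; both lie outside the scratch space of
   [cf] and [cg]. *)
exists (Seq (save m) (Seq cf (Seq (save m.+1) (Seq (load m)
  (Seq cg (Assign 0 (ECons (EVar m.+1) (EVar 0)))))))), m.+2,
  (fun n => n + bf n + bs n + n + bg n + bs n + bt n + 11).
split; first by poly_bound.
move=> x s sx.
have [t1 [s1 [e1 v1 f1 l1]]] := Hf x (update s m (s 0)) sx.
have [|t2 [s2 [e2 v2 f2 l2]]] := Hg x
  (update (update s1 m.+1 (s1 0)) 0 (update s1 m.+1 (s1 0) m)).
  rewrite /update /= (ltn_eqF (ltnSn m)) f1 //; last by rewrite /m; lia.
  by rewrite /update eqxx.
have w : s2 m.+1 = enc (f x).
  by rewrite f2 //; [rewrite /update /= eqxx|rewrite /m; lia].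
eexists; eexists; split.
- apply: ExSeq (exec_save _ _) _; apply: ExSeq e1 _.
  apply: ExSeq (exec_save _ _) _; apply: ExSeq (exec_load _ _) _.
  by apply: ExSeq e2 _; apply: ExAssign.
- by rewrite /update /= w v2.
- move=> y y0 my; rewrite /update /= gtn_eqF // f2 //; last by move: my; rewrite /m; lia.
  rewrite /update gtn_eqF //= gtn_eqF // f1 //; last by move: my; rewrite /m; lia.
  by rewrite /update gtn_eqF // ltnW.
- rewrite /= w v1 v2 sx /update (ltn_eqF (ltnSn m)) f1 //; last by rewrite /m; lia.
  rewrite /update eqxx sx /=.
  by have := Hs x; have := Ht x; rewrite /esize; move: l1 l2; rewrite /esize; lia.
Qed.

Lemma polyf_if (h : X -> bool) (f g : X -> A) :
  polyf h -> polyf f -> polyf g -> polyf (fun x => if h x then f x else g x).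
Proof.
move=> [ch [mh [bh [pbh Hh]]]] [cf [mf [bf [pbf Hf]]]] [cg [mg [bg [pbg Hg]]]].
pose m := (maxn mh (maxn mf mg)).+1.
exists (Seq (save m) (Seq ch (If (EVar 0) (Seq (load m) cf) (Seq (load m) cg)))),
  m.+1, (fun n => n + bh n + 3 + n + bf n + bg n + 10).
split; first by poly_bound.
move=> x s sx.
have [t1 [s1 [e1 v1 f1 l1]]] := Hh x (update s m (s 0)) sx.
have vm : s1 m = enc x by rewrite f1 //; [rewrite /update eqxx|rewrite /m; lia].
have [t2 [s2 [e2 v2 f2 l2]]] := Hf x (update s1 0 (s1 m)) vm.
have [t3 [s3 [e3 v3 f3 l3]]] := Hg x (update s1 0 (s1 m)) vm.
have frame s' mc : mc <= maxn mf mg ->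
    (forall y, 0 < y -> mc <= y -> s' y = update s1 0 (s1 m) y) ->
    forall y, 0 < y -> m < y -> s' y = s y.
  move=> mm F y y0 my; rewrite F //; last by move: my; rewrite /m; lia.
  rewrite /update gtn_eqF //= f1 //; last by move: my; rewrite /m; lia.
  by rewrite /update gtn_eqF.
case hx: (h x) in v1 *.
- eexists; eexists; split; first apply: ExSeq (exec_save _ _) _.
    by apply: ExSeq e1 _; apply: ExIfTrue (ExSeq (exec_load _ _) e2);
      rewrite /= v1.
  + by rewrite v2.
  + exact: (frame _ _ (leq_maxl _ _) f2).
  + by rewrite /= v1 vm sx /=; move: l1 l2 l3; rewrite /esize; lia.
- eexists; eexists; split; first apply: ExSeq (exec_save _ _) _.
    by apply: ExSeq e1 _; apply: ExIfFalse (ExSeq (exec_load _ _) e3);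
      rewrite /= v1.
  + by rewrite v3.
  + exact: (frame _ _ (leq_maxr _ _) f3).
  + by rewrite /= v1 vm sx /=; move: l1 l2 l3; rewrite /esize; lia.
Qed.

Lemma foldl_esize (q : nat -> nat) (n : nat) (step : A -> B -> B) b l :
  {homo q : x y / x <= y} ->
  (forall a b, esize (step a b) <= esize b + q (n + esize a)) ->
  esize (foldl (fun b a => step a b) b l) <= esize b + size l * q (n + esize l).
Proof.
move=> mq H; elim: l b => [|a l IH] b /=; first by rewrite addn0.
apply: leq_trans (IH _) _; have := H a b; rewrite esize_cons => h.
have h1 : q (n + esize l) <= q (n + (esize a + esize l).+1) by apply: mq; lia.
have h2 : q (n + esize a) <= q (n + (esize a + esize l).+1) by apply: mq; lia.
have := leq_mul (leqnn (size l)) h1; lia.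
Qed.

(** The growth allowed to a step depends on the parameter and the current element only. Growth
    proportional to the accumulator could produce exponential size after linearly many rounds. *)
Lemma polyf_foldl (l : X -> seq A) (i : X -> B) (step : X -> A -> B -> B) q :
  poly_bounded q ->
  (forall x a b, esize (step x a b) <= esize b + q (esize x + esize a)) ->
  polyf l -> polyf i -> polyf (fun p : X * (A * B) => step p.1 p.2.1 p.2.2) ->
  polyf (fun x => foldl (fun b a => step x a b) (i x) (l x)).
Proof.
move=> pq Hq pl pi; have [bsl [pbsl Hsl]] := polyf_size pl.
have [bsi [pbsi Hsi]] := polyf_size pi; move: pl pi.
move=> [cl [ml [bl [pbl Hl]]]] [ci [mi [bi [pbi Hi]]]] [cs [ms [bs [pbs Hs]]]].
pose m := (maxn ml (maxn mi ms)).+1.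
have m1 : m <= m.+1 by lia.
have m2 : m <= m.+2 by lia.
(* The registers [m], [m.+1] and [m.+2] hold the parameter, the elements still to be processed and
   the accumulator. *)
pose body := Seq (Assign 0 (ECons (EVar m) (ECons (EHd (EVar m.+1)) (EVar m.+2))))
  (Seq cs (Seq (save m.+2) (Assign m.+1 (ETl (EVar m.+1))))).
(* [B1] bounds the accumulator, [B2] the cost of one round of the loop. *)
pose B1 n := bsi n + bsl n * q (n + bsl n).
pose B2 n := bs (n + bsl n + B1 n + 2) + n + 3 * bsl n + 2 * B1 n + 12.
have pB1 : poly_bounded B1 by rewrite /B1; poly_bound.
have pB2 : poly_bounded B2 by rewrite /B2; poly_bound.
exists (Seq (save m) (Seq cl (Seq (save m.+1) (Seq (load m) (Seq ci
  (Seq (save m.+2) (Seq (While (EVar m.+1) body) (load m.+2)))))))), m.+3,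
  (fun n => n + bl n + bsl n + n + bi n + bsi n + (bsl n * B2 n + bsl n) + B1 n + 30).
split; first by poly_bound.
move=> x s sx.
have acc_size l0 l1 : l x = l0 ++ l1 ->
    esize (foldl (fun b a => step x a b) (i x) l0) <= B1 (esize x).
  move=> lx; apply: leq_trans (foldl_esize _ _ pq.1 (Hq x)) _.
  have h : esize l0 <= bsl (esize x).
    by apply: leq_trans (Hsl x); rewrite lx esize_catl.
  rewrite leq_add ?Hsi // leq_mul ?pq.1 ?leq_add2l //.
  by apply: leq_trans h; apply/ltnW/size_esize.
(* The accumulator is described as the fold over the processed prefix [l0], so that [acc_size] gives
   the same bound in every round. *)
have loop l1 : forall l0 b s0, l x = l0 ++ l1 ->
    b = foldl (fun b a => step x a b) (i x) l0 ->
    s0 m = enc x -> s0 m.+1 = enc l1 -> s0 m.+2 = enc b ->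
    exists t s', [/\ exec (While (EVar m.+1) body) s0 t s',
      s' m.+2 = enc (foldl (fun b a => step x a b) b l1),
      forall y, 0 < y -> m.+3 <= y -> s' y = s0 y &
      t <= size l1 * B2 (esize x) + 2].
  elim: l1 => [|a l1 IH] l0 b s0 lx bE w w1 w2.
    exists (ecost s0 (EVar m.+1)).+1, s0; split=> //; last by rewrite /= w1.
    by apply: ExWhileFalse; rewrite /= w1.
  have lx' : l x = rcons l0 a ++ l1 by rewrite cat_rcons.
  have bE' : step x a b = foldl (fun b a => step x a b) (i x) (rcons l0 a).
    by rewrite foldl_rcons -bE.
  have sb := acc_size _ _ lx; rewrite -bE in sb.
  have sb' := acc_size _ _ lx'; rewrite -bE' in sb'.
  have sl1 : esize (a :: l1) <= bsl (esize x).
    by apply: leq_trans (Hsl x); rewrite lx esize_catr.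
  pose s3 := update s0 0 (Cons (s0 m) (Cons (thd (s0 m.+1)) (s0 m.+2))).
  have s30 : s3 0 = enc (x, (a, b)) by rewrite /s3 /update w w1 w2.
  have [t4 [s4 [e4 v4 f4 l4]]] := Hs (x, (a, b)) s3 s30.
  have f4' y : m <= y -> s4 y = s0 y.
    move=> my; have y0 : 0 < y by apply: leq_trans my.
    rewrite f4 //; last by move: my; rewrite /m; lia.
    by rewrite /s3 /update gtn_eqF.
  pose s5 := update (update s4 m.+2 (s4 0)) m.+1 (ttl (s0 m.+1)).
  have e5 : exec body s0
     ((ecost s0 (ECons (EVar m) (ECons (EHd (EVar m.+1)) (EVar m.+2)))).+1 +
      (t4 + (((tsize (s4 0)).+1 + (tsize (s4 m.+1)).+2).+1)).+1).+1 s5.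
    apply: ExSeq; first exact: ExAssign.
    have -> : eval s0 (ECons (EVar m) (ECons (EHd (EVar m.+1)) (EVar m.+2))) = s3 0.
      by [].
    apply: ExSeq e4 _; apply: ExSeq; first exact: exec_save.
    have <- : ecost (update s4 m.+2 (s4 0)) (ETl (EVar m.+1)) = (tsize (s4 m.+1)).+1.
      by rewrite /= /update ltn_eqF.
    have -> : s5 = update (update s4 m.+2 (s4 0)) m.+1
        (eval (update s4 m.+2 (s4 0)) (ETl (EVar m.+1))).
      by rewrite /s5; congr update; rewrite /= /update ltn_eqF // (f4' _ m1).
    exact: ExAssign.
  have [|||t6 [s6 [e6 v6 f6 l6]]] := IH (rcons l0 a) _ s5 lx' bE'.
  - by rewrite /s5 /update !ltn_eqF // f4'.
  - by rewrite /s5 /update eqxx w1.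
  - by rewrite /s5 /update gtn_eqF // eqxx v4.
  eexists; exists s6; split.
  - apply: ExWhileTrue e5 e6; by rewrite /= w1.
  - by [].
  - move=> y y0 my; rewrite f6 // /s5 /update !gtn_eqF ?f4' //; lia.
  - rewrite /= w w1 w2 v4 f4' // w1 mulSn.
    have : t4 <= bs (esize x + bsl (esize x) + B1 (esize x) + 2).
      apply: leq_trans l4 _; apply: pbs.1; rewrite !esize_pair /=.
      by move: sl1; rewrite esize_cons; lia.
    move: sb sb' sl1 l6; rewrite esize_cons {2}/B2 /esize /=.
    have -> : enc_seq [seq enc z | z <- l1] = enc l1 by [].
    lia.
have [t1 [s1 [e1 v1 f1 l1]]] := Hl x (update s m (s 0)) sx.
have vm : s1 m = enc x by rewrite f1 //; [rewrite /update eqxx|rewrite /m; lia].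
pose s2 := update s1 m.+1 (s1 0).
have [t2 [s3 [e3 v3 f3 l3]]] := Hi x (update s2 0 (s1 m)) vm.
have f3' y : m <= y -> s3 y = s2 y.
  move=> my; have y0 : 0 < y by apply: leq_trans my.
  rewrite f3 //; last by move: my; rewrite /m; lia.
  by rewrite /update gtn_eqF.
have [|||t4 [s4 [e4 v4 f4 l4]]] :=
    loop _ [::] (i x) (update s3 m.+2 (s3 0)) erefl erefl.
- by rewrite /update ltn_eqF // f3' // /s2 /update ltn_eqF.
- by rewrite /update ltn_eqF // f3' // /s2 /update eqxx.
- by rewrite /update eqxx.
have s2m : s2 m = s1 m by rewrite /s2 /update ltn_eqF.
eexists; eexists; split.
- apply: ExSeq (exec_save _ _) _; apply: ExSeq e1 _.
  apply: ExSeq (exec_save _ _) _; apply: ExSeq (exec_load _ _) _.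
  rewrite -/s2 s2m; apply: ExSeq e3 _; apply: ExSeq (exec_save _ _) _.
  by apply: ExSeq e4 _; apply: exec_load.
- by rewrite /update /= v4.
- move=> y y0 my; rewrite {1}/update gtn_eqF // f4 // /update gtn_eqF // f3' //;
    last by lia.
  rewrite /s2 /update gtn_eqF ?(ltnW my) // f1 //; last by move: my; rewrite /m; lia.
  by rewrite /update gtn_eqF // (ltn_trans _ (ltnW my)).
- rewrite -/s2 s2m vm v1 v3 v4 sx.
  have := acc_size (l x) [::]; rewrite cats0 => /(_ erefl).
  have := Hsl x; have := Hsi x.
  have : size (l x) * B2 (esize x) <= bsl (esize x) * B2 (esize x).
    by rewrite leq_mul // ltnW // (leq_trans (size_esize (l x)) (Hsl x)).
  by move: l1 l3 l4; rewrite /esize; lia.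
Qed.
End Combinators.

Section Pointwise.
Context {A B X : Type} {eA : encoding A} {eB : encoding B} {eX : encoding X}.

Lemma polyf_proj1 (f : X -> A * B) : polyf f -> polyf (fun x => (f x).1).
Proof. exact: (polyf_comp polyf_fst). Qed.

Lemma polyf_proj2 (f : X -> A * B) : polyf f -> polyf (fun x => (f x).2).
Proof. exact: (polyf_comp polyf_snd). Qed.

(** A nonempty list and the pair of its head and tail have the same encoding, so the pairing program
    is reused unchanged. *)
Lemma polyf_cons (f : X -> A) (g : X -> seq A) :
  polyf f -> polyf g -> polyf (fun x => f x :: g x).
Proof.
move=> pf pg; have [c [m [b [pb H]]]] := polyf_pair pf pg.
by exists c, m, b; split=> // a s sa; have [t [s' [? ? ? ?]]] := H a s sa; exists t, s'.
Qed.

Lemma polyf_comp2 (C : Type) {eC : encoding C} (h : A -> B -> C)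
    (f : X -> A) (g : X -> B) :
  polyf (fun p : A * B => h p.1 p.2) -> polyf f -> polyf g ->
  polyf (fun x => h (f x) (g x)).
Proof.
by move=> ph pf pg; apply: (polyf_comp ph (f := fun x => (f x, g x))); apply: polyf_pair.
Qed.

(** A nonempty list is already encoded as the pair of head and tail; the first branch only has to
    prepend the saved input. *)
Lemma polyf_match (l : X -> seq A) (f : X * (A * seq A) -> B) (g : X -> B) :
  polyf l -> polyf f -> polyf g ->
  polyf (fun x => if l x is a :: l' then f (x, (a, l')) else g x).
Proof.
move=> pl pf; have [bs [pbs Hs]] := polyf_size pl; move: pl pf.
move=> [cl [ml [bl [pbl Hl]]]] [cf [mf [bf [pbf Hf]]]] [cg [mg [bg [pbg Hg]]]].
pose m := (maxn ml (maxn mf mg)).+1.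
exists (Seq (save m) (Seq cl (If (EVar 0)
    (Seq (Assign 0 (ECons (EVar m) (EVar 0))) cf) (Seq (load m) cg)))),
  m.+1, (fun n => n + bl n + n + bs n + bs n + bf (n + bs n + 1) + bg n + 12).
split; first by poly_bound.
move=> x s sx.
have [t1 [s1 [e1 v1 f1 l1]]] := Hl x (update s m (s 0)) sx.
have vm : s1 m = enc x by rewrite f1 //; [rewrite /update eqxx|rewrite /m; lia].
have sz := Hs x.
have frame s' v mc : mc <= maxn mf mg ->
    (forall y, 0 < y -> mc <= y -> s' y = update s1 0 v y) ->
    forall y, 0 < y -> m < y -> s' y = s y.
  move=> mm F y y0 my; rewrite F //; last by move: my; rewrite /m; lia.
  rewrite /update gtn_eqF //= f1 //; last by move: my; rewrite /m; lia.
  by rewrite /update gtn_eqF.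
case lx: (l x) => [|a l'].
- have [t3 [s3 [e3 v3 f3 l3]]] := Hg x (update s1 0 (s1 m)) vm.
  eexists; eexists; split; first apply: ExSeq (exec_save _ _) _.
    by apply: ExSeq e1 _; apply: ExIfFalse (ExSeq (exec_load _ _) e3);
      rewrite /= v1 lx.
  + by rewrite v3.
  + exact: (frame _ _ _ (leq_maxr _ _) f3).
  + by move: l1 l3 sz; rewrite /= v1 vm sx lx /esize /=; lia.
- have [|t2 [s2 [e2 v2 f2 l2]]] :=
    Hf (x, (a, l')) (update s1 0 (Cons (s1 m) (s1 0))).
    by rewrite /update /= vm v1 lx.
  eexists; eexists; split; first apply: ExSeq (exec_save _ _) _.
    by apply: ExSeq e1 _; apply: ExIfTrue 
      (ExSeq (ExAssign s1 0 (ECons (EVar m) (EVar 0))) e2);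
      rewrite /= v1 lx.
  + by rewrite v2.
  + exact: (frame _ _ _ (leq_maxl _ _) f2).
  + have l2' : t2 <= bf (esize x + bs (esize x) + 1).
      apply: leq_trans l2 (pbf.1 _ _ _); rewrite !esize_pair /=.
      by move: sz; rewrite lx esize_cons; lia.
    have h2 : esize (a :: l') = tsize (s1 0) by rewrite v1 lx.
    move: l1 l2' sz; rewrite /= vm sx lx h2 /esize; lia.
Qed.

End Pointwise.

(** * List operations as folds *)

Section Sequences.
Context {A B X : Type} {eA : encoding A} {eB : encoding B} {eX : encoding X}.

Lemma polyf_nilp (l : X -> seq A) : polyf l -> polyf (fun x => nilp (l x)).
Proof.
move=> pl; apply: polyf_ext (polyf_match pl (polyf_const false) (polyf_const true)).
by move=> x; case: (l x).
Qed.

Lemma polyf_behead (l : X -> seq A) : polyf l -> polyf (fun x => behead (l x)).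
Proof.
move=> pl; apply: (polyf_ext (f := fun x => if l x is a :: l' then l' else [::])).
  by move=> x; case: (l x).
apply: (polyf_match (f := fun p => p.2.2)) => //.
  exact/polyf_proj2/polyf_proj2/polyf_id.
exact: polyf_const.
Qed.

Lemma polyf_head (d : A) (l : X -> seq A) :
  polyf l -> polyf (fun x => head d (l x)).
Proof.
move=> pl; apply: (polyf_ext (f := fun x => if l x is a :: l' then a else d)).
  by move=> x; case: (l x).
apply: (polyf_match (f := fun p => p.2.1)) => //.
  exact/polyf_proj1/polyf_proj2/polyf_id.
exact: polyf_const.
Qed.

Lemma polyf_rev (l : X -> seq A) : polyf l -> polyf (fun x => rev (l x)).
Proof.
move=> pl.
apply: (polyf_ext (f := fun x => foldl (fun b a => a :: b) [::] (l x))).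
  by move=> x; rewrite /rev; elim: (l x) [::] => //= a s IH b.
apply: (polyf_foldl (step := fun _ a b => a :: b) (q := fun n => n + 1)) pl _ _.
- by poly_bound.
- by move=> x a b; rewrite esize_cons; lia.
- exact: polyf_const.
- by apply: polyf_cons; [apply/polyf_proj1/polyf_proj2/polyf_id
                        |apply/polyf_proj2/polyf_proj2/polyf_id].
Qed.

Lemma polyf_cat (f g : X -> seq A) :
  polyf f -> polyf g -> polyf (fun x => f x ++ g x).
Proof.
move=> pf pg.
apply: (polyf_ext (f := fun x => foldl (fun b a => a :: b) (g x) (rev (f x)))).
  by move=> x; rewrite foldl_rev; elim: (f x) => //= a s ->.
apply: (polyf_foldl (step := fun _ a b => a :: b) (q := fun n => n + 1)) => //.
- by poly_bound.
- by move=> x a b; rewrite esize_cons; lia.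
- exact: polyf_rev.
- by apply: polyf_cons; [apply/polyf_proj1/polyf_proj2/polyf_id
                        |apply/polyf_proj2/polyf_proj2/polyf_id].
Qed.

Lemma polyf_map (l : X -> seq A) (f : X -> A -> B) :
  polyf l -> polyf (fun p : X * A => f p.1 p.2) ->
  polyf (fun x => [seq f x a | a <- l x]).
Proof.
move=> pl pf; have [bs [pbs Hs]] := polyf_size pf.
apply: (polyf_ext (f := fun x =>
    foldl (fun b a => f x a :: b) [::] (rev (l x)))).
  by move=> x; rewrite foldl_rev; elim: (l x) => //= a s ->.
apply: (polyf_foldl (step := fun x a b => f x a :: b)
  (q := fun n => bs (n + 1) + 1)).
- by poly_bound.
- by move=> x a b; rewrite esize_cons; have := Hs (x, a);
    rewrite esize_pair /= -addn1; lia.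
- exact: polyf_rev.
- exact: polyf_const.
- apply: polyf_cons; last exact/polyf_proj2/polyf_proj2/polyf_id.
  apply: (polyf_comp2 pf); first exact/polyf_proj1/polyf_id.
  exact/polyf_proj1/polyf_proj2/polyf_id.
Qed.

Lemma polyf_filter (l : X -> seq A) (p : X -> pred A) :
  polyf l -> polyf (fun y : X * A => p y.1 y.2) ->
  polyf (fun x => [seq a <- l x | p x a]).
Proof.
move=> pl pp.
apply: (polyf_ext (f := fun x =>
    foldl (fun b a => if p x a then a :: b else b) [::] (rev (l x)))).
  by move=> x; rewrite foldl_rev; elim: (l x) => //= a s ->.
apply: (polyf_foldl (step := fun x a b => if p x a then a :: b else b)
  (q := fun n => n + 1)).
- by poly_bound.
- by move=> x a b; case: ifP => _; rewrite ?esize_cons; lia.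
- exact: polyf_rev.
- exact: polyf_const.
- have pb : polyf (fun p : X * (A * seq A) => p.2.2).
    exact/polyf_proj2/polyf_proj2/polyf_id.
  have pa : polyf (fun p : X * (A * seq A) => p.2.1).
    exact/polyf_proj1/polyf_proj2/polyf_id.
  apply: polyf_if (polyf_cons pa pb) pb.
  by apply: (polyf_comp2 pp _ pa); apply/polyf_proj1/polyf_id.
Qed.

Lemma polyf_has (l : X -> seq A) (p : X -> pred A) :
  polyf l -> polyf (fun y : X * A => p y.1 y.2) -> polyf (fun x => has (p x) (l x)).
Proof.
move=> pl pp; apply: (polyf_ext (f := fun x =>
    if nilp [seq a <- l x | p x a] then false else true)).
  by move=> x; rewrite has_count -size_filter /nilp; case: size.
apply: polyf_if; [|exact: polyf_const|exact: polyf_const].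
exact/polyf_nilp/polyf_filter.
Qed.

Lemma polyf_negb (b : X -> bool) : polyf b -> polyf (fun x => ~~ b x).
Proof. by move=> pb; apply: polyf_if pb _ _; apply: polyf_const. Qed.

Lemma polyf_andb (b c : X -> bool) :
  polyf b -> polyf c -> polyf (fun x => b x && c x).
Proof. by move=> pb pc; apply: polyf_if pb pc _; apply: polyf_const. Qed.

Lemma polyf_orb (b c : X -> bool) :
  polyf b -> polyf c -> polyf (fun x => b x || c x).
Proof. by move=> pb pc; apply: polyf_if pb _ pc; apply: polyf_const. Qed.

Lemma polyf_eqb (b c : X -> bool) :
  polyf b -> polyf c -> polyf (fun x => b x == c x).
Proof.
move=> pb pc; apply: (polyf_ext (f := fun x => if b x then c x else ~~ c x)).
  by move=> x; case: (b x); case: (c x).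
exact: polyf_if pb pc (polyf_negb pc).
Qed.

End Sequences.

Section Naturals.
Context {A X : Type} {eA : encoding A} {eX : encoding X}.

Lemma polyf_all (l : X -> seq A) (p : X -> pred A) :
  polyf l -> polyf (fun y : X * A => p y.1 y.2) -> polyf (fun x => all (p x) (l x)).
Proof.
move=> pl pp; apply: (polyf_ext (f := fun x => ~~ has (fun a => ~~ p x a) (l x))).
  by move=> x /=; rewrite -[RHS]negbK -has_predC.
apply: polyf_negb; apply: (polyf_has (p := fun x a => ~~ p x a)) pl _.
exact: polyf_negb.
Qed.

Lemma esize_nat (n : nat) : esize n = n.*2.+1.
Proof.
elim: n => //= n IH; have -> : esize n.+1 = (esize n).+2 by [].
by rewrite IH doubleS.
Qed.

Lemma polyf_succ (f : X -> nat) : polyf f -> polyf (fun x => (f x).+1).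
Proof.
apply: (polyf_comp (g := S)).
apply: (@polyf_assign _ _ _ _ _ (ECons ENil (EVar 0)) (fun n => n + 2)).
  by poly_bound.
by move=> n s sn /=; rewrite sn addn2.
Qed.

(** A unary number and a list of that many units are the same tree, so the program is the
    identity. *)
Lemma polyf_units (f : X -> nat) : polyf f -> polyf (fun x => nseq (f x) tt).
Proof.
apply: (polyf_comp (g := fun n => nseq n tt)).
apply: (@polyf_assign _ _ _ _ _ (EVar 0) id); first by poly_bound.
move=> n s sn /=; rewrite sn; split=> //.
by elim: n {sn} => //= n IH; congr Cons.
Qed.

Lemma polyf_units_size (f : X -> seq unit) :
  polyf f -> polyf (fun x => size (f x)).
Proof.
apply: (polyf_comp (g := fun s : seq unit => size s)).
apply: (@polyf_assign _ _ _ _ _ (EVar 0) id); first by poly_bound.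
move=> l s sl /=; rewrite sl; split=> //.
by elim: l {sl} => //= u l IH; congr Cons.
Qed.

Lemma polyf_size_seq (l : X -> seq A) : polyf l -> polyf (fun x => size (l x)).
Proof.
move=> pl; apply: (polyf_ext (f := fun x => size [seq tt | _ <- l x])).
  by move=> x; rewrite size_map.
apply: polyf_units_size; apply: (polyf_map (f := fun _ _ => tt)) pl _.
exact: polyf_const.
Qed.

Lemma polyf_iter (n : X -> nat) (i : X -> A) (step : X -> A -> A) q :
  poly_bounded q -> (forall x a, esize (step x a) <= esize a + q (esize x)) ->
  polyf n -> polyf i -> polyf (fun p : X * A => step p.1 p.2) ->
  polyf (fun x => iter (n x) (step x) (i x)).
Proof.
move=> pq Hq pn pi ps.
apply: (polyf_ext (f := fun x => foldl (fun b _ => step x b) (i x) (nseq (n x) tt))).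
  by move=> x; elim: (n x) (i x) => //= k IH b; rewrite IH -iterSr.
apply: (polyf_foldl (step := fun x _ b => step x b) (q := q)) => //.
- move=> x a b; apply: leq_trans (Hq x b) _.
  by rewrite leq_add2l pq.1 // leq_addr.
- exact: polyf_units.
- apply: (polyf_comp2 ps); first exact/polyf_proj1/polyf_id.
  exact/polyf_proj2/polyf_proj2/polyf_id.
Qed.

End Naturals.

Section Arithmetic.
Context {A X : Type} {eA : encoding A} {eX : encoding X}.
Implicit Types f g : X -> nat.

Lemma polyf_add f g : polyf f -> polyf g -> polyf (fun x => f x + g x).
Proof.
move=> pf pg; apply: (polyf_ext (f := fun x => iter (f x) S (g x))).
  by move=> x; rewrite iter_succn addnC.
apply: (polyf_iter (q := fun=> 2) (step := fun _ => S)) => //.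
- exact: poly_bounded_const.
- by move=> _ n; rewrite !esize_nat; lia.
- exact/polyf_succ/polyf_proj2/polyf_id.
Qed.

End Arithmetic.

Section Arithmetic.
Context {A X : Type} {eA : encoding A} {eX : encoding X}.
Implicit Types f g : X -> nat.

Lemma polyf_mul f g : polyf f -> polyf g -> polyf (fun x => f x * g x).
Proof.
move=> pf pg; apply: (polyf_ext (f := fun x => iter (f x) (addn (g x)) 0)).
  by move=> x; rewrite iter_addn addn0 mulnC.
have [b [pb H]] := polyf_size pg.
apply: (polyf_iter (q := b) (step := fun x => addn (g x))) => //.
- by move=> x n; have := H x; rewrite !esize_nat; lia.
- exact: polyf_const.
- apply: polyf_add; last exact/polyf_proj2/polyf_id.
  by apply: polyf_comp pg _; apply/polyf_proj1/polyf_id.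
Qed.

Lemma polyf_drop f (l : X -> seq A) :
  polyf f -> polyf l -> polyf (fun x => drop (f x) (l x)).
Proof.
move=> pf pl; apply: (polyf_ext (f := fun x => iter (f x) behead (l x))).
  move=> x; elim: (f x) (l x) => [|n IH] s; first by rewrite drop0.
  by rewrite iterSr IH; case: s.
apply: (polyf_iter (q := fun=> 0) (step := fun _ => behead)) => //.
- exact: poly_bounded_const.
- by move=> _ [|a s] //=; rewrite esize_cons; lia.
- exact/polyf_behead/polyf_proj2/polyf_id.
Qed.

Lemma polyf_nth (d : A) f (l : X -> seq A) :
  polyf f -> polyf l -> polyf (fun x => nth d (l x) (f x)).
Proof.
move=> pf pl; apply: polyf_ext (polyf_head d (polyf_drop pf pl)) => x.
by rewrite -nth0 nth_drop addn0.
Qed.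

End Arithmetic.

Section Arithmetic.
Context {A X : Type} {eA : encoding A} {eX : encoding X}.
Implicit Types f g : X -> nat.

Lemma polyf_sub f g : polyf f -> polyf g -> polyf (fun x => f x - g x).
Proof.
move=> pf pg; apply: (polyf_ext (f := fun x => size (drop (g x) (nseq (f x) tt)))).
  by move=> x; rewrite size_drop size_nseq.
apply: polyf_size_seq; apply: polyf_drop => //; exact: polyf_units.
Qed.

Lemma polyf_leq f g : polyf f -> polyf g -> polyf (fun x => f x <= g x).
Proof.
move=> pf pg; apply: (polyf_ext (f := fun x => nilp (nseq (f x - g x) tt))).
  by move=> x; rewrite /nilp size_nseq.
exact/polyf_nilp/polyf_units/polyf_sub.
Qed.

Lemma polyf_eqn f g : polyf f -> polyf g -> polyf (fun x => f x == g x).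
Proof.
move=> pf pg; apply: (polyf_ext (f := fun x => (f x <= g x) && (g x <= f x))).
  by move=> x; rewrite eqn_leq.
by apply: polyf_andb; apply: polyf_leq.
Qed.

End Arithmetic.

Section Arithmetic.
Context {A X : Type} {eA : encoding A} {eX : encoding X}.
Implicit Types f g : X -> nat.

(** The number consed in a round is [size s], written as [f x - (f x - size s)]: this agrees with
    [size s] as long as [size s <= f x], and it is at most [f x] for every [s], which gives the
    uniform growth bound that [polyf_iter] asks for. *)
Lemma polyf_iota f : polyf f -> polyf (fun x => iota 0 (f x)).
Proof.
move=> pf; apply: (polyf_ext (f := fun x => rev (iter (f x) (fun s =>
  (f x - (f x - size s)) :: s) [::]))).
  move=> x; have H i : i <= f x -> iter i (fun s => (f x - (f x - size s)) :: s)
      [::] = rev (iota 0 i).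
    elim: i => // i IH ix; rewrite iterS IH ?(ltnW ix) // size_rev size_iota.
    by rewrite -[i.+1]addn1 iotaD rev_cat subKn // ltnW.
  by rewrite H // revK.
have [b [pb Hb]] := polyf_size pf; apply: polyf_rev.
apply: (polyf_iter (q := fun n => b n + 1)
  (step := fun x s => (f x - (f x - size s)) :: s)) => //.
- by poly_bound.
- by move=> x s; have := Hb x; rewrite esize_cons !esize_nat; lia.
- exact: polyf_const.
- have pf' : polyf (fun p : X * seq nat => f p.1).
    by apply: (polyf_comp pf); apply/polyf_proj1/polyf_id.
  have ps : polyf (fun p : X * seq nat => p.2) by apply/polyf_proj2/polyf_id.
  by apply: polyf_cons => //; do 2 apply: polyf_sub => //; apply: polyf_size_seq.
Qed.

End Arithmetic.

(** * The auction algorithm *)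

(** A search written as a fold, so that [polyf_foldl] applies. The remaining elements come back in
    reverse order, hence the specification up to permutation. *)
Definition extract A (p : pred A) (s : seq A) : seq A * seq A :=
  foldl (fun acc e => if nilp acc.1 && p e then ([:: e], acc.2)
                      else (acc.1, e :: acc.2)) ([::], [::]) s.

Variant extract_spec (A : eqType) (p : pred A) s : seq A * seq A -> Prop :=
  | ExtractNone r of ~~ has p s & perm_eq r s : extract_spec p s ([::], r)
  | ExtractSome e r of p e & perm_eq (e :: r) s : extract_spec p s ([:: e], r).

Lemma extractP (A : eqType) (p : pred A) s : extract_spec p s (extract p s).
Proof.
elim/last_ind: s => [|s x IH]; first exact: ExtractNone.
rewrite /extract foldl_rcons -/(extract p s).
case: IH => [r nh pr|e r pe pr] /=.
  have pr' : perm_eq (x :: r) (rcons s x).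
    by rewrite perm_sym perm_rcons perm_sym perm_cons.
  by case: ifP => px; [apply: ExtractSome|apply: ExtractNone; rewrite ?has_rcons ?px].
apply: ExtractSome => //.
rewrite (perm_catCA [:: e] [:: x]) perm_sym perm_rcons perm_sym.
by rewrite perm_cons.
Qed.

(* Bertsekas' auction: [slots] are goods with an integer price and at most one
   holder; a waiting bidder takes a cheapest acceptable good, raises its price
   by one and sends the former holder back to the queue. *)
Section Auction.
Variables (T : eqType) (a : rel T).
Implicit Types (es : seq (T * (nat * seq T))) (e : T * (nat * seq T)).
Implicit Types (st : seq T * seq (T * (nat * seq T))).

Definition affordable (cap : nat) (x : T) es e : bool :=
  [&& a x e.1, e.2.1 < cap & all (fun f => ~~ a x f.1 || (e.2.1 <= f.2.1)) es].

Definition bid (cap : nat) st :=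
  if st.1 is x :: q then
    let r := extract (affordable cap x st.2) st.2 in
    if r.1 is e :: _ then (e.2.2 ++ q, (e.1, (e.2.1.+1, [:: x])) :: r.2) else st
  else st.

(** An effective bid raises the total price by one, and no price exceeds [(size slots).+1]. One
    round beyond the product of this bound with the number of goods therefore ends in a state that
    [bid] does not change. *)
Definition auction (jobs slots : seq T) :=
  iter (size slots * (size slots).+1).+1 (bid (size slots).+1)
    (jobs, [seq (v, (0, [::])) | v <- slots]).

Definition holders es : seq T := flatten [seq e.2.2 | e <- es].

(** [inv_price] is Bertsekas' complementary slackness with tolerance one: a holder's good costs at
    most one more than any other good acceptable to it. By [inv_holder] a good is held exactly when
    its price is positive. *)
Record auction_inv jobs slots st : Prop := AuctionInv {
  inv_jobs : perm_eq (st.1 ++ holders st.2) jobs;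
  inv_slots : perm_eq [seq e.1 | e <- st.2] slots;
  inv_holder : forall e, e \in st.2 -> size e.2.2 = (0 < e.2.1);
  inv_cap : forall e, e \in st.2 -> e.2.1 <= (size slots).+1;
  inv_adj : forall e y, e \in st.2 -> y \in e.2.2 -> a y e.1;
  inv_price : forall e y, e \in st.2 -> y \in e.2.2 ->
    forall f, f \in st.2 -> a y f.1 -> e.2.1 <= f.2.1.+1 }.

Lemma auction_inv0 jobs slots :
  auction_inv jobs slots (jobs, [seq (v, (0, [::])) | v <- slots]).
Proof.
have H e : e \in [seq (v, (0, [::])) | v <- slots] -> e.2 = (0, [::] : seq T).
  by move=> /mapP[v _ ->].
split=> /=.
- by rewrite /holders -map_comp; elim: slots {H} => //=; rewrite cats0.
- by rewrite -map_comp map_id_in.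
- by move=> e /H ->.
- by move=> e /H ->.
- by move=> e y /H ->.
- by move=> e y /H ->.
Qed.

Definition total_price st := sumn [seq e.2.1 | e <- st.2].

Lemma perm_holders es1 es2 : perm_eq es1 es2 -> perm_eq (holders es1) (holders es2).
Proof. by move=> p; apply/perm_flatten/perm_map. Qed.

Lemma bidP jobs slots st (cap := (size slots).+1) : auction_inv jobs slots st ->
  auction_inv jobs slots (bid cap st) /\
  (total_price (bid cap st) = (total_price st).+1 \/
   bid cap st = st /\
   forall x, ohead st.1 = Some x -> ~~ has (affordable cap x st.2) st.2).
Proof.
move=> inv; rewrite /bid; case E: st.1 => [|x q]; first by split=> //; right.
case: extractP => [r nh _|e r /and3P[ae lt al] pr].
  by split=> //; right; split=> // _ [<-].
have mem f : f \in st.2 = (f \in e :: r) by rewrite (perm_mem pr).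
split; last first.
  by left; rewrite /total_price /= -(perm_sumn (perm_map (fun e => e.2.1) pr)).
move/allP: al => al.
have es : e \in st.2 by rewrite mem mem_head.
have rs f : f \in r -> f \in st.2 by rewrite mem inE orbC => ->.
split=> /=.
- apply/permP => P; have := permP (inv_jobs inv) P; rewrite E => <-.
  have := permP (perm_holders pr) P.
  by rewrite /holders /= !count_cat /= => <-; lia.
- by rewrite -(permPr (inv_slots inv)) perm_sym -(permPl (perm_map _ pr)) perm_sym.
- by move=> f; rewrite inE => /orP[/eqP->|/rs /(inv_holder inv)].
- by move=> f; rewrite inE => /orP[/eqP->|/rs /(inv_cap inv)].
- move=> f y; rewrite inE => /orP[/eqP->|/rs /(inv_adj inv) H /H] //=.
  by rewrite inE => /eqP->.
(* The new holder pays one more than the minimum over its acceptable goods; for every other holder,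
   the only price that changed has gone up. *)
- move=> f y; rewrite inE => /orP[/eqP->|/rs fs] /=.
    rewrite inE => /eqP-> g; rewrite inE => /orP[/eqP-> //|/rs gs] ag.
    by have := al _ gs; rewrite ag ltnS.
  move=> yf g; rewrite inE => /orP[/eqP->|/rs gs] /= ag.
    by rewrite ltnW // ltnS; apply: (inv_price inv fs yf es).
  exact: (inv_price inv fs yf gs).
Qed.

Lemma total_price_le jobs slots st : auction_inv jobs slots st ->
  total_price st <= size slots * (size slots).+1.
Proof.
move=> inv; rewrite /total_price -(perm_size (inv_slots inv)) size_map.
rewrite -{1}(size_map (fun e => e.2.1)) mulnC.
have : all (leq^~ (size slots).+1) [seq e.2.1 | e <- st.2].
  by apply/allP => _ /mapP[e es ->]; apply: (inv_cap inv).
rewrite -(perm_size (inv_slots inv)) size_map.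
move: (size st.2).+1 => c; elim: map => //= p s IH /andP[pc /IH].
by rewrite mulnS; apply: leq_add.
Qed.

(** After [i] rounds either the total price is [i] or the state is stationary; in the last round the
    bound on the total price leaves only the second case. *)
Lemma auction_final jobs slots (st := auction jobs slots) :
  auction_inv jobs slots st /\
  forall x, ohead st.1 = Some x -> ~~ has (affordable (size slots).+1 x st.2) st.2.
Proof.
set cap := (size slots).+1; pose s0 := (jobs, [seq (v, (0, [::] : seq T)) | v <- slots]).
have inv i : auction_inv jobs slots (iter i (bid cap) s0).
  by elim: i => [|i IH]; [exact: auction_inv0|rewrite iterS; have [] := bidP IH].
have prog i : total_price (iter i (bid cap) s0) = i \/
    iter i.+1 (bid cap) s0 = iter i (bid cap) s0.
  elim: i => [|i [IH|IH]].
  - by left; rewrite /total_price /= -map_comp; elim: slots {cap s0 inv st}.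
  - have [_ [tp|[fx _]]] := bidP (inv i); first by left; rewrite iterS tp IH.
    by right; rewrite !iterS !fx.
  - by right; rewrite iterS IH.
split; first exact: inv.
have [tp|fx] := prog (size slots * cap).+1.
  by have := total_price_le (inv (size slots * cap).+1); rewrite tp ltnn.
have [_ [|[]//]] := bidP (inv (size slots * cap).+1).
by rewrite -iterS fx => E; have := n_Sn (total_price (iter (size slots * cap).+1 (bid cap) s0)); rewrite {1}E.
Qed.

Lemma auction_success jobs slots : nilp (auction jobs slots).1 ->
  exists m : seq (T * T), [/\ perm_eq [seq p.1 | p <- m] jobs,
    subseq [seq p.2 | p <- m] [seq e.1 | e <- (auction jobs slots).2],
    perm_eq [seq e.1 | e <- (auction jobs slots).2] slots &
    forall p, p \in m -> a p.1 p.2].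
Proof.
move=> /nilP E; have [inv _] := auction_final jobs slots.
have := inv_jobs inv; rewrite E /= => pj.
exists (flatten [seq [seq (y, e.1) | y <- e.2.2] | e <- (auction jobs slots).2]).
split.
- by rewrite map_flatten -map_comp (eq_map (g := fun e => e.2.2)) // => e /=;
    rewrite -map_comp map_id_in.
- have := @inv_holder _ _ _ inv.
  elim: (auction jobs slots).2 => //= e es IH H.
  have IH' := IH (fun f fs => H f (mem_behead (s := e :: es) fs)).
  have := H e (mem_head _ _); rewrite map_cat; case: e.2.2 => [|y [|? ?]] /=.
  + by move=> _; apply: subseq_trans IH' (subseq_cons _ _).
  + by rewrite eqxx.
  + by case: (0 < _).
- exact: inv_slots inv.
- move=> p /flatten_mapP[e es /mapP[y ye ->]] /=; exact: (inv_adj inv es ye).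
Qed.

(** The Hall violator consists of an unserved bidder [x] and the holders of all goods priced above a
    level [t] that no good has. By [inv_price] such a holder accepts only goods priced at least [t],
    hence above [t], and [x] accepts only goods at the cap. *)
Lemma auction_failure jobs slots : ~~ nilp (auction jobs slots).1 ->
  exists X Y, perm_eq (X ++ Y) jobs /\
    count (fun v => has (a^~ v) X) slots < size X.
Proof.
set st := auction jobs slots => ne; have [inv nc] := auction_final jobs slots.
rewrite -/st in inv nc; case E: st.1 ne nc => [//|x q] _ /(_ x erefl) nc.
have szN : size st.2 = size slots by rewrite -(perm_size (inv_slots inv)) size_map.
have pj := inv_jobs inv; rewrite E in pj.
have big f : f \in st.2 -> a x f.1 -> size slots < f.2.1.
  move=> fs af; rewrite ltnNge; apply/negP => le; move/negP: nc; apply.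
  have ex : exists n, has (fun g => a x g.1 && (g.2.1 == n)) st.2.
    by exists f.2.1; apply/hasP; exists f; rewrite ?af ?eqxx.
  case: (ex_minnP ex) => n /hasP[g gs /andP[ag /eqP gn]] mn.
  apply/hasP; exists g => //; apply/and3P; split=> //.
    rewrite gn ltnS; apply: leq_trans (mn f.2.1 _) le.
    by apply/hasP; exists f; rewrite ?af ?eqxx.
  apply/allP => h hs /=; case ah: (a x h.1) => //=; rewrite gn mn //.
  by apply/hasP; exists h; rewrite ?ah ?eqxx.
have [/hasP[f0 f0s af0]|/hasPn none] := boolP (has (fun f => a x f.1) st.2); last first.
  exists [:: x], (q ++ holders st.2); split=> //.
  rewrite -(permP (inv_slots inv)) count_map (@eq_in_count _ _ pred0) ?count_pred0 //.
  by move=> f fs /=; rewrite orbF; apply/negbTE/none.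
(* A price level which no good has separates dear goods from cheap ones. *)
have [t /andP[t0 tN] gap] : exists2 t, 0 < t <= size slots &
    t \notin [seq f.2.1 | f <- st.2].
  have [/hasP[t]|/hasPn H] := boolP (has (fun t => t \notin [seq f.2.1 | f <- st.2])
      (iota 1 (size slots))).
    by rewrite mem_iota add1n ltnS => ? ?; exists t.
  (* The price of [f0] lies above [size slots]; if all levels from 1 to [size slots] occurred too,
     there would be more distinct prices than goods. *)
  have : size (f0.2.1 :: iota 1 (size slots)) <= size [seq f.2.1 | f <- st.2].
    apply: uniq_leq_size => [|n].
      by rewrite /= iota_uniq andbT mem_iota add1n ltnS [_ <= size _]leqNgt big // andbF.
    by rewrite inE => /orP[/eqP->|/H]; [exact: map_f|rewrite negbK].
  by rewrite /= size_iota size_map szN ltnn.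
pose dear e := t < e.2.1; pose A := filter dear st.2; pose B := filter (predC dear) st.2.
exists (x :: holders A), (q ++ holders B); split.
  apply/permP => P; rewrite -(permP pj).
  have := permP (perm_holders (permEl (perm_filterC dear st.2))) P.
  by rewrite /holders map_cat flatten_cat /= !count_cat -/A -/B => <-; lia.
(* A dear good has a positive price, hence exactly one holder; together with [x] this is one bidder
   more than there are dear goods. *)
have -> : size (x :: holders A) = (size A).+1.
  have : {subset A <= st.2} by move=> e; rewrite mem_filter => /andP[].
  have : all dear A by apply: filter_all.
  rewrite /=; move=> dA sA; congr _.+1; elim: (A) dA sA => //= e es IH /andP[te tes] sub.
  rewrite /holders /= size_cat IH //; last by move=> g gs; apply: sub; rewrite inE gs orbT.
  by rewrite (inv_holder inv) ?sub ?mem_head // (leq_trans _ te).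
rewrite ltnS -(permP (inv_slots inv)) count_map size_filter.
rewrite (@eq_in_count _ _ (fun e => (e \in st.2) && has (a^~ e.1) (x :: holders A)));
  last by move=> e /= ->.
apply: sub_count => e /andP[es] /= /orP[/(big e es)|].
  exact: leq_ltn_trans.
move=> /hasP[y /flatten_mapP[f]]; rewrite mem_filter => /andP[tf fs] yf /= aye.
have := leq_trans tf (inv_price inv fs yf es aye).
rewrite ltnS leq_eqVlt => /orP[/eqP te|//].
by case/negP: gap; apply/mapP; exists e.
Qed.
End Auction.

(** * Forests *)

Lemma connect_closed (V : finType) (e : rel V) (P : V -> Prop) :
  (forall x y, e x y -> P x -> P y) ->
  forall x y, connect e x y -> P x -> P y.
Proof.
move=> cl x y /connectP[p + ->]; elim: p x => //= z p IH x /andP[exz pz] Px.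
exact: IH pz (cl _ _ exz Px).
Qed.

Lemma set2_eq (V : finType) (x y u v : V) : [set x; y] = [set u; v] ->
  (x = u /\ y = v) \/ (x = v /\ y = u).
Proof.
move/setP=> E; move: (E x) (E y) (E u) (E v); rewrite !inE !eqxx ?orbT /=.
by move=> /esym/orP[]/eqP hx /esym/orP[]/eqP hy /orP[]/eqP hu /orP[]/eqP hv; subst; auto.
Qed.

Section Forests.
Variable V : finType.
Implicit Types (F K : {set {set V}}) (W : {set V}) (a : rel V) (x y : V).

(** A graph is given by its set of unordered pairs, so that cardinalities count edges; [x != y]
    excludes singletons read as degenerate pairs. *)
Definition erel F : rel V := fun x y => (x != y) && ([set x; y] \in F).

(** Every edge is a bridge. This form suits insertion and exchange of edges; [acyc_ucycle] relates
    it to cycles. *)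
Definition acyc F : bool :=
  [forall x, forall y, erel F x y ==> ~~ connect (erel (F :\ [set x; y])) x y].

Lemma acycP F : reflect
  (forall x y, erel F x y -> ~~ connect (erel (F :\ [set x; y])) x y) (acyc F).
Proof.
apply: (iffP forallP) => H x; first by move=> y; move/forallP/(_ y)/implyP: (H x).
by apply/forallP=> y; apply/implyP/H.
Qed.

Lemma erel_sym F : symmetric (erel F).
Proof. by move=> x y; rewrite /erel eq_sym setUC. Qed.

Lemma connectC F x y : connect (erel F) x y = connect (erel F) y x.
Proof. exact: (sym_connect_sym (@erel_sym F)). Qed.

Lemma erelS F K : F \subset K -> subrel (erel F) (erel K).
Proof. by move=> /subsetP FK x y /andP[xy /FK]; rewrite /erel xy. Qed.

Lemma connectS F K : F \subset K -> subrel (connect (erel F)) (connect (erel K)).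
Proof. by move=> FK; apply: connect_sub => x y /(erelS FK); apply: connect1. Qed.

Lemma acycS F K : F \subset K -> acyc K -> acyc F.
Proof.
move=> FK /acycP H; apply/acycP => x y xy.
apply: contra (H _ _ (erelS FK xy)); apply: connectS.
by rewrite setSD.
Qed.

Lemma acyc0 : acyc set0.
Proof. by apply/acycP => x y; rewrite /erel inE andbF. Qed.

Lemma connect_add F x y u v : connect (erel ([set x; y] |: F)) u v ->
  [\/ connect (erel F) u v,
      connect (erel F) u x /\ connect (erel F) y v |
      connect (erel F) u y /\ connect (erel F) x v].
Proof.
move=> uv; apply: (@connect_closed _ _ (fun v => [\/ connect (erel F) u v,
    connect (erel F) u x /\ connect (erel F) y v |
    connect (erel F) u y /\ connect (erel F) x v]) _ u v uv); last exact: Or31.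
move=> {uv} {}v w /andP[vw]; rewrite inE => /orP[/set1P E|FE].
  have [[-> ->]|[-> ->]] := set2_eq E; case=> [c|[c1 c2]|[c1 c2]].
  - by apply: Or32.
  - by apply: Or32.
  - by apply: Or31.
  - by apply: Or33.
  - by apply: Or31.
  - by apply: Or33.
have c : connect (erel F) v w by apply: connect1; rewrite /erel vw.
case=> [c1|[c1 c2]|[c1 c2]].
- by apply: Or31; apply: connect_trans c1 c.
- by apply: Or32; split=> //; apply: connect_trans c2 c.
- by apply: Or33; split=> //; apply: connect_trans c2 c.
Qed.

(** If an old edge were no longer a bridge, the detour around it would use the new edge, and the
    rest of the detour together with the old edge would connect [x] to [y] in [F]. *)
Lemma acyc_add F x y :
  acyc F -> ~~ connect (erel F) x y -> acyc ([set x; y] |: F).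
Proof.
move=> /acycP H nc; apply/acycP => u v uv; apply/negP => c.
have [E|ne] := eqVneq [set u; v] [set x; y].
  have {}c : connect (erel F) u v.
    by apply: connectS c; rewrite E subDset.
  by case: (set2_eq E) nc => -[<- <-]; rewrite ?(connectC _ v) c.
have FE : erel F u v.
  by case/andP: uv => uv; rewrite /erel uv !inE (negbTE ne).
have cF : connect (erel F) u v by apply: connect1.
have {}c : connect (erel ([set x; y] |: (F :\ [set u; v]))) u v.
  apply: connectS c; apply/subsetP => e; rewrite !inE.
  by case/andP=> -> /orP[->|->]; rewrite ?orbT.
have sub := connectS (subD1set F [set u; v]).
case: (connect_add c) => [|[/sub c1 /sub c2]|[/sub c1 /sub c2]].
- exact/negP/H.
- move/negP: nc; apply; rewrite connectC in c1; apply: connect_trans c1 _.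
  by apply: connect_trans cF _; rewrite connectC.
- move/negP: nc; apply; apply: connect_trans c2 _.
  by rewrite connectC; apply: connect_trans cF; rewrite connectC.
Qed.

(** The remainder of a cycle bypasses each of its edges; conversely, a simple detour around an edge
    closes up to a cycle. *)
Lemma acyc_ucycle F : acyc F <-> forall c, ucycle (erel F) c -> size c <= 2.
Proof.
split=> [/acycP H [|x [|y [|z c]]] // /andP[]|H].
  rewrite /= rcons_path => /and4P[xy yz zc lx] /and3P[xN yN _].
  have lzc : last z c \in z :: c by apply: mem_last.
  case/negP: (H x y xy); rewrite connectC.
  apply: (@connect_trans _ _ (last z c)); last first.
    apply: connect1; case/andP: lx => ne lF; rewrite /erel ne !inE lF andbT.
    apply: contraNneq yN => E; have [[e1 _]|[e1 _]] := set2_eq E; last by rewrite -e1.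
    by rewrite e1 eqxx in ne.
  apply/connectP; exists (z :: c) => //.
  apply: (sub_in_path (P := fun w => w != x) (e := erel F)).
  - move=> u v ux vx /andP[uv uvF]; rewrite /erel uv !inE uvF andbT.
    apply/eqP => E; have [[e1 _]|[_ e1]] := set2_eq E.
      by rewrite unfold_in e1 eqxx in ux.
    by rewrite unfold_in e1 eqxx in vx.
  - by apply/allP => w wc /=; apply: contraNneq xN => <-.
  - by rewrite /= yz.
apply/acycP => x y xy; apply/negP => /connectP[p0 pp0 yE].
case/shortenP: pp0 yE => p pp up _ yE.
have pF : path (erel F) x p by apply: sub_path pp; apply/erelS/subD1set.
have /H : ucycle (erel F) (x :: p).
  by rewrite /ucycle up andbT /= rcons_path pF -yE erel_sym.
case: p pp up pF yE => [|z [|? ?]] //= pp _ _ yE _.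
  by rewrite yE /erel eqxx in xy.
by case/andP: pp; rewrite -yE /erel !inE eqxx andbF.
Qed.

(** On a cycle, both neighbors of a highest vertex would have to be its parent. *)
Lemma acyc_par F (ht : V -> nat) (par : V -> V) :
  (forall e, e \in F -> exists2 x, e = [set x; par x] & ht (par x) < ht x) ->
  acyc F.
Proof.
move=> H; apply/acyc_ucycle => c uc; rewrite leqNgt; apply/negP => c2.
have [x0 x0c] : exists x, x \in c by case: c c2 {uc} => // x c _; exists x; rewrite mem_head.
case: (@arg_maxnP _ x0 (mem c) ht x0c) => x xc xm.
have [i c' Ec] := rot_to xc.
have uc' : ucycle (erel F) (x :: c') by rewrite -Ec rot_ucycle.
have up y : erel F x y -> y \in c -> y = par x.
  move=> /andP[xy /H[w Ew hw]] yc.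
  case: (set2_eq Ew) => -[E1 E2]; first by rewrite E2 -E1.
  by have : ht y <= ht x := xm _ yc; rewrite leqNgt E1 E2 hw.
have sc : size c = (size c').+1 by rewrite -(size_rot i) Ec.
have mc z : z \in x :: c' -> z \in c by rewrite -Ec mem_rot.
case: c' Ec uc' sc mc => [|y c'] Ec uc' sc mc; first by rewrite sc in c2.
case/lastP: c' Ec uc' sc mc => [|c' z] Ec uc' sc mc; first by rewrite sc in c2.
case/andP: uc' => /= /andP[xy]; rewrite rcons_path last_rcons => /andP[_ zx].
move=> /and3P[_ yN _]; case/negP: yN.
rewrite (up y) ?mc ?inE ?eqxx ?orbT // -(up z) 1?erel_sym ?mem_rcons ?mem_head //.
by rewrite mc // !inE mem_rcons mem_head !orbT.
Qed.

(** No edge of the union crosses the border of [A], so a detour around an edge stays on the side of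
    that edge. *)
Lemma acyc_disjointU F K (A : {set V}) :
  (forall x y, erel F x y -> x \in A) -> (forall x y, erel K x y -> x \notin A) ->
  acyc F -> acyc K -> acyc (F :|: K).
Proof.
move=> FA KA /acycP aF /acycP aK; apply/acycP => u v uv; apply/negP => c.
have step x y : erel ((F :|: K) :\ [set u; v]) x y ->
    if x \in A then erel (F :\ [set u; v]) x y && (y \in A)
    else erel (K :\ [set u; v]) x y && (y \notin A).
  rewrite /erel !inE => /and3P[xy -> /orP[xF|xK]]; rewrite xy.
    have E : erel F x y by rewrite /erel xy.
    by rewrite (FA _ _ E) xF (FA y x) // erel_sym.
  have E : erel K x y by rewrite /erel xy.
  by rewrite (negbTE (KA _ _ E)) xK (KA y x) // erel_sym.
have [uA|uA] := boolP (u \in A).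
  have Fuv : erel F u v.
    case/andP: (uv) => ne; rewrite inE => /orP[H|H]; first by rewrite /erel ne.
    by have := KA u v; rewrite /erel ne H uA => /(_ isT).
  have : (v \in A) && connect (erel (F :\ [set u; v])) u v.
    apply: (connect_closed (P := fun z => (z \in A) &&
       connect (erel (F :\ [set u; v])) u z)) c _; last by rewrite uA connect0.
    move=> x y /step; case: ifP => // _ /andP[xy ->] /andP[_ ux].
    by apply: connect_trans ux (connect1 _).
  by rewrite (negbTE (aF _ _ Fuv)) andbF.
have Kuv : erel K u v.
  case/andP: (uv) => ne; rewrite inE => /orP[H|H]; last by rewrite /erel ne.
  by have := FA u v; rewrite /erel ne H (negbTE uA) => /(_ isT).
have : (v \notin A) && connect (erel (K :\ [set u; v])) u v.
  apply: (connect_closed (P := fun z => (z \notin A) &&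
     connect (erel (K :\ [set u; v])) u z)) c _; last by rewrite uA connect0.
  move=> x y /step; case: ifP => // _ /andP[xy ->] /andP[_ ux].
  by apply: connect_trans ux (connect1 _).
by rewrite (negbTE (aK _ _ Kuv)) andbF.
Qed.

(** Take a maximal acyclic set between [F] and [K]: by [acyc_add], an edge of [K] joining two of its
    components could still be added. *)
Lemma acyc_extend F K : (forall e, e \in K -> exists x y, e = [set x; y]) ->
  acyc F -> F \subset K -> exists2 T : {set {set V}}, F \subset T & [/\ T \subset K, acyc T &
    forall x y, connect (erel K) x y -> connect (erel T) x y].
Proof.
move=> K2 aF FK; pose P (T : {set {set V}}) := [&& F \subset T, T \subset K & acyc T].
have PF : P F by rewrite /P subxx FK.
have [T /maxsetP[/and3P[FT TK aT] mT] _] := maxset_exists PF.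
exists T => //; split=> //; apply: connect_sub => x y xy.
apply/negPn/negP => nc; have PT : P ([set x; y] |: T).
  rewrite /P acyc_add // subUset TK (subset_trans FT) ?subsetUr //.
  by rewrite sub1set; case/andP: xy => _ ->.
have xyT : [set x; y] \in T by rewrite -(mT _ PT (subsetUr _ _)) setU11.
by case/negP: nc; apply: connect1; rewrite /erel xyT andbT; case/andP: xy.
Qed.

Definition cls F x := [set z | connect (erel F) x z].
(** The number of components of [F] that meet [W]. The inequalities [acyc_card] and [conn_card] are
    the two halves of the formula relating vertices, edges and components of a forest. *)
Definition ncls F W := #|[set cls F x | x in W]|.

Lemma cls_eq F x y : (cls F x == cls F y) = connect (erel F) x y.
Proof.
apply/eqP/idP => [/setP/(_ y)|xy]; first by rewrite !inE connect0.
apply/setP => z; rewrite !inE; apply/idP/idP => [|yz].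
  by apply: connect_trans; rewrite connectC.
exact: connect_trans xy yz.
Qed.

Lemma ncls0 W : ncls set0 W = #|W|.
Proof.
rewrite /ncls card_in_imset // => x y _ _ /eqP; rewrite cls_eq => /connectP[[|z p]].
  by move=> _ ->.
by rewrite /= /erel inE andbF.
Qed.

Lemma cls_map F K : F \subset K ->
  exists g : {set V} -> {set V}, forall z, g (cls F z) = cls K z.
Proof.
move=> FK; exists (fun C : {set V} => if [pick z in C] is Some z then cls K z else set0) => z.
case: pickP => [w|/(_ z)]; last by rewrite inE connect0.
by rewrite inE => /(connectS FK) zw; apply/eqP; rewrite cls_eq connectC.
Qed.

(** Only the classes of [x] and [y] can merge, so the map [g] from old to new classes is injective
    once the class of [y] is removed. *)
Lemma ncls_add F W x y : ncls F W <= (ncls ([set x; y] |: F) W).+1.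
Proof.
have [g gE] := cls_map (subsetUr [set [set x; y]] F).
set F' := _ |: F in g gE *.
rewrite /ncls (cardsD1 (cls F y)) -addn1 addnC leq_add ?leq_b1 //.
rewrite -(card_in_imset (f := g)); first last.
  move=> C1 C2 /setD1P[n1 /imsetP[z1 _ E1]] /setD1P[n2 /imsetP[z2 _ E2]]; subst C1 C2.
  rewrite !gE => /eqP; rewrite !cls_eq in n1 n2 * => c; apply/eqP; rewrite cls_eq.
  case: (connect_add c) => [//|[_]|[]]; first by rewrite connectC (negbTE n2).
  by rewrite (negbTE n1).
apply: subset_leq_card; apply/subsetP => D /imsetP[C /setD1P[_ /imsetP[z zW ->]] ->].
by rewrite gE imset_f.
Qed.

Lemma ncls_merge F W x y : x \in W -> y \in W -> ~~ connect (erel F) x y ->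
  ncls ([set x; y] |: F) W < ncls F W.
Proof.
have [g gE] := cls_map (subsetUr [set [set x; y]] F).
set F' := _ |: F in g gE * => xW yW nc.
rewrite /ncls (cardsD1 (cls F y) [set cls F z | z in W]) imset_f //= ltnS.
apply: leq_trans (leq_imset_card g _); apply: subset_leq_card.
apply/subsetP => C /imsetP[z zW ->].
have [zy|zy] := boolP (cls F z == cls F y); last first.
  by rewrite -gE imset_f // !inE zy imset_f.
have -> : cls F' z = cls F' x.
  apply/eqP; rewrite cls_eq; rewrite cls_eq in zy.
  apply: connect_trans (connectS (subsetUr _ _) zy) (connect1 _).
  rewrite erel_sym /erel setU11 andbT; apply: contraNneq nc => ->; exact: connect0.
by rewrite -gE imset_f // !inE cls_eq nc imset_f.
Qed.

Definition edges a W := [set [set x; y] | x in W, y in W & a x y].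

Lemma edgesP a W e :
  reflect (exists x y, [/\ x \in W, y \in W, a x y & e = [set x; y]]) (e \in edges a W).
Proof.
apply: (iffP imset2P) => [[x y xW]|[x [y [xW yW axy ->]]]].
  by rewrite inE => /andP[yW axy] ->; exists x, y.
by exists x y; rewrite ?inE ?yW.
Qed.

Lemma edges_pair a W e : e \in edges a W -> exists x y, e = [set x; y].
Proof. by case/edgesP=> x [y [_ _ _ ->]]; exists x, y. Qed.

Lemma edgesS a W1 W2 : W1 \subset W2 -> edges a W1 \subset edges a W2.
Proof.
move=> /subsetP sW; apply/subsetP => e /edgesP[x [y [xW yW axy ->]]].
by apply/edgesP; exists x, y; split=> //; apply: sW.
Qed.

Section Graph.
Variable a : rel V.
Hypothesis (a_sym : symmetric a) (a_irr : irreflexive a).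

Lemma a_neq x y : a x y -> x != y.
Proof. by apply: contraTneq => ->; rewrite a_irr. Qed.

Lemma mem_edges W x y : ([set x; y] \in edges a W) = [&& x \in W, y \in W & a x y].
Proof.
apply/edgesP/and3P => [[u [v [uW vW auv /set2_eq]]]|[xW yW axy]]; last by exists x, y.
by case=> -[-> ->] //; rewrite a_sym.
Qed.

Lemma erel_edges W x y : erel (edges a W) x y = [&& x \in W, y \in W & a x y].
Proof.
rewrite /erel mem_edges andbC; apply/andb_idr => /and3P[_ _]; exact: a_neq.
Qed.

Lemma erel_sub_edges F W x y :
  F \subset edges a W -> erel F x y -> [/\ x \in W, y \in W & a x y].
Proof. by move=> FW /(erelS FW); rewrite erel_edges => /and3P. Qed.

Lemma acyc_card F W : F \subset edges a W -> acyc F -> #|F| + ncls F W <= #|W|.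
Proof.
elim: {F}#|F| {-2}F (erefl #|F|) => [|n IH] F Fn FW aF.
  by rewrite (cards0_eq Fn) ncls0 cards0.
have [e eF] : exists e, e \in F by apply/set0Pn; rewrite -card_gt0 Fn.
have /edgesP[x [y [xW yW axy Ee]]] := subsetP FW e eF.
have nc : ~~ connect (erel (F :\ e)) x y.
  by rewrite Ee; apply: (acycP _ aF); rewrite /erel -Ee eF a_neq.
have Fe : #|F :\ e| = n by move: Fn; rewrite (cardsD1 e) eF => -[].
have := IH _ Fe (subset_trans (subD1set _ _) FW) (acycS (subD1set _ _) aF).
have := ncls_merge xW yW nc; rewrite -Ee setD1K // Fn Fe; lia.
Qed.

Lemma conn_card F W : F \subset edges a W -> #|W| <= #|F| + ncls F W.
Proof.
elim: {F}#|F| {-2}F (erefl #|F|) => [|n IH] F Fn FW.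
  by rewrite (cards0_eq Fn) ncls0 cards0.
have [e eF] : exists e, e \in F by apply/set0Pn; rewrite -card_gt0 Fn.
have /edgesP[x [y [xW yW axy Ee]]] := subsetP FW e eF.
have Fe : #|F :\ e| = n by move: Fn; rewrite (cardsD1 e) eF => -[].
have := IH _ Fe (subset_trans (subD1set _ _) FW).
have := ncls_add (F :\ e) W x y; rewrite -Ee setD1K // Fn Fe; lia.
Qed.

Definition conn F W := forall x y, x \in W -> y \in W -> connect (erel F) x y.

Lemma conn_ncls F W : conn F W -> ncls F W <= 1.
Proof.
move=> c; apply/card_le1P => _ /imsetP[x xW ->] C.
apply/idP/eqP => [/imsetP[y yW ->]|->]; last by apply: imset_f.
by apply/eqP; rewrite cls_eq c.
Qed.

Lemma ncls_gt0 F W x : x \in W -> 0 < ncls F W.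
Proof. by move=> xW; apply/card_gt0P; exists (cls F x); apply: imset_f. Qed.

Definition deg F x := #|[set y | erel F x y]|.
Definition ints F := [set x | 1 < deg F x].

Lemma degS F K x : F \subset K -> deg F x <= deg K x.
Proof.
by move=> FK; apply/subset_leq_card/subsetP => y; rewrite !inE; apply: erelS.
Qed.

Lemma intsS F K : F \subset K -> ints F \subset ints K.
Proof.
move=> FK; apply/subsetP => x; rewrite !inE => /leq_trans; apply; exact: degS.
Qed.

Lemma intsP F x : reflect (exists y z, [/\ y != z, erel F x y & erel F x z]) (x \in ints F).
Proof.
rewrite inE; apply: (iffP card_gt1P) => [[y [z []]]|[y [z [yz xy xz]]]].
  by rewrite !inE => xy xz yz; exists y, z.
by exists y, z; rewrite !inE.
Qed.

End Graph.
End Forests.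

(** * Splitting sparse sets *)

Section Decomposition.
Variables (V : finType) (N : V -> {set V}) (L : {set V}).

Definition nbhd (Y : {set V}) : {set V} := \bigcup_(y in Y) N y.

Lemma nbhdP (Y : {set V}) v : reflect (exists2 y, y \in Y & v \in N y) (v \in nbhd Y).
Proof. exact: bigcupP. Qed.

Lemma nbhdS (X Y : {set V}) : X \subset Y -> nbhd X \subset nbhd Y.
Proof.
move=> /subsetP XY; apply/subsetP => v /nbhdP[y yX vy].
by apply/nbhdP; exists y => //; apply: XY.
Qed.

(** Hall's theorem with capacity two, obtained from the algorithm: every neighbor is offered twice,
    and a failed auction would return a set [Y] that violates the hypothesis. *)
Lemma hall2 : (forall Y : {set V}, Y \subset L -> #|Y| <= 2 * #|nbhd Y|) ->
  exists m : V -> V, (forall x, x \in L -> m x \in N x) /\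
    forall s, #|[set y in L | m y == s]| <= 2.
Proof.
move=> H; pose a x v := v \in N x; pose S := nbhd L.
pose slots := enum S ++ enum S.
have [/auction_success|/auction_failure] := boolP (nilp (auction a (enum L) slots).1);
    last first.
  move=> [X [Y [pXY]]]; have uX : uniq X.
    by have := perm_uniq pXY; rewrite enum_uniq cat_uniq => /and3P[].
  have XL : [set x in X] \subset L.
    apply/subsetP => x; rewrite inE => xX; rewrite -mem_enum -(perm_mem pXY).
    by rewrite mem_cat xX.
  have := H _ XL; rewrite cardsE (card_uniqP uX) => h1.
  have : #|nbhd [set x in X]| <= count (fun v => has (a^~ v) X) (enum S).
    rewrite cardE -size_filter; apply: uniq_leq_size (enum_uniq _) _ => v.
    rewrite mem_enum => vX; rewrite mem_filter mem_enum (subsetP (nbhdS XL)) // andbT.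
    by have /nbhdP[y] := vX; rewrite inE => yX vy; apply/hasP; exists y.
  rewrite /slots count_cat => h2 h3.
  have := leq_trans h3 (leq_trans h1 (leq_mul (leqnn 2) h2)).
  by rewrite mul2n -addnn ltnn.
move=> [p [p1 p2 p3 pa]].
have u1 : uniq [seq q.1 | q <- p] by rewrite (perm_uniq p1) enum_uniq.
pose m x := (nth (x, x) p (index x [seq q.1 | q <- p])).2.
have mp q : q \in p -> m q.1 = q.2.
  move=> qp; have i1 : index q p < size p by rewrite index_mem.
  rewrite /m (_ : index _ _ = index q p); first by rewrite (set_nth_default q) // nth_index.
  rewrite -{1}(nth_index q qp) -(nth_map q q.1 (fun q => q.1)) // index_uniq //.
  by rewrite size_map.
have Lp x : x \in L -> exists2 q, q \in p & q.1 = x.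
  by rewrite -mem_enum -(perm_mem p1) => /mapP[q]; exists q.
exists m; split=> [x /Lp[q qp <-]|s]; first by rewrite mp //; apply: pa.
have le : count (pred1 s) [seq q.2 | q <- p] <= 2.
  apply: leq_trans (leq_count_subseq _ p2) _; rewrite (permP p3) count_cat.
  by rewrite !count_uniq_mem ?enum_uniq //; case: (_ \in _).
apply: leq_trans le.
have -> : [seq q.2 | q <- p] = [seq m x | x <- [seq q.1 | q <- p]].
  by rewrite -map_comp; apply/eq_in_map => q qp /=; rewrite mp.
rewrite count_map -size_filter cardE; apply: uniq_leq_size (enum_uniq _) _ => x.
rewrite mem_enum inE mem_filter => /andP[xL /eqP <-] /=; rewrite eqxx.
by rewrite (perm_mem p1) mem_enum.
Qed.

Hypothesis HL : forall Y : {set V}, Y \subset L -> Y != set0 -> #|Y| < 2 * #|nbhd Y|.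

(* Vertices enter [Z] one by one, each either with at most one preimage under
   [m], or through a preimage that has a neighbor in the current [Z]: as [L] is
   sparse, the vertices outside [Z] cannot all have two preimages whose
   neighbors avoid [Z]. *)
Lemma decomposition : exists (m par : V -> V) (ht : V -> nat) (I : {set V}),
  [/\ I \subset L, forall x, x \in L -> m x \in N x,
      {in I &, injective m}, {in L :\: I &, injective m} &
      forall x, x \in I -> par x \in N x /\ ht (par x) < ht (m x)].
Proof.
have [Y|m [mN m2]] := hall2.
  by have [->|/HL H /H /ltnW //] := eqVneq Y set0; rewrite cards0.
pose S := nbhd L; pose fib s := [set y in L | m y == s].
have mS x : x \in L -> m x \in S by move=> xL; apply/nbhdP; exists x => //; apply: mN.
(* Induction on the number of vertices outside [Z]. A member [x] of [I] links [m x] to the lower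
   [par x], both in [Z]; the other members of [L] with image in [Z] are matched injectively. *)
suff: forall n (Z : {set V}), #|S :\: Z| = n ->
  (exists par (ht : V -> nat) (I : {set V}),
    [/\ I \subset L, forall x, x \in I -> m x \in Z,
      {in I &, injective m}, {in [set x in L :\: I | m x \in Z] &, injective m} &
      forall x, x \in I -> [/\ par x \in N x, par x \in Z & ht (par x) < ht (m x)]]) ->
  exists (par : V -> V) (ht : V -> nat) (I : {set V}),
    [/\ I \subset L, {in I &, injective m}, {in L :\: I &, injective m} &
      forall x, x \in I -> par x \in N x /\ ht (par x) < ht (m x)].
  move=> /(_ _ set0 erefl) H; case: H => [|par [ht [I [IL i1 i2 h]]]]; last first.
    by exists m, par, ht, I.
  exists id, (fun=> 0), set0; split; try by move=> x; rewrite inE.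
  - exact: sub0set.
  - by move=> x y; rewrite !inE andbF.
elim=> [|n IH] Z Un [par [ht [I [IL IZ i1 i2 h]]]].
  have SZ : S \subset Z by rewrite -setD_eq0 -cards_eq0 Un.
  exists par, ht, I; split=> // [x y xL yL|x /h[]] //.
  have LZ z : z \in L :\: I -> z \in [set x in L :\: I | m x \in Z].
    by move=> zL; rewrite inE zL (subsetP SZ) // mS //; case/setDP: zL.
  by apply: i2; apply: LZ.
have step s : s \in S :\: Z -> #|S :\: (s |: Z)| = n.
  move=> sU; have -> : S :\: (s |: Z) = (S :\: Z) :\ s.
    by apply/setP => z; rewrite !inE negb_or andbA.
  by move: Un; rewrite (cardsD1 s) sU => -[].
(* A vertex [s] with at most one preimage enters [Z] without a link, its preimage joining the
   matched part. *)
have [s /andP[sU f1]|all2] := pickP (fun s => (s \in S :\: Z) && (#|fib s| <= 1)).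
  apply: (IH _ (step s sU)); exists par, ht, I; split=> //.
  - by move=> x xI; rewrite inE IZ ?orbT.
  - move=> x y; rewrite !inE -!andbA => /and3P[xI xL xZ] /and3P[yI yL yZ] E.
    have [xs|xs] := eqVneq (m x) s.
      by apply: (card_le1_eqP f1); rewrite !inE ?xL ?yL -?E xs eqxx.
    apply: i2 => //; rewrite !inE ?xI ?yI ?xL ?yL /=.
      by rewrite (negbTE xs) in xZ.
    by rewrite -E (negbTE xs) E in yZ.
  - by move=> x /h[? pZ ?]; rewrite inE pZ orbT.
pose YU := [set y in L | m y \in S :\: Z].
have cYU : 2 * #|S :\: Z| <= #|YU|.
  rewrite -[#|YU|]sum1_card (partition_big m (mem (S :\: Z))) => [|y]; last by case/setIdP.
  rewrite mulnC -sum_nat_const leq_sum // => s sU; rewrite sum1dep_card.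
  have := all2 s; rewrite sU /= => /negbT; rewrite -ltnNge => /leq_trans; apply.
  apply/subset_leq_card/subsetP => y; rewrite !inE => /andP[yL /eqP my].
  by rewrite my yL eqxx andbT; rewrite inE in sU.
have YUL : YU \subset L by apply/subsetP => y /setIdP[].
have YU0 : YU != set0 by rewrite -card_gt0; apply: leq_trans cYU; rewrite Un.
(* Since [YU] has at least twice as many elements as [S :\: Z], sparseness makes its neighborhood
   larger than [S :\: Z], so it reaches some [p] in [Z]. *)
have /subsetPn[p /nbhdP[y yYU py] pU] : ~~ (nbhd YU \subset S :\: Z).
  apply/negP => /subset_leq_card; rewrite leqNgt => /negP; apply.
  by rewrite -(ltn_pmul2l (isT : 0 < 2)); apply: leq_ltn_trans cYU (HL YUL YU0).
have pZ : p \in Z.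
  have pS : p \in S by apply: (subsetP (nbhdS YUL)); apply/nbhdP; exists y.
  by move: pU; rewrite inE pS andbT negbK.
move: yYU; rewrite inE => /andP[yL myU].
have myZ : m y \notin Z by case/setDP: myU.
have yI : y \notin I by apply: contra myZ => /IZ.
apply: (IH _ (step _ myU)).
(* [y] joins the forest part and places [m y] one level above [p]. As fibers have at most two
   elements, at most one other preimage of [m y] is left for the matched part. *)
exists (fun x => if x == y then p else par x),
  (fun s => if s == m y then (ht p).+1 else ht s), (y |: I).
have f1 : #|fib (m y) :\ y| <= 1.
  by have := m2 (m y); rewrite (cardsD1 y) inE yL eqxx.
have neZ z : z \in Z -> (z == m y) = false by move=> zZ; apply: contraNF myZ => /eqP<-.
split.
- by rewrite subUset sub1set yL.
- by move=> x; rewrite !inE => /orP[/eqP->|/IZ ->]; rewrite ?eqxx ?orbT.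
- move=> x1 x2; rewrite !inE => /orP[/eqP->|x1I] /orP[/eqP->|x2I] // E.
  + by case/negP: myZ; rewrite E IZ.
  + by case/negP: myZ; rewrite -E IZ.
  + exact: i1.
- move=> x1 x2; rewrite !inE !negb_or -!andbA.
  move=> /and4P[x1y x1I x1L x1Z] /and4P[x2y x2I x2L x2Z] E.
  have [E1|ne] := eqVneq (m x1) (m y).
    by apply: (card_le1_eqP f1); rewrite !inE ?x1y ?x2y ?x1L ?x2L -?E E1 eqxx.
  apply: i2 => //; rewrite !inE ?x1I ?x2I ?x1L ?x2L /=.
    by rewrite (negbTE ne) in x1Z.
  by rewrite -E (negbTE ne) E in x2Z.
- move=> x; rewrite !inE => /orP[/eqP->|xI].
    by rewrite !eqxx pZ orbT neZ.
  have [p1 p2 p3] := h x xI.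
  have -> : (x == y) = false by apply: contraNF yI => /eqP<-.
  by rewrite p1 p2 orbT !neZ // IZ.
Qed.

End Decomposition.

Section Graph.
Variables (V : finType) (a : rel V).
Hypothesis (a_sym : symmetric a) (a_irr : irreflexive a).
Implicit Types (F T : {set {set V}}) (W L X Y : {set V}).

Definition nb W x : {set V} := [set v in W | a x v].

Notation nbs W := (nbhd (nb W)).

Lemma nbsP W Y v : reflect (exists2 y, y \in Y & a y v && (v \in W)) (v \in nbs W Y).
Proof.
apply: (iffP (nbhdP _ _ _)) => -[y yY]; rewrite ?inE => h; exists y => //.
  by rewrite andbC.
by rewrite inE andbC.
Qed.

Definition indep L := forall x y, x \in L -> y \in L -> ~~ a x y.

Definition sparse W L :=
  forall Y, Y \subset L -> Y != set0 -> #|Y| < 2 * #|nbs W Y|.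

(** [gf_ints] bounds from below the internal vertices of every connected extension of [F], and
    locates them in [L] and its neighborhood, so that others can be added to the count. In the tight
    case [3 * #|nbs W L| - 2] is the number of edges of a spanning tree of [L :|: nbs W L], and
    [gf_tight] says that [F] is one. *)
Record good_forest W L F : Prop := GoodForest {
  gf_sub : F \subset edges a W;
  gf_acyc : acyc F;
  gf_edge : forall e, e \in F ->
    exists x y, [/\ x \in L, y \in nbs W L & e = [set x; y]];
  gf_ints : forall T W', F \subset T -> T \subset edges a W' -> conn T W' ->
    L \subset W' -> 2 < #|W'| -> #|L| <= #|ints T :&: (L :|: nbs W L)|;
  gf_tight : #|L|.+1 = 2 * #|nbs W L| -> L != set0 ->
    #|F| + 2 <= 3 * #|nbs W L| /\ conn F (L :|: nbs W L) }.

(** [F] joins each [x] in [L] to [m x], and each [x] in [I] also to [par x]. Hence members of [I]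
    are internal, and any other [x] is internal itself or hangs as a leaf at [m x], which is then
    internal; injectivity of [m] outside [I] prevents double counting. *)
Lemma good_forest_exists W L : L \subset W -> indep L -> sparse W L ->
  exists F, good_forest W L F.
Proof.
move=> LW iL sL; have [m [par [ht [I [IL mN mI mM pI]]]]] := decomposition sL.
set S := nbs W L.
have mS x : x \in L -> m x \in S.
  by move=> xL; apply/nbhdP; exists x => //; apply: mN.
have pS x : x \in I -> par x \in S.
  move=> xI; apply/nbhdP; exists x; first exact: (subsetP IL).
  by case: (pI x xI).
have SL y : y \in S -> y \notin L.
  by move=> /nbsP[x xL /andP[axy _]]; apply: contraTN axy => yL; apply: iL.
pose F := [set [set x; m x] | x in L] :|: [set [set x; par x] | x in I].
have FP e : e \in F -> (exists2 x, x \in L & e = [set x; m x]) \/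
    (exists2 x, x \in I & e = [set x; par x]).
  by rewrite inE => /orP[] /imsetP[x xL ->]; [left|right]; exists x.
have Fm x : x \in L -> [set x; m x] \in F by move=> xL; rewrite inE (imset_f (fun x => [set x; m x])).
have Fp x : x \in I -> [set x; par x] \in F by move=> xI; rewrite inE orbC (imset_f (fun x => [set x; par x])).
have neL x y : x \in L -> y \in S -> x != y.
  by move=> xL /SL; apply: contraNneq => <-.
have eFm x : x \in L -> erel F x (m x).
  by move=> xL; rewrite /erel Fm // neL // mS.
have eFp x : x \in I -> erel F x (par x).
  by move=> xI; rewrite /erel Fp // neL ?pS // (subsetP IL).
exists F; split.
- apply/subsetP => e /FP[[x xL ->]|[x xI ->]]; rewrite mem_edges //.
    by move: (mN x xL); rewrite inE (subsetP LW x xL).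
  by have [] := pI x xI; rewrite inE (subsetP LW x (subsetP IL x xI)).
(* For [x] in [I], the parent of [m x] is [x] and the parent of [x] is [par x]; for [x] outside [I],
   the parent is [m x]. Doubling [ht] leaves room for [L] between the levels of [S]: members of [I]
   go just below [m x], the others just above. *)
- pose pr v := if v \in L then (if v \in I then par v else m v)
               else if [pick x in I | m x == v] is Some x then x else v.
  pose ht' v := if v \in L then (if v \in I then 2 * ht (m v) else 2 * ht (m v) + 2)
               else 2 * ht v + 1.
  apply: (@acyc_par _ _ ht' pr) => e /FP[[x xL ->]|[x xI ->]]; last first.
    have xL := subsetP IL x xI; have [_ lt] := pI x xI.
    exists x; rewrite /pr /ht' xL xI //= (negbTE (SL _ (pS _ xI))); lia.
  have [xI|xI] := boolP (x \in I); last first.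
    by exists x; rewrite /pr /ht' xL (negbTE xI) //= (negbTE (SL _ (mS _ xL))); lia.
  have prm : pr (m x) = x.
    rewrite /pr (negbTE (SL _ (mS _ xL))); case: pickP => [y /andP[yI /eqP]|/(_ x)].
      exact: mI.
    by rewrite xI eqxx.
  exists (m x); first by rewrite prm setUC.
  by rewrite prm /ht' xL xI (negbTE (SL _ (mS _ xL))); lia.
- move=> e /FP[[x xL ->]|[x xI ->]]; first by exists x, (m x); split=> //; apply: mS.
  by exists x, (par x); split=> //; [apply: (subsetP IL)|apply: pS].
- move=> T W' FT TW' cT LW' W2.
  pose phi x := if (x \in I) || (x \in ints T) then x else m x.
  have phiI x : x \in L -> phi x \in ints T.
    move=> xL; rewrite /phi; case: ifP => [/orP[xI|//]|].
      apply/intsP; exists (m x), (par x); split; last first.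
      + exact: erelS FT _ _ (eFp _ xI).
      + exact: erelS FT _ _ (eFm _ xL).
      + by have [_] := pI x xI; apply: contraTneq => ->; rewrite ltnn.
    move=> /norP[xI xT]; apply/intsP.
    have Txm : erel T x (m x) by apply: erelS FT _ _ (eFm _ xL).
    have [w /andP[wx mw]|none] := pickP (fun w => (w != x) && erel T (m x) w).
      by exists w, x; split=> //; rewrite erel_sym.
    (* If [m x] had no neighbor besides [x], then [x] and [m x] alone would form a component of [T],
       against [2 < #|W'|]. *)
    have only z : z \in W' -> z \in [set x; m x].
      move=> zW'; have c := cT x z (subsetP LW' x xL) zW'.
      apply: (connect_closed (P := fun z => z \in [set x; m x])) c _; last by rewrite set21.
      move=> u v uv; rewrite !inE => /orP[]/eqP Eu; subst u.
        apply/orP; right; apply: contraNT xT => vm; apply/intsP.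
        by exists v, (m x).
      by have /negbT := none v; rewrite uv andbT negbK => ->.
    have : #|W'| <= #|[set x; m x]| by apply/subset_leq_card/subsetP.
    by rewrite cards2 leqNgt (leq_trans _ W2) //; case: (_ != _).
  have phi_inj : {in L &, injective phi}.
    move=> x y xL yL; rewrite /phi; case: ifP => [_|/norP[xI xT]].
      case: ifP => [//|_ E]; have := neL _ _ xL (mS _ yL); by rewrite E eqxx.
    case: ifP => [_ E|/norP[yI yT]].
      by have := neL _ _ yL (mS _ xL); rewrite E eqxx.
    by apply: mM; rewrite inE ?xI ?yI.
  rewrite -(card_in_imset phi_inj); apply/subset_leq_card/subsetP => _ /imsetP[x xL ->].
  rewrite inE phiI // inE /phi; case: ifP => _; first by rewrite xL.
  by rewrite mS ?orbT.
- rewrite -/S => tight L0.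
  have S0 : exists s, s \in S.
    by case/set0Pn: L0 => x /mS; exists (m x).
  (* A vertex [r] of least height is not [m x] for any [x] in [I]. So [I] has at most [#|S| - 1]
     elements and [L :\: I] at most [#|S|]; tightness forces equality, every other vertex of [S] has
     a lower parent, and [r] is the root of all. *)
  have [s0 s0S] := S0; case: (@arg_minnP _ s0 (mem S) ht s0S) => r /= rS rmin.
  have rI : r \notin m @: I.
    apply/negP => /imsetP[x xI E]; have [_] := pI x xI; rewrite -E ltnNge.
    by rewrite (rmin (par x)) //; apply: pS.
  have sub : m @: I \subset S :\ r.
    apply/subsetP => y yI; rewrite !inE (memPn rI) //=.
    by case/imsetP: yI => x xI ->; apply/mS/(subsetP IL).
  have cI : #|I| = #|m @: I| by rewrite card_in_imset.
  have cM : #|L :\: I| = #|m @: (L :\: I)| by rewrite card_in_imset.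
  have leM : #|L :\: I| <= #|S|.
    rewrite cM; apply/subset_leq_card/subsetP => _ /imsetP[x /setDP[xL _] ->]; exact: mS.
  have leI := subset_leq_card sub.
  have cS : #|S| = #|S :\ r|.+1 by rewrite (cardsD1 r S) rS.
  have cL : #|L| = #|I| + #|L :\: I|.
    by rewrite -(cardsID I L) (setIidPr IL).
  split.
    have cF : #|F| <= #|L| + #|I|.
      by apply: leq_trans (leq_card_setU _ _).1 (leq_add _ _); apply: leq_imset_card.
    by apply: leq_trans (leq_add cF (leqnn 2)) _; lia.
  have Ir : m @: I = S :\ r.
    by apply/eqP; rewrite eqEcard sub /=; lia.
  have toR : forall n y, ht y < n -> y \in S -> connect (erel F) y r.
    elim=> // n IH y yn yS; have [->|yr] := eqVneq y r; first exact: connect0.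
    have : y \in m @: I by rewrite Ir !inE yr.
    case/imsetP=> x xI Ey; have [_ lt] := pI x xI.
    apply: (@connect_trans _ _ x).
      by rewrite connectC Ey; apply/connect1/eFm/(subsetP IL).
    apply: connect_trans (connect1 (eFp x xI)) (IH _ _ (pS _ xI)).
    by rewrite -ltnS (leq_trans _ yn) // Ey.
  have toR' y : y \in L :|: S -> connect (erel F) y r.
    rewrite inE => /orP[yL|yS]; last exact: toR (ltnSn _) yS.
    by apply: connect_trans (connect1 (eFm y yL)) (toR _ _ (ltnSn _) (mS _ yL)).
  by move=> x y /toR' xr /toR'; rewrite connectC; apply: connect_trans.
Qed.

End Graph.

(** * Spanning trees with many internal vertices *)

Section Graph.
Variables (V : finType) (a : rel V).
Hypothesis (a_sym : symmetric a) (a_irr : irreflexive a).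
Implicit Types (F T : {set {set V}}) (W L X Y : {set V}).

Definition spanning_tree W T := [/\ T \subset edges a W, acyc T & conn T W].

Lemma spanning_extend W F : conn (edges a W) W -> F \subset edges a W -> acyc F ->
  exists2 T : {set {set V}}, F \subset T & spanning_tree W T.
Proof.
move=> cW FW aF; have [T FT [TW aT cT]] := acyc_extend (@edges_pair _ a W) aF FW.
by exists T => //; split=> // x y xW yW; apply/cT/cW.
Qed.

Lemma path_avoid T z w x p : path (erel T) x p -> z \notin x :: p ->
  connect (erel (T :\ [set z; w])) x (last x p).
Proof.
move=> pT zp; apply/connectP; exists p => //.
apply: (sub_in_path (P := fun v => v != z) (e := erel T)) pT; last first.
  by apply/allP => v vp; apply: contraNneq zp => <-.
move=> u v uz vz /andP[uv uvT]; rewrite /erel uv !inE uvT andbT.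
apply/eqP => E; have [[e1 _]|[_ e1]] := set2_eq E.
  by rewrite unfold_in e1 eqxx in uz.
by rewrite unfold_in e1 eqxx in vz.
Qed.

Lemma ints_sub W T : T \subset edges a W -> ints T \subset W.
Proof.
move=> TW; apply/subsetP => x /intsP[y [z [_ xy _]]].
by have [] := erel_sub_edges a_sym a_irr TW xy.
Qed.

Lemma notin_intsP T x : x \notin ints T ->
  forall y z, erel T x y -> erel T x z -> y = z.
Proof.
move=> xT y z xy xz; apply/eqP; apply: contraNT xT => yz.
by apply/intsP; exists y, z.
Qed.

(* If the path of [T] between two adjacent leaves [u] and [v] misses a vertex,
   then it can be left at some [z] towards some [z'], and replacing the edge
   entering [z] by [[set u; v]] yields a tree with more internal vertices. *)
Lemma adjacent_leaves W T u v : spanning_tree W T -> u \in W -> v \in W ->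
  u \notin ints T -> v \notin ints T -> a u v ->
  #|W| <= #|ints T| + 2 \/
  exists2 T', spanning_tree W T' & #|ints T| < #|ints T'|.
Proof.
move=> [TW aT cT] uW vW uT vT auv.
have /connectP[p0 pp0 vE] := cT u v uW vW.
case/shortenP: pp0 vE => p pp up _ vE {p0}.
have uv : u != v := a_neq a_irr auv.
have inner z : z \in p -> z != v -> exists p1 s p2,
    [/\ p = p1 ++ z :: s :: p2, erel T (last u p1) z & erel T z s].
  move=> zp zv; case/splitPr: zp pp up vE => p1 p2; rewrite cat_path last_cat /=.
  case: p2 => [|s p2] /= pp _ vE; first by rewrite vE eqxx in zv.
  by case/and4P: pp => _ ? ? _; exists p1, s, p2.
have uhead : exists2 h, h \in p & erel T u h.
  case: p pp vE {up inner} => [_ /eqP|h p /andP[uh _] _].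
    by rewrite eq_sym (negbTE uv).
  by exists h; rewrite ?mem_head.
have vpred : exists2 h, h \in u :: p & erel T v h.
  case/lastP: p pp vE {up inner uhead} => [_ /eqP|p h].
    by rewrite eq_sym (negbTE uv).
  rewrite last_rcons rcons_path => /andP[_ hv] ->.
  by exists (last u p); rewrite 1?erel_sym // -rcons_cons mem_rcons inE mem_last orbT.
(* If the path covers [W], all its vertices except the two ends are internal. *)
have [sub|/subsetPn[x xW xp]] := boolP (W \subset [set x in u :: p]).
  left; have : W :\: [set u; v] \subset ints T.
    apply/subsetP => z /setDP[zW zuv].
    have /andP[zu zv] : (z != u) && (z != v) by rewrite -negb_or -in_set2.
    have : z \in u :: p by have := subsetP sub z zW; rewrite inE.
    rewrite inE (negbTE zu) => /inner /(_ zv) [p1 [s [p2 [Ep e1 e2]]]].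
    apply/intsP; exists (last u p1), s; split=> //; last by rewrite erel_sym.
    move: up; rewrite Ep -cat_cons cat_uniq => /and3P[_ /hasPn /(_ s)].
    rewrite !inE eqxx !orbT => /(_ isT) /= sp _.
    by apply: contraNneq sp => <-; apply: mem_last.
  move/subset_leq_card; have := cards2 u v; rewrite uv => c2.
  by have := cardsID [set u; v] W; have := subset_leq_card (subsetIr W [set u; v]); lia.
right.
have [z zp [z' zz' z'p]] : exists2 z, z \in u :: p & exists2 z', erel T z z' & z' \notin u :: p.
  have [/hasP[z zp /existsP[z' /andP[? ?]]]|/hasPn H] :=
    boolP (has (fun z => [exists z', erel T z z' && (z' \notin u :: p)]) (u :: p)).
    by exists z => //; exists z'.
  case/negP: xp; rewrite inE.
  apply: (connect_closed (P := fun z => z \in u :: p)) (cT u x uW xW) (mem_head _ _).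
  move=> y w yw /H /existsPn /(_ w); by rewrite yw negbK.
have zu : z != u.
  apply: contraNneq z'p => zu; have [h hp uh] := uhead; rewrite zu in zz'.
  by rewrite (notin_intsP uT zz' uh) inE hp orbT.
have zv : z != v.
  apply: contraNneq z'p => zv; have [h hp uh] := vpred; rewrite zv in zz'.
  by rewrite (notin_intsP vT zz' uh).
have {}zp : z \in p by move: zp; rewrite inE (negbTE zu).
have [p1 [s [p2 [Ep e1 e2]]]] := inner z zp zv.
set w := last u p1 in e1.
move: up; rewrite Ep -cat_cons cat_uniq => /and3P[up1 /hasPn disj up2].
have wp1 : w \in u :: p1 by apply: mem_last.
have zp1 : z \notin u :: p1 by apply: disj; rewrite mem_head.
have wp2 : w \notin z :: s :: p2 by apply/negP => /disj; rewrite wp1.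
have vE2 : v = last z (s :: p2) by rewrite vE Ep last_cat.
have vp2 : v \in s :: p2 by rewrite vE2 /= mem_last.
have vw : v != w by apply: contraNneq wp2 => <-; rewrite inE vp2 orbT.
move: pp; rewrite Ep cat_path /= => /and3P[pp1 _ pp2].
pose T1 := T :\ [set z; w].
have ezw : erel T z w by rewrite erel_sym.
have nzw : ~~ connect (erel T1) z w by apply: (acycP _ aT).
have cuw : connect (erel T1) u w by apply: path_avoid.
have czv : connect (erel T1) z v.
  rewrite vE2 /T1 setUC; apply: path_avoid wp2.
  by rewrite /= e2; case/andP: pp2.
have nuv : ~~ connect (erel T1) u v.
  apply: contra nzw => c; apply: connect_trans czv _.
  by rewrite connectC; apply: connect_trans c; rewrite connectC.
pose T' := [set u; v] |: T1.
have T1T : T1 \subset T := subD1set _ _.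
have T1T' : T1 \subset T' := subsetUr _ _.
have euv : erel T' u v by rewrite /erel uv setU11.
exists T'; first split.
- by rewrite subUset sub1set mem_edges // uW vW auv /= (subset_trans T1T).
- exact: acyc_add (acycS T1T aT) nuv.
- have czw : connect (erel T') z w.
    apply: connect_trans (connectS T1T' czv) _.
    apply: connect_trans (connectS T1T' cuw).
    by rewrite connectC; apply: connect1.
  move=> y1 y2 y1W y2W; apply: (connect_sub _ (cT _ _ y1W y2W)) => x1 x2 /andP[x12 xT].
  have [E|ne] := eqVneq [set x1; x2] [set z; w].
    by case: (set2_eq E) => -[-> ->] //; rewrite connectC.
  by apply: connect1; rewrite /erel x12 !inE ne xT orbT.
have keep x1 x2 : x1 != z -> x1 != w -> erel T x1 x2 -> erel T' x1 x2.
  move=> xz xw /andP[ne xT]; rewrite /erel ne !inE xT andbT; apply/orP; right.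
  by apply/eqP => E; case: (set2_eq E) => -[E1 _]; rewrite E1 eqxx in xz xw.
have vI : v \in ints T'.
  have [h hp vh] := vpred; apply/intsP; exists u, h; split.
  - apply: contraTneq vh => <-; apply/negP => vu.
    have := nuv; rewrite connectC connect1 //.
    have [_ uvT] := andP vu; rewrite /erel eq_sym uv !inE uvT andbT.
    by apply/eqP => E; case: (set2_eq E) => -[E1 _]; rewrite E1 eqxx in vw zv.
  - by rewrite erel_sym.
  - by apply: keep => //; rewrite eq_sym.
have zI : z \in ints T'.
  apply/intsP; exists s, z'; split.
  - by apply: contraNneq z'p => <-; rewrite Ep inE mem_cat !inE eqxx !orbT.
  - rewrite /erel; have [-> sT] := andP e2; rewrite !inE sT andbT; apply/orP; right.
    apply/eqP => E; case: (set2_eq E) => -[E1 E2].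
      by move: wp2; rewrite -E2 !inE eqxx orbT.
    by move: e2; rewrite E2 /erel eqxx.
  - rewrite /erel; have [-> zT] := andP zz'; rewrite !inE zT andbT; apply/orP; right.
    apply/eqP => E; case: (set2_eq E) => -[E1 E2].
      by case/negP: z'p; rewrite E2 Ep -cat_cons mem_cat wp1.
    by move: zz'; rewrite E2 /erel eqxx.
(* Only [w] can stop being internal, since [z] keeps the two neighbors [s] and [z']. If [w] is [u],
   it was a leaf, nothing is lost and [v] is gained; otherwise [u] and [v] are both gained against
   the loss of [w]. *)
have others y : y != w -> y \in ints T -> y \in ints T'.
  move=> yw; have [->|yz] := eqVneq y z; first by rewrite zI.
  move=> /intsP[y1 [y2 [y12 xy1 xy2]]]; apply/intsP.
  by exists y1, y2; split=> //; apply: keep.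
have [wu|wu] := eqVneq w u.
  apply: proper_card; apply/properP; split; last by exists v.
  apply/subsetP => y yT; apply: others => //.
  by apply: contraNneq uT => yw; rewrite -wu -yw.
have uI : u \in ints T'.
  have [h hp uh] := uhead; apply/intsP; exists v, h; split=> //.
  - apply: contraTneq uh => <-; apply/negP => vu.
    have := nuv; rewrite connect1 //.
    have [_ uvT] := andP vu; rewrite /erel uv !inE uvT andbT.
    by apply/eqP => E; case: (set2_eq E) => -[E1 _];
      [rewrite E1 eqxx in zu|rewrite E1 eqxx in wu].
  - by apply: keep; rewrite // eq_sym.
have sub : ints T :\ w \subset ints T' :\ u :\ v.
  apply/subsetP => y /setD1P[yw yT]; rewrite !in_setD1 (others _ yw yT) andbT.
  by apply/andP; split; [apply: contraNneq vT|apply: contraNneq uT] => <-.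
rewrite (cardsD1 w (ints T)) (cardsD1 u (ints T')) uI (cardsD1 v (ints T' :\ u)).
rewrite in_setD1 vI eq_sym uv.
by apply: leq_ltn_trans (leq_add (leq_b1 _) (subset_leq_card sub)) _; rewrite !add1n.
Qed.

Lemma half_internal W : conn (edges a W) W -> 2 < #|W| ->
  sparse a W W -> exists2 T, spanning_tree W T & #|W| <= 2 * #|ints T| + 1.
Proof.
move=> cW W2 sW.
pose P T := [&& T \subset edges a W, acyc T &
  [forall x in W, forall y in W, connect (erel T) x y]].
have PP T : reflect (spanning_tree W T) (P T).
  apply: (iffP and3P) => -[TW aT cT]; split=> //.
    by move=> x y xW yW; move/forall_inP: cT => /(_ x xW) /forall_inP /(_ y yW).
  by apply/forall_inP => x xW; apply/forall_inP => y yW; apply: cT.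
have [T0 _ /PP PT0] := spanning_extend cW (sub0set _) (acyc0 _).
case: (@arg_maxnP _ T0 P (fun T => #|ints T|) PT0) => T /PP sT maxT.
have [TW aT cT] := sT; exists T => //.
pose L := W :\: ints T.
have cL : #|W| = #|ints T| + #|L|.
  by rewrite -(cardsID (ints T) W) (setIidPr (ints_sub TW)).
have [/existsP[u /existsP[v /and3P[/setDP[uW uT] /setDP[vW vT] auv]]]|nadj] :=
    boolP [exists u, exists v, [&& u \in L, v \in L & a u v]].
  (* Here [#|W| <= #|ints T| + 2], and [2 < #|W|] yields an internal vertex. This is the case that
     accounts for the added 1; independent leaves give [#|W| <= 2 * #|ints T|]. *)
  have [le|[T' /PP /maxT]] := adjacent_leaves sT uW vW uT vT auv; first by lia.
  by rewrite /= leqNgt => /negbTE ->.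
have iL : indep a L.
  move=> x y xL yL; apply: contra nadj => axy.
  by apply/existsP; exists x; apply/existsP; exists y; rewrite xL yL.
have LW : L \subset W := subsetDl _ _.
have sL : sparse a W L by move=> Y YL; apply: sW; apply: subset_trans LW.
have [F gF] := good_forest_exists a_sym LW iL sL.
have [T' FT' sT'] := spanning_extend cW (gf_sub gF) (gf_acyc gF).
have [T'W _ cT'] := sT'.
have leT' : #|ints T'| <= #|ints T| := maxT _ (introT (PP _) sT').
have := leq_trans (gf_ints gF FT' T'W cT' LW W2) (subset_leq_card (subsetIl _ _)).
by move/leq_trans/(_ leT'); lia.
Qed.

End Graph.

(** * Deleting a vertex *)

Section Cardinals.
Variables (V : finType) (T : {set {set V}}).

(** Choose an edge at every vertex of [Y] and a second one at the internal ones; no edge is chosen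
    twice, because none has both ends in [Y]. *)
Lemma star_card (Y : {set V}) :
  (forall y, y \in Y -> exists z, erel T y z) ->
  (forall y z, y \in Y -> erel T y z -> z \notin Y) ->
  #|Y| + #|ints T :&: Y| <= #|[set e in T | ~~ [disjoint e & Y]]|.
Proof.
move=> nbr out.
pose n1 y := odflt y [pick z | erel T y z].
pose n2 y := odflt y [pick z | erel T y z && (z != n1 y)].
have n1P y : y \in Y -> erel T y (n1 y).
  by move=> /nbr[z yz]; rewrite /n1; case: pickP => [//|/(_ z)]; rewrite yz.
have n2P y : y \in ints T -> erel T y (n2 y) && (n2 y != n1 y).
  move=> /intsP[z1 [z2 [z12 y1 y2]]]; rewrite /n2; case: pickP => [//|no].
  have := no z1; have := no z2; rewrite y1 y2 /= => /negbFE/eqP e2 /negbFE/eqP e1.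
  by rewrite e1 e2 eqxx in z12.
have inj (n : V -> V) (A : {set V}) : A \subset Y -> (forall y, y \in A -> erel T y (n y)) ->
    {in A &, injective (fun y => [set y; n y])}.
  move=> /subsetP AY nA y z yA zA /set2_eq[[]//|[E1 E2]].
  by have := out z (n z) (AY z zA) (nA z zA); rewrite -E1 AY.
pose E1 := [set [set y; n1 y] | y in Y]; pose E2 := [set [set y; n2 y] | y in ints T :&: Y].
have n2Y y : y \in ints T :&: Y -> erel T y (n2 y).
  by move=> /setIP[/n2P /andP[]].
have c1 : #|E1| = #|Y| by rewrite card_in_imset //; apply: inj.
have c2 : #|E2| = #|ints T :&: Y| by rewrite card_in_imset //; apply: inj (subsetIr _ _) _.
have dis : E1 :&: E2 = set0.
  apply/setP => e; rewrite inE in_set0; apply/negP => /andP[/imsetP[y yY Ey] /imsetP[z zI Ez]].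
  have [zT zY] := setIP zI; have := Ey; rewrite Ez => /set2_eq[[zy n12]|[zn _]].
    by have /andP[_] := n2P z zT; rewrite n12 zy eqxx.
  by have := out y (n1 y) yY (n1P y yY); rewrite -zn zY.
rewrite -c1 -c2 -[X in X <= _]subn0 -[0](cards0 {set V}) -dis -cardsU.
apply/subset_leq_card/subsetP => e; rewrite inE => /orP[]/imsetP[y yE ->].
  have /andP[_ yT] := n1P y yE; rewrite inE yT /=.
  by apply/negP => /pred0P /(_ y); rewrite /= set21 yE.
have /andP[_ yT] := n2Y y yE; rewrite inE yT /=.
by apply/negP => /pred0P /(_ y); rewrite /= set21; case/setIP: yE => _ ->.
Qed.

(** Charge a vertex of [R] that stops being internal to one of its lost edges. Edges with both ends
    in [R] survive, so no lost edge is charged twice. *)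
Lemma lost_card (R : {set V}) (TR T' : {set {set V}}) :
  (forall u v, erel T u v -> u \in R -> [set u; v] \in TR) ->
  (forall u v, erel T u v -> u \in R -> v \in R -> [set u; v] \in T') ->
  #|ints T :&: R| <= #|ints T' :&: R| + #|TR :\: T'|.
Proof.
move=> TRP TRR; pose A := (ints T :&: R) :\: ints T'.
have -> : #|ints T :&: R| = #|(ints T :&: R) :&: ints T'| + #|A|.
  by rewrite cardsID.
apply: leq_add.
  by apply/subset_leq_card/subsetP => v; rewrite !in_setI => /andP[/andP[_ ->] ->].
pose n v := odflt v [pick z | erel T v z && ~~ erel T' v z].
have nP v : v \in A -> erel T v (n v) && ~~ erel T' v (n v).
  move=> /setDP[/setIP[/intsP[z1 [z2 [z12 v1 v2]]] vR] vT']; rewrite /n.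
  case: pickP => [//|no]; case/negP: vT'; apply/intsP; exists z1, z2.
  by have := no z1; have := no z2; rewrite v1 v2 => /negbFE -> /negbFE ->.
have AR v : v \in A -> v \in R by move=> /setDP[/setIP[]].
have new v : v \in A -> [set v; n v] \in TR :\: T'.
  move=> vA; have /andP[vn nv] := nP v vA; rewrite inE (TRP _ _ vn (AR v vA)) andbT.
  by apply: contra nv => vT'; rewrite /erel vT' andbT; case/andP: vn.
rewrite -(card_in_imset (f := fun v => [set v; n v]) (D := mem A)).
  by apply/subset_leq_card/subsetP => _ /imsetP[v vA ->]; apply: new.
move=> u v uA vA /= E; case: (set2_eq E) => -[E1 E2] //.
have /andP[un _] := nP u uA; have nuR : n u \in R by rewrite E2 AR.
by have := new u uA; rewrite inE (TRR _ _ un (AR u uA) nuR).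
Qed.

End Cardinals.

Section Deletion.
Variables (V : finType) (a : rel V).
Hypothesis (a_sym : symmetric a) (a_irr : irreflexive a).
Implicit Types (F T : {set {set V}}).
Variables (W Y : {set V}) (x : V).
Let S := nbhd (nb a W) Y.
Hypothesis (YW : Y \subset W) (xY : x \in Y) (cY : 2 * #|S| <= #|Y|).
Hypothesis Ymin : forall X : {set V}, X \proper Y -> X != set0 -> #|X| < 2 * #|nbhd (nb a W) X|.

Let SW : S \subset W.
Proof. by apply/subsetP => v /nbsP[y _ /andP[]]. Qed.

(** By minimality [Y :\ x] is not dense, which squeezes [#|Y|] to exactly [2 * #|S|]. If [S] met
    [Y], then [Y :\: S] would be a smaller dense set: its neighbors lie in [S :\: Y], and twice as
    many vertices are removed from the doubled side as from [Y]. *)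
Lemma dense_indep : S != set0 ->
  [/\ [disjoint S & Y], #|Y :\ x|.+1 = 2 * #|S| & nbhd (nb a W) (Y :\ x) = S].
Proof.
rewrite -card_gt0 => S0; have cYx : #|Y| = #|Y :\ x|.+1 by rewrite (cardsD1 x Y) xY.
have pr : Y :\ x \proper Y by apply: properD1.
have Yx0 : Y :\ x != set0 by rewrite -card_gt0; lia.
have sub : nbhd (nb a W) (Y :\ x) \subset S := nbhdS _ (subD1set _ _).
have := Ymin pr Yx0; have := subset_leq_card sub => le1 lt1.
have cE : #|Y :\ x|.+1 = 2 * #|S| by lia.
split=> //; last by apply/eqP; rewrite eqEcard sub; lia.
rewrite -setI_eq0; apply: contraT => SY0.
have : #|Y :\: S| < 2 * #|nbhd (nb a W) (Y :\: S)|.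
  apply: Ymin.
    apply/properP; split; first exact: subsetDl.
    by case/set0Pn: SY0 => v /setIP[vS vY]; exists v; rewrite // inE vS.
  rewrite -card_gt0; have := cardsID S Y; have := subset_leq_card (subsetIr Y S); lia.
have : #|nbhd (nb a W) (Y :\: S)| <= #|S :\: Y|.
  apply/subset_leq_card/subsetP => v /nbsP[y /setDP[yY yS] /andP[ayv vW]].
  rewrite inE; apply/andP; split; last by apply/nbsP; exists y; rewrite ?ayv.
  apply: contra yS => vY; apply/nbsP; exists v => //.
  by rewrite a_sym ayv (subsetP YW).
have := cardsID S Y; have := cardsID Y S; rewrite setIC.
by move: SY0; rewrite -card_gt0 setIC; lia.
Qed.

(* The edges of [T] at [Y] are exchanged for the forest built on [Y :\ x] and
   [S], and as many of the other edges as possible are kept.  An edge that is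
   lost has an end in [S], hence costs at most one internal vertex, and counting
   edges bounds the number of lost ones. *)
Lemma delete_vertex T : spanning_tree a W T -> 3 < #|W| ->
  exists2 T', spanning_tree a (W :\ x) T' & #|ints T| <= #|ints T'|.
Proof.
(* [s] is the size of [S], [i] and [r] count the internal vertices of [T] in [Y] and [R], [j] those
   of the new tree in [R], and [d] the lost edges. The edge counts of the two trees give
   [d <= s - 1 - i], hence [s + i + r <= (2 * s - 1) + j], where [2 * s - 1] is the size [y] of
   [Y :\ x]. *)
have arith (s w y i r d f tr ty t t' j u : nat) : y.+1 = 2 * s -> f + 2 <= 3 * s ->
    tr + ty <= t -> t + 1 <= w.+1 -> w <= t' + 1 -> y.+1 + i <= ty ->
    t' + d <= f + tr -> r <= j + d -> y + j <= u -> s + i + r <= u by lia.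
move=> [TW aT cT] W3; have xW := subsetP YW x xY.
have eT u v : erel T u v -> [/\ u \in W, v \in W & a u v].
  exact: erel_sub_edges.
have nbr v : v \in W -> exists w, erel T v w.
  move=> vW; apply/existsP; rewrite -[X in is_true X]negbK; apply/negP => /existsPn no.
  have : W \subset [set v].
    apply/subsetP => w wW; apply: (connect_closed (P := fun z => z \in [set v]))
      (cT v w vW wW) (set11 _) => y z yz /set1P Ey; by move: (no z); rewrite -Ey yz.
  by move/subset_leq_card; rewrite cards1; lia.
have [s0 s0S] : exists s, s \in S.
  have [w xw] := nbr x xW; have [_ wW axw] := eT _ _ xw.
  by exists w; apply/nbsP; exists x; rewrite ?axw.
have S0 : S != set0 by apply/set0Pn; exists s0.
have [SY cYx SE] := dense_indep S0.
have nS v : v \in S -> v \in Y = false by move=> vS; apply: (disjointFr SY).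
have YS u v : u \in Y -> a u v -> v \in W -> v \in S.
  by move=> uY auv vW; apply/nbsP; exists u; rewrite ?auv.
have iY : indep a (Y :\ x).
  move=> u v /setD1P[_ uY] /setD1P[_ vY]; apply/negP => auv.
  by have := nS v (YS u v uY auv (subsetP YW v vY)); rewrite vY.
have sY : sparse a W (Y :\ x).
  by move=> X XY; apply: Ymin; apply: sub_proper_trans XY (properD1 xY).
have YxW : Y :\ x \subset W by apply: subset_trans YW; apply: subD1set.
have [F gF] := good_forest_exists a_sym YxW iY sY.
have Yx0 : Y :\ x != set0 by rewrite -card_gt0 -ltnS cYx; move: S0; rewrite -card_gt0; lia.
have [] := gf_tight gF; rewrite ?SE // => cF cnF.
pose R := W :\: (Y :|: S).
pose TR := [set e in T | [disjoint e & Y] && ~~ [disjoint e & R]].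
pose TRR := [set e in T | e \subset R].
pose TY := [set e in T | ~~ [disjoint e & Y]].
have RP v : v \in R = [&& v \in W, v \notin Y & v \notin S].
  by rewrite !inE negb_or andbC.
have eTR u v : erel T u v -> u \notin Y -> v \notin Y -> u \in R ->
    [set u; v] \in TR.
  move=> /andP[_ uvT] uY vY uR; rewrite inE uvT /=; apply/andP; split.
    by rewrite disjoints_subset; apply/subsetP => z; rewrite !inE => /orP[]/eqP->.
  by apply/negP => /pred0P /(_ u); rewrite /= set21 uR.
have TRRR : TRR \subset TR.
  apply/subsetP => e; rewrite !inE => /andP[eT' eR]; rewrite eT' /=; apply/andP; split.
    rewrite disjoints_subset; apply: subset_trans eR _.
    by apply/subsetP => z; rewrite RP inE => /and3P[].
  have /edgesP[u [v [_ _ _ E]]] := subsetP TW e eT'.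
  by apply/negP => /pred0P /(_ u); rewrite /= (subsetP eR) E ?set21.
pose K := F :|: TR.
have FA u v : erel F u v -> u \in (Y :\ x) :|: S.
  move=> /andP[_ /(gf_edge gF)[u' [v' [u'Y v'S E]]]]; rewrite SE in v'S.
  by case: (set2_eq E) => -[-> _]; rewrite inE ?u'Y ?v'S ?orbT.
have aFR : acyc (F :|: TRR).
  apply: acyc_disjointU FA _ (gf_acyc gF) _.
    move=> u v /andP[_]; rewrite inE => /andP[_ /subsetP /(_ u (set21 _ _))].
    by rewrite RP !inE => /and3P[_ /negbTE -> /negbTE ->]; rewrite andbF.
  by apply: acycS aT; apply/subsetP => e; rewrite inE => /andP[].
have K2 e : e \in K -> exists u v, e = [set u; v].
  rewrite inE => /orP[/(gf_edge gF)[u [v [_ _ ->]]]|]; first by exists u, v.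
  by rewrite inE => /andP[/(subsetP TW) /edges_pair].
(* Edges inside [R] are kept from the start, so every lost edge has exactly one end in [R], as
   [lost_card] requires. *)
have [T' FT' [T'K aT' cT']] := acyc_extend K2 aFR (setUS F TRRR).
have FsT' : F \subset T' by apply: subset_trans FT'; apply: subsetUl.
have KW : K \subset edges a (W :\ x).
  apply/subsetP => e; rewrite inE => /orP[eF|].
    have [u [v [uY vS E]]] := gf_edge gF eF; rewrite SE in vS.
    have := subsetP (gf_sub gF) e eF; rewrite E !mem_edges // !in_setD1 => /and3P[-> -> ->].
    case/setD1P: uY => -> _; rewrite !andbT; apply: contraTneq vS => ->.
    by apply/negP => /nS; rewrite xY.
  rewrite inE => /and3P[eT' eY _].
  have /edgesP[u [v [uW vW auv E]]] := subsetP TW e eT'.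
  have ne w : w \in e -> w != x.
    by move=> we; apply: contraTneq eY => wx; apply/negP => /pred0P /(_ w);
      rewrite /= we wx xY.
  by rewrite E mem_edges // !in_setD1 uW vW auv !ne // E ?set21 ?set22.
have T'W : T' \subset edges a (W :\ x) := subset_trans T'K KW.
have FK : F \subset K := subsetUl _ _.
have toA u : u \in (Y :\ x) :|: S -> connect (erel K) s0 u.
  by move=> uA; apply: (connectS FK); apply: cnF; rewrite // inE s0S orbT.
(* A walk of [T] leaves [Y] only into [S], which [F] connects to [s0]; an edge reaching [R] does not
   come from [Y] and so belongs to [TR]. *)
have reach u : u \in W -> u \in Y \/ connect (erel K) s0 u.
  move=> uW; have c := cT s0 u (subsetP SW s0 s0S) uW.
  apply: (connect_closed (P := fun u => u \in Y \/ connect (erel K) s0 u)) c _;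
    last by right; apply: connect0.
  move=> v w vw H; have [wY|wY] := boolP (w \in Y); [by left|right].
  have [vW wW avw] := eT v w vw.
  have [wS|wS] := boolP (w \in S); first by apply: toA; rewrite inE wS orbT.
  have wR : w \in R by rewrite RP wW wY.
  have vY : v \notin Y by apply: contra wS => vY; apply: YS avw wW.
  case: H => [vY'|]; first by rewrite vY' in vY.
  move/connect_trans; apply; apply: connect1; rewrite erel_sym /erel inE.
  rewrite (eTR w v) ?orbT ?andbT // 1?erel_sym //.
  by rewrite eq_sym; case/andP: vw.
have cT'W : conn T' (W :\ x).
  have to u : u \in W :\ x -> connect (erel T') s0 u.
    move=> /setD1P[ux uW]; apply: cT'; case: (reach u uW) => // uY.
    by apply: toA; rewrite inE in_setD1 ux uY.
  by move=> u v /to su /to; apply: connect_trans; rewrite connectC.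
exists T'; first by split.
have cW : #|W| = #|W :\ x|.+1 by rewrite (cardsD1 x W) xW.
pose RI := ints T :&: R; pose YI := ints T :&: Y; pose D := TR :\: T'.
have le_ints : #|ints T| <= #|S| + #|YI| + #|RI|.
  have sub : ints T \subset S :|: YI :|: RI.
    apply/subsetP => v vT; have vW := subsetP (ints_sub a_sym a_irr TW) v vT.
    rewrite 2!in_setU /YI /RI 2!in_setI RP vT vW.
    by case: (v \in Y); case: (v \in S).
  apply: leq_trans (subset_leq_card sub) _.
  apply: leq_trans (leq_card_setU _ _).1 _; rewrite leq_add2r.
  exact: (leq_card_setU _ _).1.
apply: leq_trans le_ints _.
apply: (arith _ #|W :\ x| #|Y :\ x| _ _ #|D| #|F| #|TR| #|TY| #|T| #|T'| #|ints T' :&: R|) => //.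
- have dis : TR :&: TY = set0.
    by apply/setP => e; rewrite !inE; case: (e \in T); case: [disjoint e & Y]; rewrite ?andbF.
  have <- : #|TR :|: TY| = #|TR| + #|TY| by rewrite cardsU dis cards0 subn0.
  by apply/subset_leq_card/subsetP => e; rewrite !inE => /orP[]/andP[].
- rewrite -cW; apply: leq_trans (acyc_card a_irr TW aT).
  by rewrite leq_add2l (ncls_gt0 T xW).
- apply: leq_trans (conn_card T'W) _.
  by rewrite leq_add2l; apply: conn_ncls.
- have -> : #|Y :\ x|.+1 = #|Y| by rewrite (cardsD1 x Y) xY.
  apply: star_card => [y yY|y z yY yz]; first exact: nbr (subsetP YW y yY).
  by apply/negP => zY; have [_ zW ayz] := eT y z yz; have := nS z (YS y z yY ayz zW);
    rewrite zY.
- have -> : #|T'| + #|D| = #|T' :|: TR|.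
    by rewrite -(cardsID T' (T' :|: TR)) (setIidPr (subsetUl _ _)) setDUl setDv set0U.
  apply: leq_trans (leq_card_setU _ _).1; apply/subset_leq_card.
  by rewrite subUset T'K subsetUr.
- have vY u v : u \in R -> erel T u v -> v \notin Y.
    rewrite RP => /and3P[uW _ uS] uv; have [_ _ auv] := eT u v uv.
    by apply: contra uS => vY; apply: YS vY _ uW; rewrite a_sym.
  have uY u : u \in R -> u \notin Y by rewrite RP => /and3P[].
  apply: lost_card => u v uv uR => [|vR].
    by apply: eTR; rewrite ?(vY u v) ?uY.
  apply: (subsetP FT'); rewrite inE; apply/orP; right.
  have /andP[_ uvT] := uv; rewrite inE uvT /=.
  by apply/subsetP => z; rewrite in_set2 => /orP[]/eqP->.
- have := gf_ints gF FsT' T'W cT'W _ _; rewrite SE => h.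
  apply: leq_trans (leq_add (h _ _) (leqnn _)) _.
  + by rewrite setSD.
  + by rewrite -ltnS -cW.
  have dis : (ints T' :&: ((Y :\ x) :|: S)) :&: (ints T' :&: R) = set0.
    apply/setP => v; rewrite 3!in_setI [v \in R]RP in_setU in_set0 in_setD1.
    by case: (v \in Y); case: (v \in S); rewrite ?andbF.
  rewrite -[X in X <= _]subn0 -[0](cards0 V) -dis -cardsU.
  by apply/subset_leq_card; rewrite subUset !subsetIl.
Qed.

End Deletion.

(** * The kernelization algorithm *)

Notation matrix := (seq (seq bool)).

Definition adjm (M : matrix) (x y : nat) : bool := nth false (nth [::] M x) y.

(** Vertices are accepted as long as the accepted ones contain no dense set. Listing [x] twice
    against doubled goods turns Hall's condition for sets containing [x] into the strict one, so the
    first rejected vertex lies in every dense set formed with the accepted ones. *)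
Definition culprit (M : matrix) (W : seq nat) : seq nat :=
  (foldl (fun acc x =>
     if nilp acc.2 then
       if nilp (auction (adjm M) (x :: x :: acc.1) (W ++ W)).1
       then (x :: acc.1, [::]) else (acc.1, [:: x])
     else acc) ([::], [::]) W).2.

(** [delete_vertex] asks for more than three vertices, so that more than two remain for [gf_ints];
    smaller cases are settled directly in [large_yes]. *)
Definition reduce (M : matrix) (W : seq nat) : seq nat :=
  if size W <= 3 then W else [seq x <- W | x \notin culprit M W].

Definition expand (M : matrix) (C : seq nat) : seq nat :=
  [seq x <- iota 0 (size M) | (x \in C) || has (fun y => adjm M y x) C].

(** The encoded instance does not name the new edge; its ends are recovered as the rows where the
    two matrices differ. *)
Definition endpoints (M M' : matrix) : seq nat :=
  [seq x <- iota 0 (size M') |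
    has (fun y => adjm M x y != adjm M' x y) (iota 0 (size M'))].

Definition core (M M' : matrix) : seq nat :=
  iter (size M') (reduce M') (iter (size M') (expand M') (endpoints M M')).

Definition yes_kernel : matrix * nat := ([:: [:: false]], 0).

Definition kernel (I : (matrix * nat) * ((seq bool * matrix) * (matrix * nat))) :
    matrix * nat :=
  if (I.1.2 == 0) || (1 < count id I.2.1.1) then yes_kernel
  else if size (core I.1.1 I.2.2.1) <= 2 * I.1.2 then
    ([seq [seq adjm I.2.2.1 x y | y <- core I.1.1 I.2.2.1]
         | x <- core I.1.1 I.2.2.1], I.1.2)
  else yes_kernel.

(** * Polynomial running time of the kernelization *)

Ltac polyf_auto := repeat match goal with
  | |- polyf _ => assumption
  | H : polyf ?h |- polyf (fun x => ?h (@?g x)) =>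
      refine (polyf_comp (g := h) (f := g) H _)
  | |- polyf fst => exact polyf_fst
  | |- polyf snd => exact polyf_snd
  | |- polyf (fun x => x) => exact polyf_id
  | |- polyf (fun _ => ?c) => exact (polyf_const c)
  | |- polyf (fun x => fst (@?f x)) => refine (polyf_proj1 (f := f) _)
  | |- polyf (fun x => snd (@?f x)) => refine (polyf_proj2 (f := f) _)
  | |- polyf (fun x => (@?f x, @?g x)) => refine (polyf_pair (f := f) (g := g) _ _)
  | |- polyf (fun x => @?f x :: @?g x) => refine (polyf_cons (f := f) (g := g) _ _)
  | |- polyf (fun x => @?f x ++ @?g x) => refine (polyf_cat (f := f) (g := g) _ _)
  | |- polyf (fun x => nilp (@?f x)) => refine (polyf_nilp (l := f) _)
  | |- polyf (fun x => @?f x && @?g x) => refine (polyf_andb (b := f) (c := g) _ _)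
  | |- polyf (fun x => @?f x || @?g x) => refine (polyf_orb (b := f) (c := g) _ _)
  | |- polyf (fun x => ~~ @?f x) => refine (polyf_negb (b := f) _)
  | |- polyf (fun x => leq (@?f x) (@?g x)) => refine (polyf_leq (f := f) (g := g) _ _)
  | |- polyf (fun x => (@?f x).+1) => refine (polyf_succ (f := f) _)
  | |- polyf (fun x => @?f x * @?g x) => refine (polyf_mul (f := f) (g := g) _ _)
  | |- polyf (fun x => size (@?f x)) => refine (polyf_size_seq (l := f) _)
  | |- polyf (fun x => nth ?d (@?l x) (@?f x)) => refine (polyf_nth d (f := f) (l := l) _ _)
  | |- polyf (fun x => iota 0 (@?f x)) => refine (polyf_iota (f := f) _)
  | |- polyf (fun x => @eq_op _ (@?f x) (@?g x)) =>
      refine (polyf_eqn (f := f) (g := g) _ _)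
  end.

Section Poly.
Context {X : Type} {eX : encoding X}.

Lemma polyf_mem (f : X -> nat) (l : X -> seq nat) :
  polyf f -> polyf l -> polyf (fun x => f x \in l x).
Proof.
move=> pf pl; apply: (polyf_ext (f := fun x => has (fun y => y == f x) (l x))).
  by move=> x; rewrite -has_pred1.
apply: (polyf_has (p := fun x y => y == f x)) => //.
apply: polyf_eqn; polyf_auto.
Qed.

Lemma polyf_adjm (m : X -> matrix) (i j : X -> nat) :
  polyf m -> polyf i -> polyf j -> polyf (fun x => adjm (m x) (i x) (j x)).
Proof. by move=> pm pi pj; rewrite /adjm; polyf_auto. Qed.

Lemma polyf_count (l : X -> seq bool) : polyf l -> polyf (fun x => count id (l x)).
Proof.
move=> pl; apply: (polyf_ext (f := fun x => size [seq b <- l x | b])).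
  by move=> x; rewrite size_filter.
apply: polyf_size_seq; apply: (polyf_filter (p := fun _ b => b)) => //; polyf_auto.
Qed.

Lemma polyf_extract A {eA : encoding A} (l : X -> seq A) (p : X -> pred A) :
  polyf l -> polyf (fun y : X * A => p y.1 y.2) ->
  polyf (fun x => extract (p x) (l x)).
Proof.
move=> pl pp; apply: (polyf_foldl (i := fun _ => ([::], [::]))
    (step := fun x e acc => if nilp acc.1 && p x e then ([:: e], acc.2)
                            else (acc.1, e :: acc.2)) (q := fun n => n + 3)) => //.
- by poly_bound.
- move=> x e [b1 b2] /=; case: ifP => [/andP[/nilP -> _]|_];
    rewrite !esize_pair /= ?esize_cons ?esize_nil; lia.
- exact: polyf_const.
- apply: polyf_if; polyf_auto.
  by apply: (polyf_comp2 pp); polyf_auto.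
Qed.

End Poly.

Lemma polyf_affordable : polyf
  (fun p : (((matrix * nat) * nat) * seq (nat * (nat * seq nat))) * (nat * (nat * seq nat)) =>
     affordable (adjm p.1.1.1.1) p.1.1.1.2 p.1.1.2 p.1.2 p.2).
Proof.
rewrite /affordable; apply: polyf_andb; first by apply: polyf_adjm; polyf_auto.
apply: polyf_andb; first by polyf_auto.
pose C := ((((matrix * nat) * nat) * seq (nat * (nat * seq nat))) * (nat * (nat * seq nat)))%type.
apply: (polyf_all (l := fun p : C => p.1.2) (p := fun (p : C) f =>
  ~~ adjm p.1.1.1.1 p.1.1.2 f.1 || (p.2.2.1 <= f.2.1))); first by polyf_auto.
apply: polyf_orb; last by polyf_auto.
by apply: polyf_negb; apply: polyf_adjm; polyf_auto.
Qed.

Notation astate := (seq nat * seq (nat * (nat * seq nat)))%type.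

Lemma polyf_bid : polyf
  (fun p : (matrix * nat) * astate => bid (adjm p.1.1) p.1.2 p.2).
Proof.
pose C := ((matrix * nat) * astate)%type.
pose ext (y : C * (nat * seq nat)) :=
  extract (affordable (adjm y.1.1.1) y.1.1.2 y.2.1 y.1.2.2) y.1.2.2.
apply: (polyf_match (l := fun p : C => p.2.1) (g := fun p : C => p.2)
  (f := fun y => if (ext y).1 is e :: _ then
    (e.2.2 ++ y.2.2, (e.1, (e.2.1.+1, [:: y.2.1])) :: (ext y).2) else y.1.2));
  try by polyf_auto.
have pe : polyf ext.
  apply: (polyf_extract (p := fun y : C * (nat * seq nat) =>
    affordable (adjm y.1.1.1) y.1.1.2 y.2.1 y.1.2.2)); first by polyf_auto.
  apply: (polyf_comp (f := fun z : (C * (nat * seq nat)) * (nat * (nat * seq nat)) =>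
     ((((z.1.1.1.1, z.1.1.1.2), z.1.2.1), z.1.1.2.2), z.2)) polyf_affordable).
  by polyf_auto.
apply: (polyf_match (l := fun y => (ext y).1) (g := fun y => y.1.2)
  (f := fun z => (z.2.1.2.2 ++ z.1.2.2,
     (z.2.1.1, (z.2.1.2.1.+1, [:: z.1.2.1])) :: (ext z.1).2))); polyf_auto.
Qed.

Lemma perm_esize (A : eqType) {eA : encoding A} (s1 s2 : seq A) :
  perm_eq s1 s2 -> esize s1 = esize s2.
Proof.
have H (s : seq A) : esize s = (sumn [seq (esize x).+1 | x <- s]).+1.
  by elim: s => //= x s IH; rewrite esize_cons IH; lia.
by move=> p12; rewrite !H (perm_sumn (perm_map _ p12)).
Qed.

(** Bidders only move between the queue and the goods; the 2 is the size of one more unary digit in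
    the raised price. *)
Lemma esize_bid a cap (st : astate) : esize (bid a cap st) <= esize st + 2.
Proof.
case: st => [[|x q] es]; first by rewrite leq_addr.
rewrite /bid /=; case: extractP => [r _ _|e r _ pr] /=; first by rewrite leq_addr.
have cE : (esize (e.2.2 ++ q)).+1 = esize e.2.2 + esize q by apply: esize_cat.
have eE : esize (e :: r) = esize es by apply: perm_esize.
move: cE eE; rewrite !esize_pair /= !esize_cons !esize_pair /= esize_cons esize_nil.
rewrite !esize_nat; lia.
Qed.

Lemma polyf_auction X {eX : encoding X} (m : X -> matrix) (jobs slots : X -> seq nat) :
  polyf m -> polyf jobs -> polyf slots ->
  polyf (fun x => auction (adjm (m x)) (jobs x) (slots x)).
Proof.
move=> pm pj ps.
apply: (polyf_iter (step := fun x => bid (adjm (m x)) (size (slots x)).+1)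
    (i := fun x => (jobs x, [seq (v, (0, [::])) | v <- slots x]))
    (n := fun x => (size (slots x) * (size (slots x)).+1).+1) (q := fun=> 2)).
- exact: poly_bounded_const.
- by move=> x st; apply: esize_bid.
- by polyf_auto.
- apply: polyf_pair => //; apply: (polyf_map (f := fun _ v => (v, (0, [::])))) => //.
  by polyf_auto.
- apply: (polyf_comp (f := fun p => ((m p.1, (size (slots p.1)).+1), p.2)) polyf_bid).
  by polyf_auto.
Qed.

Section ReduceExpand.
Context {X : Type} {eX : encoding X} (m m' : X -> matrix) (w : X -> seq nat).
Hypothesis (pm : polyf m) (pm' : polyf m') (pw : polyf w).

Lemma polyf_culprit : polyf (fun x => culprit (m x) (w x)).
Proof.
apply: polyf_proj2.
apply: (polyf_foldl (l := w) (i := fun _ => ([::], [::])) (q := fun n => n + 3)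
  (step := fun x y acc => if nilp acc.2 then
       if nilp (auction (adjm (m x)) (y :: y :: acc.1) (w x ++ w x)).1
       then (y :: acc.1, [::]) else (acc.1, [:: y])
     else acc)).
- by poly_bound.
- move=> x y [b1 b2] /=; case: ifP => [/nilP ->|_]; last by lia.
  by case: ifP => _; rewrite !esize_pair /= !esize_cons ?esize_nil; lia.
- by [].
- by polyf_auto.
- apply: polyf_if; polyf_auto; apply: polyf_if; polyf_auto.
  by apply: polyf_auction; polyf_auto.
Qed.

Lemma polyf_reduce : polyf (fun x => reduce (m x) (w x)).
Proof.
apply: polyf_if; polyf_auto.
apply: (polyf_filter (p := fun x y => y \notin culprit (m x) (w x))) => //.
apply: polyf_negb; apply: polyf_mem; polyf_auto.
exact: (polyf_comp polyf_culprit polyf_fst).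
Qed.

Lemma polyf_expand : polyf (fun x => expand (m x) (w x)).
Proof.
apply: (polyf_filter (p := fun x y => (y \in w x) || has (fun z => adjm (m x) z y) (w x)));
  first by polyf_auto.
apply: polyf_orb; first by apply: polyf_mem; polyf_auto.
apply: (polyf_has (p := fun (y : X * nat) z => adjm (m y.1) z y.2)); first by polyf_auto.
by apply: polyf_adjm; polyf_auto.
Qed.

Lemma polyf_endpoints : polyf (fun x => endpoints (m x) (m' x)).
Proof.
apply: (polyf_filter (p := fun x y =>
  has (fun z => adjm (m x) y z != adjm (m' x) y z) (iota 0 (size (m' x)))));
  first by polyf_auto.
apply: (polyf_has (p := fun (y : X * nat) z => adjm (m y.1) y.2 z != adjm (m' y.1) y.2 z)).
  by polyf_auto.
by apply: polyf_negb; apply: polyf_eqb; apply: polyf_adjm; polyf_auto.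
Qed.

End ReduceExpand.

Lemma polyf_core X {eX : encoding X} (m m' : X -> matrix) :
  polyf m -> polyf m' -> polyf (fun x => core (m x) (m' x)).
Proof.
move=> pm pm'; have [b [pb Hb]] := polyf_size (polyf_iota (polyf_size_seq pm')).
apply: (polyf_iter (n := fun x => size (m' x)) (step := fun x => reduce (m' x))
  (i := fun x => iter (size (m' x)) (expand (m' x)) (endpoints (m x) (m' x)))
  (q := fun=> 0)).
- exact: poly_bounded_const.
- by move=> x W; rewrite addn0 /reduce; case: ifP => // _; apply: esize_filter.
- by polyf_auto.
- apply: (polyf_iter (n := fun x => size (m' x)) (step := fun x => expand (m' x))
    (q := b)) => //.
  (* [expand] filters a fixed range, so its result has a size bound independent of [C]. *)
  + by move=> x C; apply: leq_trans (leq_addl _ _); apply: leq_trans (esize_filter _ _) (Hb x).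
  + by polyf_auto.
  + exact: polyf_endpoints.
  + by apply: polyf_expand; polyf_auto.
- by apply: polyf_reduce; polyf_auto.
Qed.

Lemma polyf_kernel : polyf kernel.
Proof.
pose I := ((matrix * nat) * ((seq bool * matrix) * (matrix * nat)))%type.
have pk : polyf (fun i : I => i.1.2) by polyf_auto.
have pm : polyf (fun i : I => i.2.2.1) by polyf_auto.
have pw : polyf (fun i : I => core i.1.1 i.2.2.1) by apply: polyf_core; polyf_auto.
apply: polyf_if; last apply: polyf_if; try exact: polyf_const.
- by apply: polyf_orb; polyf_auto; apply: polyf_count; polyf_auto.
- by polyf_auto.
- apply: polyf_pair => //.
  apply: (polyf_map (f := fun i x => [seq adjm i.2.2.1 x y | y <- core i.1.1 i.2.2.1])) => //.
  apply: (polyf_map (f := fun (i : I * nat) y => adjm i.1.2.2.1 i.2 y)).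
    by apply: (polyf_comp pw); polyf_auto.
  by apply: polyf_adjm; polyf_auto.
Qed.

(** * Correctness *)

Section Reduction.
Variables (n : nat) (a : rel 'I_n) (M : matrix).
Hypothesis (a_sym : symmetric a) (a_irr : irreflexive a).
Hypothesis aM : forall i j : 'I_n, adjm M i j = a i j.
Implicit Types (s W : seq nat) (X Y Z : {set 'I_n}).

Definition vset s : {set 'I_n} := [set i : 'I_n | val i \in s].

Lemma mem_vset s (i : 'I_n) : (i \in vset s) = (val i \in s).
Proof. by rewrite inE. Qed.

Lemma count_vset (P : pred nat) s : uniq s ->
  {subset s <= gtn n} -> count P s = #|[set i in vset s | P i]|.
Proof.
move=> us sn; rewrite -size_filter cardE -(size_map val); apply: perm_size.
apply: uniq_perm; rewrite ?filter_uniq ?map_inj_uniq ?enum_uniq //; first exact: val_inj.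
move=> i; rewrite mem_filter; apply/andP/mapP => [[Pi si]|[j]].
  by exists (Ordinal (sn i si)); rewrite // mem_enum !inE Pi /= si.
by rewrite mem_enum !inE => /andP[? ?] ->.
Qed.

Lemma card_vset s : uniq s -> {subset s <= gtn n} -> #|vset s| = size s.
Proof.
move=> us sn; rewrite -count_predT count_vset //.
by apply: eq_card => i; rewrite !inE andbT.
Qed.

Variable W : seq nat.
Hypothesis (uW : uniq W) (Wn : {subset W <= gtn n}).

Local Notation nbW := (nbhd (nb a (vset W))).

(** Among the jobs, [Y] accounts for [#|Y|.+1] entries because [x] is listed twice, and all of them
    are matched into the two copies of the neighborhood of [Y]. *)
Lemma test_success (x : 'I_n) s : uniq (val x :: s) -> {subset s <= W} -> val x \in W ->
  nilp (auction (adjm M) (val x :: val x :: s) (W ++ W)).1 ->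
  forall Y, Y \subset vset (val x :: s) -> x \in Y -> #|Y| < 2 * #|nbW Y|.
Proof.
move=> us sW xW /auction_success[m [p1 p2 p3 pa]] Y Ys xY.
pose P z := z \in [seq val y | y <- enum Y].
pose Q z := z \in [seq val y | y <- enum (nbW Y)].
have PE (y : 'I_n) : P y = (y \in Y) by rewrite /P mem_map ?mem_enum //; apply: val_inj.
have QE (y : 'I_n) : Q y = (y \in nbW Y) by rewrite /Q mem_map ?mem_enum //; apply: val_inj.
have xsn : {subset val x :: s <= gtn n}.
  by move=> z; rewrite inE => /orP[/eqP->|/sW /Wn //]; apply: ltn_ord.
have cP : count P (val x :: val x :: s) = #|Y|.+1.
  have -> : count P (val x :: val x :: s) = P x + count P (val x :: s) by [].
  rewrite PE xY count_vset // add1n; congr _.+1; apply: eq_card => y.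
  by rewrite inE PE; apply: andb_idl; apply/(subsetP Ys).
have cQ : count Q (W ++ W) = 2 * #|nbW Y|.
  rewrite count_cat addnn -mul2n count_vset //; congr (2 * _); apply: eq_card => y.
  rewrite inE QE; apply: andb_idl => /nbhdP[z _]; rewrite inE.
  by case/andP.
rewrite -ltnS -cP -cQ ltnS -(permP p1) -(permP p3).
apply: leq_trans (leq_count_subseq Q p2); rewrite !count_map.
apply: (@leq_trans (count (fun p => (p \in m) && P p.1) m)).
  by rewrite leq_eqVlt (@eq_in_count _ _ (fun p => (p \in m) && P p.1)) ?eqxx // => p /= ->.
apply: sub_count => p /= /andP[pm Pp].
have p2W : p.2 \in W.
  have : p.2 \in [seq q.2 | q <- m] by apply: map_f.
  by move/(mem_subseq p2); rewrite (perm_mem p3) mem_cat orbb.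
have /mapP[y] := Pp; rewrite mem_enum => yY E.
apply/mapP; exists (Ordinal (Wn p2W)) => //; rewrite mem_enum.
by apply/nbsP; exists y => //; rewrite inE p2W andbT -aM /= -E pa.
Qed.

(** Only [x] can be repeated in a violator, so passing to the underlying set loses at most one
    element, which the strict inequality pays for. *)
Lemma test_failure (x : 'I_n) s : uniq (val x :: s) -> {subset s <= W} -> val x \in W ->
  ~~ nilp (auction (adjm M) (val x :: val x :: s) (W ++ W)).1 ->
  exists Z, [/\ Z \subset vset (val x :: s), Z != set0 & 2 * #|nbW Z| <= #|Z|].
Proof.
move=> us sW xW /auction_failure[X [X' [pX cX]]].
have xsn : {subset val x :: s <= gtn n}.
  by move=> z; rewrite inE => /orP[/eqP->|/sW /Wn //]; apply: ltn_ord.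
have Xs : {subset X <= val x :: s}.
  move=> z zX; have : z \in val x :: val x :: s by rewrite -(perm_mem pX) mem_cat zX.
  by rewrite !inE orbA orbb.
have cardX : size X <= #|vset X|.+1.
  have -> : #|vset X| = count (mem X) (val x :: s).
    rewrite count_vset //; apply: eq_card => i; rewrite !inE.
    apply/idP/andP => [iX|[_ //]]; split=> //; have := Xs _ iX.
    by rewrite inE.
  have -> : size X = count (mem X) X by apply/esym/eqP; rewrite -all_count; apply/allP.
  apply: (@leq_trans (count (mem X) (val x :: val x :: s))).
    by rewrite -(permP pX) count_cat leq_addr.
  by rewrite /= -add1n leq_add2r leq_b1.
have le : #|nbW (vset X)| <= count (fun v => has ((adjm M)^~ v) X) W.
  rewrite count_vset //; apply/subset_leq_card/subsetP => v /nbsP[y].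
  rewrite inE => yX /andP[ayv vW]; rewrite inE vW /=.
  by apply/hasP; exists (val y); rewrite // aM.
exists (vset X); split.
- by apply/subsetP => i; rewrite !mem_vset; apply: Xs.
- case: X {pX cX cardX le} Xs => [|z X] Xs in cX *; first by [].
  have zn : z < n by apply: xsn; apply: Xs; rewrite mem_head.
  by apply/set0Pn; exists (Ordinal zn); rewrite !inE eqxx.
- rewrite -ltnS; apply: leq_trans cardX; apply: leq_ltn_trans cX.
  by rewrite count_cat addnn -mul2n leq_mul2l.
Qed.

Lemma culpritP : (culprit M W = [::] /\ sparse a (vset W) (vset W)) \/
  exists (x : 'I_n) Y, [/\ culprit M W = [:: val x], Y \subset vset W, x \in Y,
    2 * #|nbW Y| <= #|Y| &
    forall X : {set 'I_n}, X \proper Y -> X != set0 -> #|X| < 2 * #|nbW X|].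
Proof.
rewrite /culprit; set step := (fun acc x => _).
pose good s := forall Y, Y \subset vset s -> Y != set0 -> #|Y| < 2 * #|nbW Y|.
suff: forall W1 W2, W1 ++ W2 = W ->
    (foldl step ([::], [::]) W1 = (rev W1, [::]) /\ good W1) \/
    exists (x : 'I_n) s Z, [/\ (foldl step ([::], [::]) W1).2 = [:: val x],
      {subset val x :: s <= W}, good s & [/\ Z \subset vset (val x :: s), Z != set0 &
        2 * #|nbW Z| <= #|Z|]].
  move/(_ W [::] (cats0 W)) => [[-> gW]|[x [s [Z [-> sW gs [Zs Z0 Zd]]]]]]; first by left.
  (* A minimal dense set inside [Z] must contain [x], because the vertices accepted before [x]
     contain no dense set. *)
  right; pose P (Y : {set 'I_n}) := (Y != set0) && (2 * #|nbW Y| <= #|Y|).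
  have PZ : P Z by rewrite /P Z0.
  have [Y /minsetP[/andP[Y0 Yd] Ymin] YZ] := minset_exists PZ.
  exists x, Y; split=> //.
  - apply: subset_trans YZ (subset_trans Zs _); apply/subsetP => i; rewrite !mem_vset; exact: sW.
  - apply: contraT => xY; have /(gs Y)/(_ Y0) : Y \subset vset s.
      apply/subsetP => i iY; have := subsetP Zs i (subsetP YZ i iY); rewrite !inE.
      by case: eqP => // /val_inj ix; rewrite -ix iY in xY.
    by rewrite ltnNge Yd.
  - move=> X XY X0; rewrite ltnNge; apply/negP => Xd.
    have := Ymin X; rewrite /P X0 Xd (proper_sub XY) => /(_ isT isT) E.
    by rewrite E properxx in XY.
elim/last_ind => [|W1 y IH] W2 E.
  by left; split=> // Y Y0 /negP[]; rewrite -subset0; apply/subsetP => i /(subsetP Y0); rewrite inE.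
rewrite foldl_rcons; rewrite cat_rcons in E.
case: (IH _ E) => [[-> gW1]|[x [s [Z [e1 e2 e3 e4]]]]]; last first.
  by right; exists x, s, Z; rewrite /step e1 /=.
rewrite /step /=.
have yW : y \in W by rewrite -E mem_cat mem_head orbT.
have W1W : {subset rev W1 <= W} by move=> z; rewrite mem_rev -E mem_cat => ->.
have uy : uniq (y :: rev W1).
  move: uW; rewrite -E cat_uniq /= rev_uniq mem_rev => /and3P[-> + _].
  by rewrite negb_or => /andP[->].
pose yo := Ordinal (Wn yW); have yE : y = val yo by [].
have gW1' : good (rev W1).
  move=> Y Ys; apply: gW1; apply: subset_trans Ys _.
  by apply/subsetP => i; rewrite !inE mem_rev.
case: ifP => [ok|/negbT nok].
  left; rewrite rev_rcons; split=> // Y Ys Y0.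
  have [yY|yY] := boolP (yo \in Y).
    apply: (@test_success yo _ uy W1W yW ok Y _ yY); apply: subset_trans Ys _.
    by apply/subsetP => i; rewrite !inE mem_rcons mem_rev inE.
  apply: gW1 => //; apply/subsetP => i iY; have := subsetP Ys i iY.
  rewrite !inE mem_rcons inE; case: eqP => // iy.
  by rewrite -(_ : i = yo) ?iY // in yY; apply: val_inj.
right; have [Z Zp] := @test_failure yo _ uy W1W yW nok.
exists yo, (rev W1), Z; split=> // z; rewrite inE => /orP[/eqP->|/W1W] //.
Qed.

End Reduction.

(** Forests instead of trees make the notion monotone in [W], so one direction of the deletion step
    is immediate. On a connected vertex set nothing changes, as a forest extends to a spanning tree
    without losing internal vertices. *)
Definition has_internals (V : finType) (a : rel V) (W : {set V}) (k : nat) : Prop :=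
  exists F : {set {set V}}, [/\ F \subset edges a W, acyc F & k <= #|ints F|].

(** Without internal vertices, a vertex and its neighbors form a whole component, which has at most
    two elements. *)
Lemma one_internal (V : finType) (a : rel V) (W : {set V}) T :
  symmetric a -> irreflexive a ->
  spanning_tree a W T -> 2 < #|W| -> 0 < #|ints T|.
Proof.
move=> a_sym a_irr [TW _ cT] W2; rewrite lt0n cards_eq0; apply/negP => /eqP T0.
have none x : x \notin ints T by rewrite T0 inE.
have /card_gt0P[u uW] : 0 < #|W| by apply: leq_trans W2.
have sub : W \subset [set z | (z == u) || erel T u z].
  apply/subsetP => z zW; rewrite inE.
  apply: (connect_closed (P := fun z => (z == u) || erel T u z)) (cT u z uW zW) _;
    last by rewrite eqxx.
  move=> x y xy /orP[/eqP xu|ux]; first by rewrite -xu xy orbT.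
  apply/orP; left; apply/eqP; apply: (notin_intsP (none x)) xy _.
  by rewrite erel_sym.
have := leq_trans W2 (subset_leq_card sub).
rewrite (_ : [set z | _] = u |: [set z | erel T u z]); last first.
  by apply/setP => z; rewrite !inE.
move=> h; have := leq_trans h (leq_card_setU _ _).1; rewrite cards1 add1n ltnS.
by have := none u; rewrite inE /deg => /negP.
Qed.

Section Reduction.
Variables (n : nat) (a : rel 'I_n) (M : matrix).
Hypothesis (a_sym : symmetric a) (a_irr : irreflexive a).
Hypothesis aM : forall i j : 'I_n, adjm M i j = a i j.
Implicit Types (s W : seq nat).

Local Notation vset := (@vset n).

Definition connected_part W :=
  [/\ uniq W, {subset W <= gtn n} & conn (edges a (vset W)) (vset W)].

Lemma spanning_tree_exists W (F : {set {set 'I_n}}) : connected_part W -> F \subset edges a (vset W) ->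
  acyc F -> exists2 T, spanning_tree a (vset W) T & #|ints F| <= #|ints T|.
Proof.
move=> [_ _ cW] FW aF; have [T FT sT] := spanning_extend cW FW aF.
by exists T => //; apply/subset_leq_card/intsS.
Qed.

Lemma reduceP W (W' := reduce M W) : connected_part W ->
  [/\ connected_part W', forall k, has_internals a (vset W) k <-> has_internals a (vset W') k &
    size W' < size W \/ (W' = W /\ (3 < size W -> sparse a (vset W) (vset W)))].
Proof.
move=> cpW; have [uW Wn cW] := cpW; rewrite /W' /reduce.
case: (leqP (size W) 3) => [_|W3]; first by split=> //; right.
have cardW := card_vset uW Wn.
case: (culpritP aM uW Wn) => [[-> sW]|[x [Y [-> YW xY Yd Ymin]]]].
  rewrite (eq_filter (a2 := predT)) // filter_predT.
  by split=> //; right.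
have del T := delete_vertex a_sym a_irr YW xY Yd Ymin (T := T).
have xW : x \in vset W := subsetP YW x xY.
have uW' := filter_uniq (fun z => z \notin [:: val x]) uW.
have W'n : {subset [seq z <- W | z \notin [:: val x]] <= gtn n}.
  by move=> z; rewrite mem_filter => /andP[_ /Wn].
have E : vset [seq z <- W | z \notin [:: val x]] = vset W :\ x.
  by apply/setP => i; rewrite in_setD1 !mem_vset mem_filter inE.
rewrite cardW in del.
split.
- split=> //; rewrite E.
  have [T sT _] := spanning_tree_exists cpW (sub0set _) (acyc0 _).
  have [T' [T'W _ cT'] _] := del T sT W3.
  by move=> y z yW zW; apply: (connectS T'W); apply: cT'.
- move=> k; rewrite E; split=> -[F [FW aF kF]].
    have [T sT lT] := spanning_tree_exists cpW FW aF.
    have [T' [T'W aT' _] lT'] := del T sT W3.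
    by exists T'; split=> //; apply: leq_trans kF (leq_trans lT lT').
  by exists F; split=> //; apply: subset_trans FW (edgesS _ (subD1set _ _)).
- left; rewrite -cardW -(card_vset uW' W'n) E (cardsD1 x (vset W)) xW; exact: leqnn.
Qed.

Lemma iter_reduceP W i (W' := iter i (reduce M) W) : connected_part W -> size W <= i ->
  [/\ connected_part W', forall k, has_internals a (vset W) k <-> has_internals a (vset W') k &
    3 < size W' -> sparse a (vset W') (vset W')].
Proof.
move=> cpW Wi.
have H j : [/\ connected_part (iter j (reduce M) W),
    forall k, has_internals a (vset W) k <-> has_internals a (vset (iter j (reduce M) W)) k &
    size (iter j (reduce M) W) + j <= size W \/
    (iter j.+1 (reduce M) W = iter j (reduce M) W /\
     (3 < size (iter j (reduce M) W) ->
      sparse a (vset (iter j (reduce M) W)) (vset (iter j (reduce M) W))))].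
  elim: j => [|j [IH1 IH2 IH3]]; first by split=> //; left; rewrite addn0.
  have [r1 r2 r3] := reduceP IH1; split=> //.
    by move=> k; rewrite IH2 r2.
  case: IH3 => [lt|[E sp]]; last by right; rewrite !iterS in E *; rewrite !E.
  case: r3 => [lt'|[E sp]]; first by left; rewrite iterS; lia.
  by right; rewrite !iterS !E.
have [h1 h2 h3] := H i; split=> // lt; case: h3 => [le|[_ sp]]; last exact: sp.
(* If each of the [i] rounds deleted a vertex, nothing is left, against [3 < size W']. *)
have := leq_trans le Wi; rewrite -[X in _ <= X]add0n leq_add2r leqn0 => /eqP W0.
by move: lt; rewrite /W' W0.
Qed.

Lemma large_yes W k : connected_part W -> (3 < size W -> sparse a (vset W) (vset W)) ->
  0 < k -> 2 * k < size W -> has_internals a (vset W) k.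
Proof.
move=> cpW sp k0 kW; have [uW Wn cW] := cpW; have cardW := card_vset uW Wn.
(* At most three vertices and [2 * k < size W] leave only [k = 1], for which one internal vertex
   suffices. *)
have [W3|W3] := leqP (size W) 3.
  have [T sT _] := spanning_tree_exists cpW (sub0set _) (acyc0 _).
  have := one_internal a_sym a_irr sT; rewrite cardW => /(_ _) T1.
  have [TW aT _] := sT; exists T; split=> //; apply: leq_trans (T1 _); lia.
have W2 : 2 < #|vset W| by rewrite cardW ltnW.
have [T [TW aT _]] := half_internal a_sym a_irr cW W2 (sp W3).
by rewrite cardW => le; exists T; split=> //; lia.
Qed.

Section Component.
Hypothesis sM : size M = n.
Variables (u : 'I_n) (U : seq nat).
Hypothesis (Uc : U = [seq x <- iota 0 n | x \in U]) (uU : val u \in U).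
Hypothesis (Uu : forall z : 'I_n, val z \in U -> connect a u z).

(** A stage either grows or repeats forever, so [n] rounds reach the closure. All stages, the seed
    included by [Uc], are sublists of [iota 0 n] in canonical form, so that equal sizes of nested
    stages mean equal lists. *)
Lemma componentP (C := iter n (expand M) U) :
  [/\ connected_part C, size C <= n & vset C = [set z | connect a u z]].
Proof.
pose Ci i := iter i (expand M) U.
have CS i z : (z \in Ci i.+1) =
    ((z \in Ci i) || has (fun y => adjm M y z) (Ci i)) && (z < n).
  by rewrite {1}/Ci iterS {1}/expand sM mem_filter mem_iota.
have can i : Ci i = [seq x <- iota 0 n | x \in Ci i].
  case: i => [//|i]; rewrite {1}/Ci iterS {1}/expand sM; apply: eq_in_filter => x xn.
  by rewrite CS; move: xn; rewrite mem_iota => /= ->; rewrite andbT.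
have Cn i : {subset Ci i <= gtn n}.
  by move=> z; rewrite can mem_filter mem_iota => /andP[_].
have sC i : size (Ci i) <= n by rewrite can size_filter (leq_trans (count_size _ _)) ?size_iota.
have mono i : {subset Ci i <= Ci i.+1}.
  by move=> z zC; rewrite CS zC; apply: Cn zC.
have uC i : val u \in Ci i by elim: i => // i /mono.
have reach i : forall z : 'I_n, val z \in Ci i -> connect a u z.
  elim: i => [|i IH] z; first exact: Uu.
  rewrite CS => /andP[/orP[/IH //|/hasP[y yC yz]] _].
  have ayz : a (Ordinal (Cn i y yC)) z by rewrite -aM.
  by apply: connect_trans (connect1 ayz); apply: IH.
have grow i : i < size (Ci i) \/ Ci i.+1 = Ci i.
  elim: i => [|i [lt|E]].
  - by left; rewrite -has_predT; apply/hasP; exists (val u).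
  - have sub : subseq (Ci i) (Ci i.+1).
      rewrite [X in subseq X _]can [X in subseq _ X]can.
      have -> : [seq x <- iota 0 n | x \in Ci i] =
          [seq x <- [seq x <- iota 0 n | x \in Ci i.+1] | x \in Ci i].
        rewrite -filter_predI; apply: eq_filter => x /=.
        by apply/esym/andb_idr/mono.
      exact: filter_subseq.
    have [E|ne] := eqVneq (size (Ci i)) (size (Ci i.+1)); last first.
      by left; apply: leq_ltn_trans lt _; rewrite ltn_neqAle ne size_subseq.
    right; have /eqP E' : Ci i == Ci i.+1.
      by rewrite -(size_subseq_leqif sub) E.
    by rewrite -[LHS]/(expand M (Ci i.+1)) -E' [RHS]E'.
  - by right; rewrite -[LHS]/(expand M (Ci i.+1)) E -[RHS]E.
have fix_n : Ci n.+1 = Ci n.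
  by case: (grow n) => // lt; have := leq_trans lt (sC n); rewrite ltnn.
have closed z w : a z w -> val z \in Ci n -> val w \in Ci n.
  move=> zw zC; rewrite -fix_n CS ltn_ord andbT; apply/orP; right; apply/hasP; exists (val z) => //.
  by rewrite aM.
have E : vset C = [set z | connect a u z].
  apply/setP => z; rewrite mem_vset inE; apply/idP/idP; first exact: reach.
  move=> c; apply: (connect_closed (P := fun z : 'I_n => val z \in Ci n) closed c).
  exact: uC.
split=> //; last exact: sC.
split; [|exact: Cn|].
  by rewrite /C -/(Ci n) can filter_uniq ?iota_uniq.
have to z : z \in vset C -> connect (erel (edges a (vset C))) u z.
  rewrite {1}E inE => c.
  have [] // : z \in vset C /\ connect (erel (edges a (vset C))) u z.
  apply: (connect_closed (P := fun z => z \in vset C /\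
    connect (erel (edges a (vset C))) u z)) c _; last first.
    by split; [rewrite mem_vset; apply: uC|apply: connect0].
  move=> y w yw [yC cy]; have wC : w \in vset C.
    by move: yC; rewrite !mem_vset; apply: closed.
  split=> //; apply: connect_trans cy (connect1 _).
  by rewrite erel_edges // yC wC yw.
by move=> x1 x2 /to c1 /to c2; apply: connect_trans c2; rewrite connectC.
Qed.

End Component.

End Reduction.

(** The maps need to be mutually inverse on [W] and [W'] only, so the lemma applies in both
    directions between the core inside [G'] and its renumbered copy. The forest is pulled back along
    [f]. *)
Lemma internals_transport (V V' : finType) (a : rel V) (a' : rel V') (W : {set V})
    (W' : {set V'}) (f : V' -> V) (g : V -> V') k :
  symmetric a -> irreflexive a -> symmetric a' -> irreflexive a' ->
  {in W, forall x, f (g x) = x /\ g x \in W'} ->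
  {in W', forall y, g (f y) = y /\ f y \in W} ->
  {in W' &, forall x y, a' x y = a (f x) (f y)} ->
  has_internals a W k -> has_internals a' W' k.
Proof.
move=> s i s' i' gW fW' aa' [F [FW aF kF]].
pose r x y := erel F (f x) (f y); pose F' := edges r W'.
have rs : symmetric r by move=> x y; rewrite /r erel_sym.
have ri : irreflexive r by move=> x; rewrite /r /erel eqxx.
have F'E x y : erel F' x y = [&& x \in W', y \in W' & erel F (f x) (f y)].
  by rewrite erel_edges.
exists F'; split.
- apply/subsetP => e /edgesP[x [y [xW yW /(erel_sub_edges s i FW)[_ _ axy] ->]]].
  by rewrite mem_edges // xW yW aa'.
- apply/acyc_ucycle => c; case: (leqP (size c) 2) => // c2 /andP[cc uc].
  have cW x : x \in c -> x \in W'.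
    by move=> xc; have := next_cycle cc xc; rewrite F'E => /andP[].
  have finj : {in c &, injective f}.
    move=> x y xc yc E; have [gx _] := fW' x (cW x xc).
    by have [gy _] := fW' y (cW y yc); rewrite -gx E gy.
  rewrite -(size_map f) ltnNge in c2; case/negP: c2.
  apply: (proj1 (acyc_ucycle F) aF); rewrite /ucycle map_inj_in_uniq // uc andbT.
  by apply: homo_cycle cc => x y; rewrite F'E => /and3P[].
- apply: leq_trans kF _.
  have sub := subsetP (ints_sub s i FW).
  have ginj : {in ints F &, injective g}.
    move=> x y xF yF E; have [fx _] := gW x (sub x xF).
    by have [fy _] := gW y (sub y yF); rewrite -fx E fy.
  rewrite -(card_in_imset ginj); apply/subset_leq_card/subsetP => _ /imsetP[x xF ->].
  have [y [z [yz xy xz]]] := intsP _ _ xF; apply/intsP; exists (g y), (g z).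
  have [xW yW _] := erel_sub_edges s i FW xy; have [_ zW _] := erel_sub_edges s i FW xz.
  have [fx gx] := gW x xW; have [fy gy] := gW y yW; have [fz gz] := gW z zW.
  rewrite !F'E gx gy gz fx fy fz; split=> //.
  by apply: contraNneq yz => E; rewrite -fy E fz.
Qed.

(** * Passage between edge sets and subtrees *)

Section Subtrees.
Variable G : graph.
Implicit Types (W : {set 'I_(nvert G)}).

Lemma sadj_irr (T : subgraph G) : irreflexive (@sadj G T).
Proof. by move=> x; apply/negP => /sadj_adj; rewrite adj_irr. Qed.

Lemma internals_of_subtree (T : subgraph G) W k : is_tree T -> sverts T \subset W ->
  k <= #|internal T| -> has_internals (@adj G) W k.
Proof.
move=> [_ ac] TW kT; pose F := edges (@sadj G T) (sverts T).
have FE : erel F =2 @sadj G T.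
  move=> x y; rewrite erel_edges; [|exact: sadj_sym|exact: sadj_irr].
  by apply/and3P/idP => [[]|xy] //; have /andP[] := sadj_verts xy.
exists F; split.
- apply/subsetP => e /edgesP[x [y [xW yW xy ->]]].
  rewrite mem_edges; last exact: adj_sym.
  by rewrite (subsetP TW x xW) (subsetP TW y yW) (sadj_adj xy).
- apply/acyc_ucycle => c /andP[cc uc]; apply: ac.
  by rewrite /ucycle uc andbT -(eq_cycle FE).
- apply: leq_trans kT _; apply/subset_leq_card/subsetP => x.
  rewrite !inE => /andP[_ /leq_trans]; apply; apply/subset_leq_card/subsetP => y.
  by rewrite !inE FE.
Qed.

Lemma subtree_of_internals W k x : x \in W -> conn (edges (@adj G) W) W ->
  has_internals (@adj G) W k -> ivst_yes (G, k).
Proof.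
move=> xW cW [F [FW aF kF]].
have [T FT [TW aT cT]] := spanning_extend cW FW aF.
have adjT y z : erel T y z -> [/\ y \in W, z \in W & adj y z].
  by apply: erel_sub_edges => //; [exact: adj_sym|exact: adj_irr].
have Tadj y z : erel T y z -> adj y z by case/adjT.
have TV y z : erel T y z -> (y \in W) && (z \in W) by case/adjT => -> ->.
exists (Subgraph (@erel_sym _ T) Tadj TV); split; first split.
- by split=> [|y z]; [apply/set0Pn; exists x|exact: cT].
- by apply/acyc_ucycle.
- apply: leq_trans kF (leq_trans (subset_leq_card (intsS FT)) _).
  apply/subset_leq_card/subsetP => y yT; rewrite inE /=; apply/andP; split.
    have [z [_ [_ yz _]]] := intsP _ _ yT; by case/adjT: yz.
  by rewrite inE in yT.
Qed.

End Subtrees.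

Section AddEdge.
Variables (G : graph) (u v : 'I_(nvert G)) (uv : u != v).
Local Notation G' := (add_edge uv).

Lemma yes_add_edge k : ivst_yes (G, k) -> ivst_yes (G', k).
Proof.
move=> [T [[cT aT] kT]].
have sub x y : sadj T x y -> @adj G' x y.
  by move=> /sadj_adj xy; rewrite /= /add_rel xy.
by exists (@Subgraph G' (sverts T) (@sadj _ T) (@sadj_sym _ T) sub (@sadj_verts _ T)).
Qed.

(* A solution of [G'] that avoids the new edge would be a solution of [G]. *)
Lemma new_solution_component k : ~ ivst_yes (G, k) -> ivst_yes (G', k) ->
  has_internals (@adj G') [set z | connect (@adj G') u z] k.
Proof.
move=> no [T [tT kT]]; apply: (internals_of_subtree tT _ kT).
have [uvT|uvT] := boolP (sadj T u v); last first.
  case: no; have sub x y : sadj T x y -> @adj G x y.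
    move=> xy; have /or3P[//|/andP[/eqP xu /eqP yv]|/andP[/eqP xv /eqP yu]] := sadj_adj xy.
      by rewrite xu yv (negbTE uvT) in xy.
    by rewrite xv yu sadj_sym (negbTE uvT) in xy.
  exists (@Subgraph G (sverts T) (@sadj _ T) (@sadj_sym _ T) sub (@sadj_verts _ T)).
  exact: (conj tT kT).
apply/subsetP => z zT; rewrite inE; have /andP[uT _] := sadj_verts uvT.
have [[_ cT] _] := tT.
by apply: connect_sub (cT u z uT zT) => x y /sadj_adj; apply: connect1.
Qed.

End AddEdge.

Definition matrix_of n (r : rel 'I_n) : matrix :=
  [seq [seq r i j | j <- enum 'I_n] | i <- enum 'I_n].

Lemma size_matrix_of n (r : rel 'I_n) : size (matrix_of r) = n.
Proof. by rewrite size_map size_enum_ord. Qed.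

Lemma adjm_matrix_of n (r : rel 'I_n) (i j : 'I_n) : adjm (matrix_of r) i j = r i j.
Proof.
rewrite /adjm (nth_map i) ?size_enum_ord // (nth_map j) ?size_enum_ord //.
by rewrite !nth_ord_enum.
Qed.

Lemma enc_matrix_of n (r : rel 'I_n) : enc (matrix_of r) = enc_rel r.
Proof.
rewrite /enc_rel /enc /seq_encoding /matrix_of -map_comp; congr enc_seq; apply: eq_map => i /=.
by rewrite /enc_pred /enc -map_comp.
Qed.

Section InducedGraph.
Variables (M : matrix) (W : seq nat).

(** Irreflexivity and symmetry are forced, so that any matrix and any list give a graph; for an
    adjacency matrix and vertices in range this is the induced adjacency. *)
Definition ind_rel : rel 'I_(size W) := fun i j =>
  [&& i != j, adjm M (nth 0 W i) (nth 0 W j) & adjm M (nth 0 W j) (nth 0 W i)].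

Lemma ind_rel_sym : symmetric ind_rel.
Proof. by move=> i j; rewrite /ind_rel eq_sym [X in _ && X]andbC. Qed.

Lemma ind_rel_irr : irreflexive ind_rel.
Proof. by move=> i; rewrite /ind_rel eqxx. Qed.

Definition ind_graph : graph := Graph ind_rel_sym ind_rel_irr.

End InducedGraph.

Definition k1_graph : graph := ind_graph [::] [:: 0].

Lemma k1_yes : ivst_yes (k1_graph, 0).
Proof.
apply: (@subtree_of_internals k1_graph setT 0 ord0); first exact: in_setT.
  by move=> x y _ _; rewrite (ord1 x) (ord1 y) connect0.
by exists set0; rewrite sub0set acyc0.
Qed.

(** * The kernel of a reoptimization instance *)

Section Kernel.
Variable I : reopt_instance.
Let G := r_graph I.
Let n := nvert G.
Let k := r_param I.
Let G' := (r_new I).1.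
Let u : 'I_n := r_u I.
Let v : 'I_n := r_v I.
Let A : rel 'I_n := @adj G.
Let A' : rel 'I_n := @adj G'.
Let W := core (matrix_of A) (matrix_of A').

(** The instance with finite types replaced by lists, the form on which [kernel] computes; by
    [enc_input] both are encoded by the same tree. *)
Definition input : (matrix * nat) * ((seq bool * matrix) * (matrix * nat)) :=
  ((matrix_of A, k), (([seq x \in sverts (r_tree I) | x <- enum 'I_n], matrix_of (@sadj _ (r_tree I))),
   (matrix_of A', k))).

Definition easy : bool :=
  (k == 0) || (1 < count id [seq x \in sverts (r_tree I) | x <- enum 'I_n]).

Definition kernel_of : ivst_instance :=
  if easy then (k1_graph, 0)
  else if size W <= 2 * k then (ind_graph (matrix_of A') W, k) else (k1_graph, 0).

Lemma enc_input : enc input = enc_reopt I.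
Proof.
rewrite /input /enc_reopt /enc_ivst /enc_subgraph /enc_graph /enc /prod_encoding /=.
rewrite -!enc_matrix_of; congr (Cons _ (Cons (Cons _ _) _)).
by rewrite /enc_pred /enc /seq_encoding -map_comp.
Qed.

Let A's : symmetric A'. Proof. exact: (@adj_sym G'). Qed.
Let A'i : irreflexive A'. Proof. exact: (@adj_irr G'). Qed.

Lemma count_sverts : count id [seq x \in sverts (r_tree I) | x <- enum 'I_n] =
  #|sverts (r_tree I)|.
Proof.
by rewrite count_map cardE -size_filter [in RHS]/enum_mem -enumT.
Qed.

Lemma easy_yes : easy -> ivst_yes (r_new I).
Proof.
move=> e; apply: yes_add_edge; exists (r_tree I); split; first exact: r_is_tree.
case/orP: e => [/eqP k0|c1]; first by rewrite /= -/k k0.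
(* With fewer than [k] internal vertices in the given tree, [r_solution] makes [G] a no-instance,
   and [r_trivial] then reduces the tree to a single vertex. *)
rewrite leqNgt; apply/negP => lt; rewrite count_sverts r_trivial // in c1.
by move/r_solution; rewrite leqNgt lt.
Qed.

(** An internal vertex brings two distinct neighbors into the tree, so a tree with at most one
    vertex has none; since [0 < k], [r_solution] then excludes a solution in [G]. *)
Lemma hard_no : ~~ easy -> 0 < k /\ ~ ivst_yes (G, k).
Proof.
rewrite negb_or -lt0n -leqNgt count_sverts => /andP[k0 le]; split=> //.
move=> /r_solution/(leq_trans k0)/card_gt0P[x].
rewrite inE => /andP[_ /card_gt1P[y [z [+ + yz]]]].
rewrite !inE => /sadj_verts/andP[_ yT] /sadj_verts/andP[_ zT].
by move: le; rewrite leqNgt => /negP; apply; apply/card_gt1P; exists y, z.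
Qed.

Lemma endpointsE : endpoints (matrix_of A) (matrix_of A') =
  [seq x <- iota 0 n | (x == val u) || (x == val v)].
Proof.
have uv : u != v := r_neq I; have nadj : ~~ A u v := r_nonadj I.
have A'E i j : A' i j = [|| A i j, (i == u) && (j == v) | (i == v) && (j == u)] by [].
rewrite /endpoints size_matrix_of; apply: eq_in_filter => x; rewrite mem_iota => /andP[_ xn].
pose i : 'I_n := Ordinal xn; have xE : x = val i by [].
rewrite {}xE !val_eqE; apply/hasP/orP => [[y]|].
  rewrite mem_iota => /andP[_ yn]; have yE : y = val (Ordinal yn : 'I_n) by [].
  rewrite {}yE !adjm_matrix_of A'E; case: (A i _) => //=.
  case: (i == u) => //= [_|]; first by left.
  by case: (i == v) => //=; right.
case=> /eqP ->.
  exists (val v); first by rewrite mem_iota ltn_ord.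
  by rewrite !adjm_matrix_of A'E (negbTE nadj) !eqxx.
exists (val u); first by rewrite mem_iota ltn_ord.
have nadj' : A v u = false by rewrite /A adj_sym; apply: negbTE.
by rewrite !adjm_matrix_of A'E nadj' !eqxx orbT.
Qed.

Lemma coreP : ~ ivst_yes (G, k) -> [/\ @connected_part n A' W,
  ivst_yes (r_new I) <-> has_internals A' (vset n W) k &
  3 < size W -> sparse A' (vset n W) (vset n W)].
Proof.
move=> no; have uv : u != v := r_neq I.
have A'uv : A' u v by rewrite /A' /= /add_rel !eqxx orbT.
have aM i j : adjm (matrix_of A') (i : 'I_n) (j : 'I_n) = A' i j by apply: adjm_matrix_of.
pose U := endpoints (matrix_of A) (matrix_of A').
have Uc : U = [seq x <- iota 0 n | x \in U].
  rewrite [LHS]endpointsE; apply: eq_in_filter => x xn.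
  by rewrite /U endpointsE mem_filter xn andbT.
have uU : val u \in U by rewrite /U endpointsE mem_filter mem_iota eqxx ltn_ord.
have Uu (z : 'I_n) : val z \in U -> connect A' u z.
  rewrite /U endpointsE mem_filter !val_eqE => /andP[/orP[]/eqP-> _]; first exact: connect0.
  exact: connect1.
have [cp szC CE] := componentP A's A'i aM (size_matrix_of _) Uc uU Uu.
have [cpW eqW sp] := iter_reduceP A's A'i aM cp szC.
rewrite /W /core size_matrix_of; split=> //; rewrite -eqW CE; split.
  exact: (new_solution_component no).
have [_ _ cC] := cp; rewrite CE in cC.
by apply: (@subtree_of_internals G' _ k u) cC; rewrite inE connect0.
Qed.

Lemma ind_graph_yes : @connected_part n A' W -> 0 < k ->
  has_internals A' (vset n W) k <-> ivst_yes (ind_graph (matrix_of A') W, k).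
Proof.
(* For empty [W] both sides fail: as [0 < k], an internal vertex would be needed on the left, and a
   graph without vertices has no subtree. *)
move=> [uW Wn cW] k0; have [W0|size0] := posnP (size W).
  split=> [[F [FW _ kF]]|[T [[[/set0Pn[x _] _] _] _]]]; last first.
    by have lt : x < size W := ltn_ord x; exfalso; move: lt; rewrite [X in _ < X]W0.
  have /card_gt0P[x /(subsetP (ints_sub A's A'i FW))] := leq_trans k0 kF.
  by rewrite mem_vset (size0nil W0).
pose J := ind_graph (matrix_of A') W; pose m := size W.
have phiP (i : 'I_m) : nth 0 W i < n by apply: Wn; apply: mem_nth.
pose phi (i : 'I_m) : 'I_n := Ordinal (phiP i).
(* [psi] inverts the numbering [phi] on the core; the default of [insubd], available since [W] is
   nonempty, is taken only outside [vset n W]. *)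
pose psi (x : 'I_n) : 'I_m := insubd (Ordinal size0) (index (val x) W).
have psiV x : x \in vset n W -> val (psi x) = index (val x) W.
  by rewrite mem_vset => xW; rewrite val_insubd index_mem xW.
have phi_psi x : x \in vset n W -> phi (psi x) = x /\ psi x \in [set: 'I_m].
  move=> xW; split; last exact: in_setT.
  by apply: val_inj; rewrite /= psiV // nth_index // -mem_vset.
have phiW i : phi i \in vset n W by rewrite mem_vset mem_nth.
have psi_phi i : i \in [set: 'I_m] -> psi (phi i) = i /\ phi i \in vset n W.
  by move=> _; split=> //; apply: val_inj; rewrite psiV //= index_uniq.
have JE i j : @adj J i j = A' (phi i) (phi j).
  rewrite /= /ind_rel !(@adjm_matrix_of n A' (phi _) (phi _)) [A' (phi j) _]A's andbb.
  by apply: andb_idl; apply: contraTneq => ->; rewrite A'i.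
have JE' x y : x \in vset n W -> y \in vset n W -> A' x y = @adj J (psi x) (psi y).
  by move=> xW yW; rewrite JE (phi_psi x xW).1 (phi_psi y yW).1.
have Js := @adj_sym J; have Ji := @adj_irr J.
split=> [h|[T [tT kT]]]; last first.
  have hJ : has_internals (@adj J) setT k by apply: internals_of_subtree tT (subsetT _) kT.
  exact: (internals_transport Js Ji A's A'i psi_phi phi_psi JE' hJ).
have hJ : has_internals (@adj J) setT k.
  apply: (internals_transport A's A'i Js Ji phi_psi psi_phi _ h) => i j _ _; exact: JE.
apply: (@subtree_of_internals J setT k (Ordinal size0)) hJ; first exact: in_setT.
move=> i j _ _; rewrite -(psi_phi i (in_setT _)).1 -(psi_phi j (in_setT _)).1.
suff : phi j \in vset n W /\ connect (erel (edges (@adj J) setT)) (psi (phi i)) (psi (phi j)).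
  by case.
apply: (connect_closed (P := fun z => z \in vset n W /\
  connect (erel (edges (@adj J) setT)) (psi (phi i)) (psi z))) (cW _ _ (phiW i) (phiW j)) _;
  last by split=> //; apply: connect0.
move=> x y xy [xW cx]; have /and3P[_ yW axy] : [&& x \in vset n W, y \in vset n W & A' x y].
  by rewrite -erel_edges.
split=> //; apply: connect_trans cx (connect1 _).
by rewrite erel_edges // !in_setT -JE'.
Qed.

Lemma kernel_of_correct : kernel_for (r_new I) kernel_of (maxn 1 (2 * r_param I)).
Proof.
have triv : ivst_yes (r_new I) ->
    kernel_for (r_new I) (k1_graph, 0) (maxn 1 (2 * r_param I)).
  by move=> y; split; rewrite ?leq_max //=; split=> // _; apply: k1_yes.
rewrite /kernel_of; case: ifPn => [/easy_yes|/hard_no[k0 no]]; first exact: triv.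
have [cpW yesW sp] := coreP no.
case: leqP => [le|lt]; last by apply/triv/yesW/large_yes.
split; rewrite /= ?leq_max ?le ?orbT //; last by rewrite -/k; lia.
by rewrite yesW; apply: ind_graph_yes.
Qed.

Lemma enc_ind_graph : @connected_part n A' W ->
  enc_graph (ind_graph (matrix_of A') W) = enc [seq [seq adjm (matrix_of A') x y | y <- W] | x <- W].
Proof.
move=> [uW Wn _]; rewrite /enc_graph -enc_matrix_of; congr enc.
have WE : W = [seq nth 0 W (val i) | i <- enum 'I_(size W)].
  by rewrite (map_comp (nth 0 W) val) val_enum_ord map_nth_iota0 // take_size.
rewrite [X in _ = [seq _ | x <- X]]WE -map_comp; apply: eq_map => i /=.
rewrite [X in _ = [seq _ | x <- X]]WE -map_comp; apply: eq_map => j /=.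
have lt (l : 'I_(size W)) : nth 0 W l < n by apply: Wn; apply: mem_nth.
rewrite /ind_rel -[nth 0 W i]/(val (Ordinal (lt i))) -[nth 0 W j]/(val (Ordinal (lt j))).
rewrite !adjm_matrix_of [A' (Ordinal (lt j)) _]A's andbb.
apply: andb_idl; apply: contraTneq => ->; by rewrite A'i.
Qed.

Lemma enc_k1 : enc_ivst (k1_graph, 0) = enc yes_kernel.
Proof.
have E1 : enum 'I_(size [:: 0]) = [:: ord0] by rewrite enum_ordSl enum_ord0.
by rewrite /enc_ivst /enc_graph -enc_matrix_of /matrix_of E1 /= /ind_rel eqxx.
Qed.

Lemma enc_kernel_of : enc_ivst kernel_of = enc (kernel input).
Proof.
rewrite /kernel /kernel_of -/easy /= -/W; case: ifPn => [_|/hard_no[_ no]]; first exact: enc_k1.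
case: ifP => _; last exact: enc_k1.
have [cpW _ _] := coreP no.
by rewrite /enc_ivst enc_ind_graph.
Qed.

End Kernel.

(* For k > 0 the bound is 2k.  For k = 0 the bound 0 is unattainable: (G+e, 0)
   is a yes-instance, whereas the graph without vertices has no subtree. *)
Theorem theorem4 :
  exists f : reopt_instance -> ivst_instance,
    polytime enc_reopt enc_ivst f /\
    forall I : reopt_instance,
      kernel_for (r_new I) (f I) (maxn 1 (2 * r_param I)).
Proof.
exists kernel_of; split; last exact: kernel_of_correct.
have [p [C [d H]]] := polyf_polytime polyf_kernel.
exists p, C, d => I; have [t [s [e o l]]] := H (input I).
by exists t, s; rewrite -enc_input enc_kernel_of.
Qed.
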